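(* Let $n\ge2$ and let $C\in\mathcal K_{(0)}(\mathbb R^n)$ have $C^{1,1}$ boundary. Then $$\Omega_n(C)=2^{\frac{n-1}2}\lim_{\lambda\to1^-}\Omega_C(\lambda C)\,(1-\lambda)^{\frac{n-1}2},$$ where $\Omega_C$ is the Busemann floating area and $\Omega_n$ is the centro-affine surface area.
   Context: $\mathcal K_{(0)}(\mathbb R^n)$ is the set of compact convex subsets of $\mathbb R^n$ containing the origin in their interior. For $x\in\mathrm{int}\,C$ and $v\in\mathbb R^n\setminus\{0\}$ let $\|v\|_x=\frac12\big(\frac1{t^+}+\frac1{t^-}\big)$, where $t^\pm>0$ are determined by $x\pm t^\pm v\in\partial C$ (and $\|0\|_x=0$); this is the Finsler norm of the Hilbert metric on $\mathrm{int}\,C$. Let $I^C_x=\{v:\|v\|_x\le1\}$. The density of the Busemann volume with respect to Lebesgue measure $\lambda_n$ is $\sigma_C(x)=v_n/\lambda_n(I^C_x)$, $v_n$ being the volume of the Euclidean unit ball of $\mathbb R^n$. For a compact convex set $K\subset\mathrm{int}\,C$ with non-empty interior, the Busemann floating area is $$\Omega_C(K)=\int_{\partial K}H_{n-1}(K,x)^{\frac1{n+1}}\sigma_C(x)^{\frac{n-1}{n+1}}\,dx.$$ The centro-affine surface area of $C$ is $$\Omega_n(C)=\int_{\partial C}\frac{H_{n-1}(C,x)^{\frac12}}{(x\cdot n_C(x))^{\frac{n-1}2}}\,dx,$$ with $n_C(x)$ the outer unit normal. $H_{n-1}(K,x)$ is the (generalized) Euclidean Gauss–Kronecker curvature, existing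 for almost every $x\in\partial K$: at a point $x$ with unique outer unit normal $n_K(x)$ where $\partial K$ is locally $\{x+v-f(v)n_K(x)\}$, $v\perp n_K(x)$, with $f\ge0$ convex, $f(0)=0$ and $f(w)=\frac12Aw\cdot w+o(\|w\|^2)$, it equals $\det A$. Integration over boundaries is with respect to $(n-1)$-dimensional Hausdorff measure. *)

(* Defs.v *)
(* R^n is 'rV[R]_n; its canonical norm is the sup norm,
   used only for its topology and for "Lipschitz for some constant". *)
From HB Require Import structures.
From mathcomp Require Import all_boot all_order all_algebra.
From mathcomp Require Import all_classical all_reals all_analysis.

Set Implicit Arguments.
Unset Strict Implicit.
Unset Printing Implicit Defensive.
Import Order.TTheory GRing.Theory Num.Theory numFieldNormedType.Exports.
Local Open Scope classical_set_scope.
Local Open Scope ring_scope.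

Section Euclidean.
Context {R : realType} {n : nat}.
Implicit Types (A : set 'rV[R]_n) (a b x y : 'rV[R]_n).

Definition dot x y : R := (x *m y^T) 0 0.

Definition enorm x : R := Num.sqrt (dot x x).

Definition eball (r : R) : set 'rV[R]_n := [set x | enorm x < r].

Definition closed_eball (r : R) : set 'rV[R]_n := [set x | enorm x <= r].

Definition boundary A := closure A `\` interior A.

Definition diam A : \bar R :=
  ereal_sup [set (enorm (p.1 - p.2))%:E | p in A `*` A].

Definition box a b : set 'rV[R]_n := [set x | forall i, a 0 i <= x 0 i <= b 0 i].

(* +oo on the sets that are not boxes *)
Definition box_volume A : \bar R :=
  if A == set0 then 0%E
  else ereal_inf [set (\prod_i (p.2 0 i - p.1 0 i))%:E
                 | p in [set p : 'rV[R]_n * 'rV[R]_n | A = box p.1 p.2]].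

End Euclidean.

Section OuterMeasures.
Context {R : realType} {T : pointedType}.
Implicit Types (g : set T -> \bar R) (A : set T).

(* inf { \sum_k g (F k) | F a countable cover of A } : mu_ext over the
   sigma-algebra of all subsets of T *)
Definition cover_outer g A : \bar R :=
  @mu_ext _ (g_sigma_algebraType [set: set T]) R g A.

Section Properties.
Variable g : set T -> \bar R.
Hypotheses (g0 : g set0 = 0%E) (g_ge0 : forall A, (0 <= g A)%E).

Lemma cover_outer0 : cover_outer g set0 = 0%E.
Proof. exact: mu_ext0. Qed.

Lemma cover_outer_ge0 A : (0 <= cover_outer g A)%E.
Proof. exact: mu_ext_ge0. Qed.

Lemma le_cover_outer :
  {homo cover_outer g : A B / A `<=` B >-> (A <= B)%E}.
Proof. exact: (@le_mu_ext _ (g_sigma_algebraType [set: set T])). Qed.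

Lemma cover_outer_sigma_subadditive : sigma_subadditive (cover_outer g).
Proof. exact: (@mu_ext_sigma_subadditive _ (g_sigma_algebraType [set: set T])).  Qed.

End Properties.
End OuterMeasures.

Section Lebesgue.
Context {R : realType} (n : nat).

(* Lebesgue outer measure on R^n; it is Lebesgue measure on the measurable
   sets *)
Definition lebesgue_outer : set 'rV[R]_n -> \bar R := cover_outer box_volume.

Lemma box_volume0 : box_volume (set0 : set 'rV[R]_n) = 0%E.
Proof. by rewrite /box_volume eqxx. Qed.

Lemma box_volume_ge0 (A : set 'rV[R]_n) : (0 <= box_volume A)%E.
Proof.
rewrite /box_volume; case: ifPn => // /set0P[x Ax].
apply: le_ereal_inf_tmp => _ /= [p Ap <-]; rewrite lee_fin prodr_ge0// => i _.
move: Ax; rewrite Ap => /(_ i)/andP[ax xb].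
by rewrite subr_ge0 (le_trans ax).
Qed.

HB.instance Definition _ := isOuterMeasure.Build R 'rV[R]_n lebesgue_outer
  (cover_outer0 box_volume0 box_volume_ge0)
  (cover_outer_ge0 box_volume_ge0)
  (@le_cover_outer _ _ _)
  (cover_outer_sigma_subadditive box_volume_ge0).

Definition unit_ball_volume : R := fine (lebesgue_outer (closed_eball 1)).

End Lebesgue.

Section Hausdorff.
Context {R : realType} (d n : nat).
Implicit Types (A : set 'rV[R]_n) (delta : R).

Definition hausdorff_gauge delta A : \bar R :=
  if A == set0 then 0%E
  else if (diam A <= delta%:E)%E
       then ((unit_ball_volume d / 2 ^+ d : R)%:E * diam A ^+ d)%E
       else +oo%E.

(* d-dimensional Hausdorff (outer) measure on R^n, normalised so that it agrees
   with Lebesgue measure when d = n *)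
Definition hausdorff A : \bar R :=
  ereal_sup [set cover_outer (hausdorff_gauge delta) A
            | delta in [set delta | 0 < delta]].

Lemma hausdorff_gauge0 delta : hausdorff_gauge delta set0 = 0%E.
Proof. by rewrite /hausdorff_gauge eqxx. Qed.

Lemma hausdorff_gauge_ge0 delta A : (0 <= hausdorff_gauge delta A)%E.
Proof.
rewrite /hausdorff_gauge; case: ifPn => // /set0P[x Ax].
case: ifP => // _; apply: mule_ge0.
  rewrite lee_fin divr_ge0 ?exprn_ge0// fine_ge0//.
  exact: outer_measure_ge0.
apply: expe_ge0; apply: (@le_trans _ _ (enorm (x - x))%:E).
  by rewrite lee_fin sqrtr_ge0.
by apply: ereal_sup_ubound; exists (x, x).
Qed.

Let hausdorff_ge0 A : (0 <= hausdorff A)%E.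
Proof.
apply: (@le_trans _ _ (cover_outer (hausdorff_gauge 1) A)).
  exact/cover_outer_ge0/hausdorff_gauge_ge0.
by apply: ereal_sup_ubound; exists 1 => //=.
Qed.

Let hausdorff0 : hausdorff set0 = 0%E.
Proof.
apply/eqP; rewrite eq_le hausdorff_ge0 andbT.
apply: ge_ereal_sup => _ [delta _ <-]; rewrite cover_outer0//.
  exact: hausdorff_gauge0.
exact: hausdorff_gauge_ge0.
Qed.

Let le_hausdorff : {homo hausdorff : A B / A `<=` B >-> (A <= B)%E}.
Proof.
move=> A B AB; apply: ge_ereal_sup => _ [delta delta0 <-].
apply: le_trans (le_cover_outer _ AB) _.
by apply: ereal_sup_ubound; exists delta.
Qed.

Let hausdorff_sigma_subadditive : sigma_subadditive hausdorff.
Proof.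
move=> F; apply: ge_ereal_sup => _ [delta delta0 <-].
apply: le_trans (cover_outer_sigma_subadditive _ _) _.
  exact: hausdorff_gauge_ge0.
apply: lee_nneseries => k _.
  by move=> _; exact/cover_outer_ge0/hausdorff_gauge_ge0.
by apply: ereal_sup_ubound; exists delta.
Qed.

HB.instance Definition _ := isOuterMeasure.Build R 'rV[R]_n hausdorff
  hausdorff0 hausdorff_ge0 le_hausdorff hausdorff_sigma_subadditive.

Definition hausdorff_measure :
  set (caratheodory_type hausdorff) -> \bar R := hausdorff.

HB.instance Definition _ := isMeasure.Build _ _ _ hausdorff_measure
  (caratheodory_measure0 hausdorff) (caratheodory_measure_ge0 (mu := hausdorff))
  (@caratheodory_measure_sigma_additive _ _ hausdorff).

End Hausdorff.

Section Boundary.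
Context {R : realType} {n : nat}.
Implicit Types (S K C : set 'rV[R]_n) (x u v : 'rV[R]_n) (r : R).

(* the n.-1 rows of B form an orthonormal basis of the hyperplane orthogonal
   to u, which is thus parametrised by w |-> w *m B, w in R^(n-1) *)
Definition orthonormal_frame u (B : 'M[R]_(n.-1, n)) :=
  [/\ enorm u = 1, B *m B^T = 1%:M & B *m u^T = 0].

Definition local_graph S x u (B : 'M[R]_(n.-1, n)) r (f : 'rV[R]_n.-1 -> R^o) :=
  \forall y \near x,
    S y <-> exists2 w, eball r w & y = x + w *m B - f w *: u.

Definition gradient m (f : 'rV[R]_m -> R^o) (w : 'rV[R]_m) : 'rV[R]_m :=
  \row_i 'd f w (delta_mx 0 i).

Definition C11_on m (D : set 'rV[R]_m) (f : 'rV[R]_m -> R^o) :=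
  (forall w, D w -> differentiable f w) /\
  exists k : R, k.-lipschitz_D (gradient f).

Definition C11_boundary C :=
  forall x, boundary C x -> exists u B r f,
    [/\ orthonormal_frame u B, 0 < r, C11_on (eball r) f &
        local_graph (boundary C) x u B r f].

Definition outer_unit_normal K x u :=
  enorm u = 1 /\ forall y, K y -> dot (y - x) u <= 0.

(* f w = 2^-1 (A w . w) + o(|w|^2) as w -> 0 *)
Definition second_order_expansion m (f : 'rV[R]_m -> R^o) (A : 'M[R]_m) :=
  forall e : R, 0 < e ->
    \forall w \near (0 : 'rV[R]_m),
      `|f w - 2^-1 * dot (w *m A) w| <= e * enorm w ^+ 2.

Definition curvature_spec K x (h : R) :=
  exists u B r f (A : 'M[R]_n.-1),
    [/\ outer_unit_normal K x u
      & forall u', outer_unit_normal K x u' -> u' = u] /\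
    [/\ orthonormal_frame u B, 0 < r & local_graph (boundary K) x u B r f] /\
    [/\ forall w, eball r w -> 0 <= f w, f 0 = 0
      & @convex_function R 'rV[R]_n.-1 (eball r) f] /\
    [/\ A^T = A, second_order_expansion f A & h = \det A].

(* H_(n-1)(K, x); 0 where the curvature does not exist *)
Definition gauss_kronecker K x : R := xget 0 [set h | curvature_spec K x h].

Definition normal K x : 'rV[R]_n := xget 0 [set u | outer_unit_normal K x u].

Definition surface_measure := @hausdorff_measure R n.-1 n.

End Boundary.

Section Hilbert.
Context {R : realType} {n : nat}.
Implicit Types (C K : set 'rV[R]_n) (x v : 'rV[R]_n).

Definition convex_bodies_around0 : set (set 'rV[R]_n) :=
  [set C | [/\ compact C, @convex_set R 'rV[R]_n C & interior C 0]].

Definition exit_time C x v : R :=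
  xget 0 [set t | 0 < t /\ boundary C (x + t *: v)].

Definition hilbert_norm C x v : R :=
  if v == 0 then 0 else 2^-1 * ((exit_time C x v)^-1 + (exit_time C x (- v))^-1).

Definition hilbert_unit_ball C x := [set v | hilbert_norm C x v <= 1].

Definition busemann_density C x : R :=
  unit_ball_volume n / fine (lebesgue_outer (hilbert_unit_ball C x)).

Definition busemann_floating_area C K : \bar R :=
  (\int[surface_measure]_(x in boundary K)
     (gauss_kronecker K x `^ (n.+1%:R^-1)
      * busemann_density C x `^ (n.-1%:R / n.+1%:R))%:E)%E.

Definition centro_affine_area C : \bar R :=
  (\int[surface_measure]_(x in boundary C)
     (gauss_kronecker C x `^ (2^-1)
      / dot x (normal C x) `^ (n.-1%:R / 2))%:E)%E.

End Hilbert.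

(* Main.v *)
(* Put [lambda = 1 - q ^ 2]. Scaling [lambda C] back to [C] turns the rescaled
   floating area into the integral over the boundary of [C] of
   [H(y) ^ (1/(n+1)) (sigma_C(lambda y) q ^ (n+1)) ^ ((n-1)/(n+1))], up to a
   factor tending to [1].
   If the curvature [H] exists and is not zero at [y], the part of [C] seen from
   [lambda y] at scales [q] along the boundary and [q ^ 2] across it tends to a
   paraboloid, whose Hilbert unit ball at the corresponding point is an
   ellipsoid; its volume gives
   [sigma_C(lambda y) q ^ (n+1) --> sqrt H / (2 (y . n_C(y))) ^ ((n+1)/2)].
   Where [H] is zero both integrands vanish. Since the boundary is C^{1,1}, the
   Hilbert ball at [lambda y] contains an ellipsoid of volume of order
   [q ^ (n+1)], uniformly in [y], so that dominated convergence applies.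
   [H] is not known to be measurable here: the integrals are lower integrals, and
   [H ^ (1/(n+1))] is replaced by a largest measurable minorant. *)
From HB Require Import structures.
Require Import Defs.
From mathcomp Require Import all_boot all_order all_algebra.
From mathcomp Require Import all_classical all_reals all_analysis.
From mathcomp Require Import measurable_realfun.
From mathcomp Require Import ring lra.

Set Implicit Arguments.
Unset Strict Implicit.
Unset Printing Implicit Defensive.
Import Order.TTheory GRing.Theory Num.Theory numFieldNormedType.Exports.
Local Open Scope classical_set_scope.
Local Open Scope ring_scope.

(** * Euclidean norm and orthonormal frames *)

Section EuclideanTheory.
Context {R : realType} {n : nat}.
Implicit Types (x y z : 'rV[R]_n) (A : 'M[R]_n).

Lemma dotE x y : dot x y = \sum_i x 0 i * y 0 i.
Proof. by rewrite /dot mxE; apply: eq_bigr => i _; rewrite mxE. Qed.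

Lemma dotC x y : dot x y = dot y x.
Proof. by rewrite !dotE; apply: eq_bigr => i _; rewrite mulrC. Qed.

Lemma dotDl x y z : dot (x + y) z = dot x z + dot y z.
Proof. by rewrite /dot mulmxDl mxE. Qed.

Lemma dotZl a x y : dot (a *: x) y = a * dot x y.
Proof. by rewrite /dot -scalemxAl mxE. Qed.

Lemma dotDr x y z : dot x (y + z) = dot x y + dot x z.
Proof. by rewrite dotC dotDl !(dotC x). Qed.

Lemma dotZr a x y : dot x (a *: y) = a * dot x y.
Proof. by rewrite dotC dotZl dotC. Qed.

Lemma dotNl x y : dot (- x) y = - dot x y.
Proof. by rewrite -scaleN1r dotZl mulN1r. Qed.

Lemma dotNr x y : dot x (- y) = - dot x y.
Proof. by rewrite dotC dotNl dotC. Qed.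

Lemma dotBl x y z : dot (x - y) z = dot x z - dot y z.
Proof. by rewrite dotDl dotNl. Qed.

Lemma dotBr x y z : dot x (y - z) = dot x y - dot x z.
Proof. by rewrite dotDr dotNr. Qed.

Lemma dot0l x : dot 0 x = 0.
Proof. by rewrite /dot mul0mx mxE. Qed.

Lemma dot0r x : dot x 0 = 0.
Proof. by rewrite dotC dot0l. Qed.

Lemma dot_ge0 x : 0 <= dot x x.
Proof. by rewrite dotE sumr_ge0// => i _; rewrite -expr2 sqr_ge0. Qed.

Lemma dot_eq0 x : dot x x = 0 -> x = 0.
Proof.
rewrite dotE => /eqP; rewrite psumr_eq0; last first.
  by move=> i _; rewrite -expr2 sqr_ge0.
move=> /allP x0; apply/rowP => i; rewrite mxE.
by have /x0/implyP := mem_index_enum i; rewrite mulf_eq0 orbb => /(_ isT)/eqP.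
Qed.

Lemma dot_gt0 x : x != 0 -> 0 < dot x x.
Proof.
by move=> x0; rewrite lt_neqAle dot_ge0 andbT eq_sym; apply: contra x0 => /eqP/dot_eq0 ->.
Qed.

Lemma dot_mulmx m (x : 'rV[R]_m) y (M : 'M[R]_(m, n)) :
  dot (x *m M) y = dot x (y *m M^T).
Proof. by rewrite /dot trmx_mul trmxK mulmxA. Qed.

Lemma psd_dot_sqr A x y : A^T = A -> (forall w, 0 <= dot (w *m A) w) ->
  dot (x *m A) y ^+ 2 <= dot (x *m A) x * dot (y *m A) y.
Proof.
move=> symA psd; have AC u v : dot (u *m A) v = dot (v *m A) u.
  by rewrite dot_mulmx symA dotC.
have H t : 0 <= dot (x *m A) x + t * dot (x *m A) y *+ 2 + t ^+ 2 * dot (y *m A) y.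
  have := psd (x + t *: y).
  rewrite mulmxDl -scalemxAl !dotDl !dotDr !dotZl !dotZr (AC y x).
  by rewrite mulr2n expr2 -!mulrA !addrA.
have [y0|y0] := eqVneq (dot (y *m A) y) 0; last first.
  have := H (- dot (x *m A) y / dot (y *m A) y).
  have yp : 0 < dot (y *m A) y by rewrite lt_neqAle psd andbT eq_sym.
  rewrite -(pmulr_lge0 _ yp); set b := dot (x *m A) y; set c := dot (y *m A) y.
  set a := dot (x *m A) x => abc; rewrite -subr_ge0.
  suff <- : (a + (- b / c * b) *+ 2 + (- b / c) ^+ 2 * c) * c = a * c - b ^+ 2 by [].
  by rewrite mulr2n; field.
move: H; rewrite y0 => H; rewrite mulr0; set b := dot (x *m A) y in H *.
have [->|b0] := eqVneq b 0; first by rewrite expr0n.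
have := H (- (dot (x *m A) x + 1) / b).
rewrite mulr0 addr0 divfK//; have := psd x; lra.
Qed.

Lemma dot_sqr_le x y : dot x y ^+ 2 <= dot x x * dot y y.
Proof.
have := @psd_dot_sqr 1%:M x y (@trmx1 _ _).
by rewrite !mulmx1; apply=> w; rewrite mulmx1 dot_ge0.
Qed.

Lemma enorm_ge0 x : 0 <= enorm x. Proof. exact: sqrtr_ge0. Qed.

Lemma enorm_sqr x : enorm x ^+ 2 = dot x x.
Proof. by rewrite sqr_sqrtr// dot_ge0. Qed.

Lemma enorm0 : enorm (0 : 'rV[R]_n) = 0.
Proof. by rewrite /enorm dot0l sqrtr0. Qed.

Lemma enorm_eq0 x : enorm x = 0 -> x = 0.
Proof. by move=> x0; apply: dot_eq0; rewrite -enorm_sqr x0 expr0n. Qed.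

Lemma enormZ a x : enorm (a *: x) = `|a| * enorm x.
Proof. by rewrite /enorm dotZl dotZr mulrA -expr2 sqrtrM ?sqr_ge0// sqrtr_sqr. Qed.

Lemma enormN x : enorm (- x) = enorm x.
Proof. by rewrite -scaleN1r enormZ normrN1 mul1r. Qed.

Lemma dot_le_enorm x y : `|dot x y| <= enorm x * enorm y.
Proof.
rewrite -[leRHS]ger0_norm ?mulr_ge0 ?enorm_ge0//.
by rewrite -ler_sqr ?nnegrE// !real_normK ?num_real// exprMn !enorm_sqr dot_sqr_le.
Qed.

Lemma enorm_le_sqr x a : 0 <= a -> (enorm x <= a) = (dot x x <= a ^+ 2).
Proof. by move=> a0; rewrite -ler_sqr ?nnegrE ?enorm_ge0// enorm_sqr. Qed.

Lemma ler_enormD x y : enorm (x + y) <= enorm x + enorm y.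
Proof.
rewrite enorm_le_sqr ?addr_ge0 ?enorm_ge0// sqrrD !enorm_sqr dotDl !dotDr (dotC y x).
have := dot_le_enorm x y; have := ler_norm (dot x y); lra.
Qed.

Lemma ler_enormB x y : enorm (x - y) <= enorm x + enorm y.
Proof. by rewrite -(enormN y) ler_enormD. Qed.

Lemma enormBC x y : enorm (x - y) = enorm (y - x).
Proof. by rewrite -enormN opprB. Qed.

Lemma coord_le_enorm x i : `|x 0 i| <= enorm x.
Proof.
rewrite -[leRHS]ger0_norm ?enorm_ge0// -ler_sqr ?nnegrE//.
rewrite !real_normK ?num_real// enorm_sqr dotE (bigD1 i)//= -expr2 lerDl.
by rewrite sumr_ge0// => j _; rewrite -expr2 sqr_ge0.
Qed.

Lemma coord_le_norm x i : `|x 0 i| <= `|x|.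
Proof.
rewrite /Num.norm/= mx_normrE.
exact: (@le_bigmax _ _ _ 0 (fun p : 'I_1 * 'I_n => `|x p.1 p.2|) (0, i)).
Qed.

Lemma norm_le_enorm x : `|x| <= enorm x.
Proof.
rewrite {1}/Num.norm/= mx_normrE; apply: bigmax_le; first exact: enorm_ge0.
by move=> [i j] _/=; rewrite (ord1 i) coord_le_enorm.
Qed.

Lemma enorm_le_norm x : enorm x <= n%:R * `|x|.
Proof.
rewrite enorm_le_sqr ?mulr_ge0// dotE.
apply: (@le_trans _ _ (\sum_(i < n) `|x| ^+ 2)).
  apply: ler_sum => i _; rewrite -expr2 -real_normK ?num_real//.
  by rewrite ler_sqr ?nnegrE// coord_le_norm.
rewrite sumr_const card_ord -[leLHS]mulr_natl exprMn ler_wpM2r ?sqr_ge0// -natrX ler_nat.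
by case: (n) => // m; rewrite leq_pmull.
Qed.

Lemma nbhs_enormP x (P : set 'rV[R]_n) :
  nbhs x P <-> exists2 e : R, 0 < e & forall y, enorm (y - x) < e -> P y.
Proof.
split.
  move=> /nbhs_ballP[e /= e0 eP]; exists e => // y yx; apply: eP.
  by rewrite -ball_normE/= distrC (le_lt_trans (norm_le_enorm _)).
move=> [e e0 eP]; apply/nbhs_ballP; exists (e / n.+1%:R) => /=; first exact: divr_gt0.
move=> y; rewrite -ball_normE/= distrC => yx; apply: eP.
apply: (le_lt_trans (enorm_le_norm _)).
rewrite ltr_pdivlMr// mulrC in yx; apply: le_lt_trans yx.
by rewrite ler_wpM2r// ler_nat.
Qed.

Lemma near_enorm x (e : R) : 0 < e -> \forall y \near x, enorm (y - x) < e.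
Proof. by move=> e0; apply/nbhs_enormP; exists e. Qed.

Lemma interior_enormP (C : set 'rV[R]_n) x :
  interior C x <-> exists2 e : R, 0 < e & forall y, enorm (y - x) < e -> C y.
Proof. exact: nbhs_enormP. Qed.

End EuclideanTheory.

Section Frame.
Context {R : realType} {d : nat}.
Implicit Types (u v : 'rV[R]_d.+1) (B : 'M[R]_(d, d.+1)) (w : 'rV[R]_d).

Lemma enorm_eq1 u : enorm u = 1 -> u *m u^T = 1%:M.
Proof.
move=> u1; apply/matrixP => i j; rewrite !ord1 -[LHS]/(dot u u) -enorm_sqr u1.
by rewrite expr1n mxE eqxx.
Qed.

Lemma frame_mxE u B : orthonormal_frame u B ->
  (col_mx u B : 'M[R]_(1 + d)) *m (col_mx u B)^T = 1%:M.
Proof.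
move=> [u1 BB Bu]; rewrite tr_col_mx mul_col_row enorm_eq1// BB Bu.
by rewrite -[u *m B^T]trmxK trmx_mul trmxK Bu trmx0 -scalar_mx_block.
Qed.

Lemma frame_det u B : orthonormal_frame u B ->
  \det (col_mx u B : 'M[R]_(1 + d)) ^+ 2 = 1.
Proof. by move=> /frame_mxE uB; rewrite expr2 -{2}det_tr -det_mulmx uB det1. Qed.

Lemma frame_id u B : orthonormal_frame u B -> B^T *m B + u^T *m u = 1%:M.
Proof.
move=> /frame_mxE/mulmx1C; rewrite tr_col_mx mul_row_col => <-.
by rewrite addrC.
Qed.

Lemma frame_decomp u B v : orthonormal_frame u B ->
  v = v *m B^T *m B + dot v u *: u.
Proof.
move=> /frame_id uB; rewrite -{1}[v]mulmx1 -uB mulmxDr !mulmxA; congr (_ + _).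
by apply/rowP => i; rewrite !mxE big_ord_recl big_ord0 addr0 /dot.
Qed.

Lemma frame_dot u B v v' : orthonormal_frame u B ->
  dot v v' = dot (v *m B^T) (v' *m B^T) + dot v u * dot v' u.
Proof.
move=> uB; rewrite {1}(frame_decomp v uB) dotDl dotZl dot_mulmx; congr (_ + _ * _).
exact: dotC.
Qed.

Lemma frame_coord u B w s : orthonormal_frame u B -> (w *m B + s *: u) *m B^T = w.
Proof.
move=> [u1 BB Bu]; rewrite mulmxDl -mulmxA BB mulmx1 -scalemxAl.
by rewrite -[u *m B^T]trmxK trmx_mul trmxK Bu trmx0 scaler0 addr0.
Qed.

Lemma frame_dotu u B w s : orthonormal_frame u B -> dot (w *m B + s *: u) u = s.
Proof.
move=> [u1 BB Bu]; rewrite dotDl dotZl -enorm_sqr u1 expr1n mulr1.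
by rewrite dot_mulmx -[u *m B^T]trmxK trmx_mul trmxK Bu trmx0 dot0r add0r.
Qed.

Lemma frame_enorm u B w : orthonormal_frame u B -> enorm (w *m B) = enorm w.
Proof. by move=> [_ BB _]; rewrite /enorm dot_mulmx -mulmxA BB mulmx1. Qed.

Lemma frame_enorm_le u B v : orthonormal_frame u B -> enorm (v *m B^T) <= enorm v.
Proof.
move=> uB; rewrite enorm_le_sqr ?enorm_ge0// enorm_sqr (frame_dot v v uB).
by rewrite lerDl -expr2 sqr_ge0.
Qed.

Lemma frame_dotu_le u B v : orthonormal_frame u B -> `|dot v u| <= enorm v.
Proof. by move=> [u1 _ _]; rewrite (le_trans (dot_le_enorm _ _))// u1 mulr1. Qed.

End Frame.

(** * Lebesgue outer measure of boxes, linear images and ellipsoids *)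

Section BoxVolume.
Context {R : realType}.
Local Open Scope ereal_scope.

Lemma lebesgue_measure_itvcc (a b : R) : (a <= b)%R ->
  lebesgue_measure (`[a, b]%classic : set R) = (b - a)%:E.
Proof.
move=> ab; rewrite lebesgue_measure_itv/= lte_fin; case: ltP => // ba.
by rewrite (@le_anti _ _ a b) ?subrr// ab.
Qed.

(* Induction on the dimension: the hypothesis on the slice at height [t] is
   integrated against one-dimensional Lebesgue measure. *)
Lemma prod_le_nneseries n (a b : nat -> R) (A B : nat -> nat -> R)
    (c : nat -> R) (V : R) :
  (0 <= V)%R -> (forall i, (a i <= b i)%R) -> (forall k, (0 <= c k)%R) ->
  (forall k i, (A k i <= B k i)%R) ->
  (forall x : nat -> R, (forall i, (i < n)%N -> (a i <= x i <= b i)%R) ->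
    V%:E <= \sum_(k <oo) (c k * [forall i : 'I_n, (A k i <= x i <= B k i)%R]%:R)%:E) ->
  (V * \prod_(i < n) (b i - a i))%:E <=
    \sum_(k <oo) (c k * \prod_(i < n) (B k i - A k i))%:E.
Proof.
move=> V0; elim: n a b A B c => [|n IH] a b A B c ab c0 AB H.
  rewrite big_ord0 mulr1; apply: le_trans (H (fun=> 0%R) _) _ => //.
  apply: lee_nneseries => k; first by move=> *; rewrite lee_fin mulr_ge0.
  by rewrite big_ord0; case: [forall _, _]; rewrite lee_fin ?mulr1 ?mulr0.
have pos k : (0 <= \prod_(i < n) (B k i.+1 - A k i.+1))%R.
  by rewrite prodr_ge0// => i _; rewrite subr_ge0.
have mI k : measurable_fun [set: R] (\1_`[A k 0%N, B k 0%N] : R -> R).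
  exact: measurable_indic.
set W := (V * \prod_(i < n) (b i.+1 - a i.+1))%R.
have slice (t : R) : `[a 0%N, b 0%N]%classic t ->
    W%:E <= \sum_(k <oo) ((c k * \prod_(i < n) (B k i.+1 - A k i.+1)) *
                           \1_`[A k 0%N, B k 0%N] t)%:E.
  rewrite /= in_itv/= => tab.
  under eq_eseriesr => k _ do rewrite mulrAC.
  apply: (IH (fun i => a i.+1) (fun i => b i.+1) (fun k i => A k i.+1)
    (fun k i => B k i.+1) (fun k => c k * \1_`[A k 0%N, B k 0%N] t)%R) => //.
    by move=> k; rewrite mulr_ge0.
  move=> x xab.
  apply: le_trans (H (fun i => if i is j.+1 then x j else t) _) _.
    by case=> // j; rewrite ltnS => /xab.
  apply: lee_nneseries => k; first by move=> *; rewrite lee_fin mulr_ge0.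
  rewrite lee_fin -mulrA ler_wpM2l//.
  case: forallP => [all_k|_]; last by rewrite mulr_ge0.
  rewrite indicE mem_set ?mul1r; last by have := all_k ord0; rewrite /= in_itv.
  rewrite (_ : [forall _, _] = true)//; apply/forallP => i.
  by have := all_k (lift ord0 i); rewrite lift0.
have mab : measurable `[a 0%N, b 0%N] by exact: measurable_itv.
have W0 : (0 <= W)%R by rewrite mulr_ge0// prodr_ge0// => i _; rewrite subr_ge0.
have -> : (V * \prod_(i < n.+1) (b i - a i))%:E =
    \int[@lebesgue_measure R]_(t in `[a 0%N, b 0%N]) cst W%:E t.
  rewrite integral_cst// big_ord_recl mulrCA EFinM muleC; congr (_ * _).
  exact/esym/lebesgue_measure_itvcc.
have mf k : measurable_fun `[a 0%N, b 0%N] (fun t : R =>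
    ((c k * \prod_(i < n) (B k i.+1 - A k i.+1)) * \1_`[A k 0%N, B k 0%N] t)%:E).
  by apply/measurable_EFinP/measurable_funM => //; exact: measurable_funTS.
have msum : measurable_fun `[a 0%N, b 0%N] (fun t : R => \sum_(k <oo)
    ((c k * \prod_(i < n) (B k i.+1 - A k i.+1)) * \1_`[A k 0%N, B k 0%N] t)%:E).
  by apply: ge0_emeasurable_sum => // k t _ _; rewrite lee_fin !mulr_ge0.
have le := @ge0_le_integral _ _ R (@lebesgue_measure R) _ mab (cst W%:E) _
  (fun _ _ => W0) (measurable_cst _) msum slice.
apply: (le_trans le); clear le.
rewrite integral_nneseries//=; last by move=> k t _; apply: mulr_ge0 => //; apply: mulr_ge0.
apply: lee_nneseries => k.
  by move=> *; rewrite integral_ge0// => t _; rewrite lee_fin !mulr_ge0.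
under eq_integral do rewrite EFinM.
rewrite ge0_integralZl//=; [|exact/measurable_EFinP/measurable_funTS
  |by rewrite lee_fin mulr_ge0].
rewrite integral_indic// big_ord_recl mulrCA [leRHS]EFinM muleC.
rewrite lee_pmul ?lee_fin ?mulr_ge0//.
apply: (@le_trans _ _ (lebesgue_measure `[A k 0%N, B k 0%N]%classic)).
  by apply: le_measure; rewrite ?inE//; exact: measurableI.
by have /eqP := lebesgue_measure_itvcc (AB k 0%N); rewrite eq_le => /andP[].
Qed.

Lemma le_sigma_subadditive_fin (T : Type) (mu : set T -> \bar R) (I : finType)
    (F : I -> set T) :
  mu set0 = 0 -> (forall A, 0 <= mu A) -> sigma_subadditive mu ->
  {homo mu : A B / A `<=` B >-> A <= B} ->
  mu (\bigcup_i F i) <= \sum_i mu (F i).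
Proof.
move=> mu0 mu_ge0 mus le_mu.
pose G k := if insub k is Some i then F (@enum_val I predT i) else set0.
apply: (@le_trans _ _ (mu (\bigcup_k G k))).
  apply: le_mu => x [i _ Fix]; exists (enum_rank i : nat) => //.
  by rewrite /G insubT//= => ilt; rewrite (_ : Sub _ _ = enum_rank i) ?enum_rankK//; exact/val_inj.
apply: (le_trans (mus G)).
rewrite (nneseries_split 0 #|I|)//.
rewrite add0n big_mkord eseries0 ?adde0; last first.
  by move=> k kI _; rewrite /G insubF// ltnNge kI.
rewrite (big_enum_val (A := I) (fun i => mu (F i))) le_eqVlt; apply/orP; left.
apply/eqP; apply: eq_bigr => i _; rewrite /G insubT//= => ilt; congr (mu (F (enum_val _))).
exact: val_inj.
Qed.

Lemma cover_outer_le (T : pointedType) (g : set T -> \bar R) A :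
  g set0 = 0 -> (forall A, 0 <= g A) -> cover_outer g A <= g A.
Proof.
move=> g0 g_ge0; apply: ge_ereal_inf.
exists (\sum_(k <oo) g (if k is 0%N then A else set0)).
  exists (fun k : nat => if k is 0%N then A else set0) => //.
  split => [k|x Ax]; last by exists 0%N.
  exact: sub_gen_smallest.
rewrite (nneseries_split 0 1)//.
by rewrite add0n big_nat1 eseries0 ?adde0//; case.
Qed.

End BoxVolume.

Section LebesgueOuter.
Context {R : realType} {n : nat}.
Implicit Types (a b x : 'rV[R]_n) (A : set 'rV[R]_n).
Local Notation lambda := (@lebesgue_outer R n).

Lemma lebesgue_outer_ge0 A : (0 <= lambda A)%E.
Proof. exact: outer_measure_ge0. Qed.

Lemma le_lebesgue_outer A B : A `<=` B -> (lambda A <= lambda B)%E.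
Proof. exact: le_outer_measure. Qed.

Lemma box_volume_box a b : (forall i, a 0 i <= b 0 i) ->
  box_volume (box a b) = (\prod_i (b 0 i - a 0 i))%:E.
Proof.
move=> ab; rewrite /box_volume ifF; last first.
  by apply/negbTE/set0P; exists a => i; rewrite lexx ab.
rewrite [X in ereal_inf X](_ : _ = [set (\prod_i (b 0 i - a 0 i))%:E]) ?ereal_inf1//.
apply/seteqP; split => [_ [[a' b'] /= E <-]|_ ->]; last by exists (a, b).
have a'a i : a' 0 i <= a 0 i.
  have : box a b a by move=> j; rewrite lexx ab.
  by rewrite E => /(_ i)/andP[].
have bb' i : b 0 i <= b' 0 i.
  have : box a b b by move=> j; rewrite lexx ab.
  by rewrite E => /(_ i)/andP[].
have a'b' i : a' 0 i <= b' 0 i by rewrite (le_trans (a'a i))// (le_trans (ab i)).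
congr EFin; apply: eq_bigr => i _; congr (_ - _); apply/le_anti; rewrite ?bb' ?a'a ?andbT/=.
  have : box a' b' b' by move=> j; rewrite lexx a'b'.
  by rewrite -E => /(_ i)/andP[].
have : box a' b' a' by move=> j; rewrite lexx a'b'.
by rewrite -E => /(_ i)/andP[].
Qed.

Lemma box_volumeP A : box_volume A = +oo%E \/
  exists a b, (forall i, a 0 i <= b 0 i) /\
    (A = box a b \/ A = set0) /\
    box_volume A = (if A == set0 then 0%E else (\prod_i (b 0 i - a 0 i))%:E).
Proof.
have [A0|A0] := eqVneq A set0.
  right; exists 0, 0; split => //; split; first by right.
  by rewrite A0 box_volume0.
have [[p Ap]|nA] := pselect (exists p : 'rV[R]_n * 'rV[R]_n, A = box p.1 p.2).
  have ab i : p.1 0 i <= p.2 0 i.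
    move: A0 => /set0P[x]; rewrite Ap => /(_ i)/andP[]; exact: le_trans.
  by right; exists p.1, p.2; rewrite Ap box_volume_box//; split => //; split => //; left.
left; rewrite /box_volume (negbTE A0) (_ : [set _ | _ in _] = set0) ?ereal_inf0//.
by rewrite -subset0 => v [p /= Ap _]; case: nA; exists p.
Qed.

Lemma lebesgue_outer_box_le a b : (forall i, a 0 i <= b 0 i) ->
  (lambda (box a b) <= (\prod_i (b 0 i - a 0 i))%:E)%E.
Proof.
move=> ab; rewrite -box_volume_box//.
by apply: cover_outer_le; [exact: box_volume0|exact: box_volume_ge0].
Qed.

Lemma lebesgue_outer_box_ge a b : (forall i, a 0 i <= b 0 i) ->
  ((\prod_i (b 0 i - a 0 i))%:E <= lambda (box a b))%E.
Proof.
move=> ab; apply: le_ereal_inf_tmp => _ [F [_ Fcov] <-].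
have [[k Fk]|nF] := pselect (exists k, box_volume (F k) = +oo%E).
  rewrite [leRHS](_ : _ = +oo%E) ?leey//.
  by apply: (nneseries_pinfty (k := k)) => // j _; exact: box_volume_ge0.
have /choice[p Hp] : forall k, exists p : 'rV[R]_n * 'rV[R]_n,
    (forall i, p.1 0 i <= p.2 0 i) /\
    (F k = box p.1 p.2 \/ F k = set0) /\ box_volume (F k) =
      (if F k == set0 then 0%E else (\prod_i (p.2 0 i - p.1 0 i))%:E).
  move=> k; have [Fk|[a' [b' H]]] := box_volumeP (F k); last by exists (a', b').
  by case: nF; exists k.
pose ext x (k : nat) := if insub k is Some i then x 0 i else 0 : R.
have extE x (i : 'I_n) : ext x i = x 0 i.
  by rewrite /ext insubT//= => ilt; congr (x 0 _); exact: val_inj.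
have le_ext x (y : 'rV[R]_n) : (forall i, x 0 i <= y 0 i) -> forall i, ext x i <= ext y i.
  by move=> xy i; rewrite /ext; case: insubP.
pose c k : R := (F k != set0)%:R.
have -> : \big[+%E/0%E]_(0 <= k <oo) box_volume (F k) =
    \big[+%E/0%E]_(0 <= k <oo)
      (c k * \prod_(i < n) (ext (p k).2 i - ext (p k).1 i))%:E.
  apply: eq_eseriesr => k _; have [_ [_ ->]] := Hp k; rewrite /c.
  case: eqVneq => _; rewrite ?mul0r ?mul1r//; congr EFin.
  by apply: eq_bigr => i _; rewrite !extE.
have -> : \prod_i (b 0 i - a 0 i) = 1 * \prod_(i < n) (ext b i - ext a i).
  by rewrite mul1r; apply: eq_bigr => i _; rewrite !extE.
apply: (@prod_le_nneseries R n (ext a) (ext b) (fun k => ext (p k).1)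
  (fun k => ext (p k).2) c 1) => //.
- exact: le_ext.
- by move=> k; apply: le_ext; case: (Hp k).
move=> x xab.
have /Fcov[k _ Fkx] : box a b (\row_i x i).
  by move=> i; rewrite mxE; have := xab i (ltn_ord i); rewrite !extE.
have ge0 j : (0 <= (c j * [forall i : 'I_n,
    ext (p j).1 i <= x i <= ext (p j).2 i]%:R)%:E)%E by rewrite lee_fin mulr_ge0.
rewrite (nneseries_split 0 k.+1)// add0n big_nat_recr//=.
apply: (@le_trans _ _ (c k * [forall i : 'I_n,
    ext (p k).1 i <= x i <= ext (p k).2 i]%:R)%:E).
  have F0 : F k != set0 by apply/set0P; exists (\row_i x i).
  rewrite /c F0 mul1r lee_fin ler1n lt0b; apply/forallP => i.
  have [_ [[Fk|/eqP]]] := Hp k; last by rewrite (negbTE F0).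
  by move: Fkx; rewrite Fk => /(_ i); rewrite mxE !extE.
rewrite -[leLHS]adde0 leeD//; first by rewrite leeDr// sume_ge0.
exact: nneseries_ge0.
Qed.

End LebesgueOuter.

Section LinearImages.
Context {R : realType} {n : nat}.
Implicit Types (a b x r : 'rV[R]_n) (A : set 'rV[R]_n) (M : 'M[R]_n).
Local Notation lambda := (@lebesgue_outer R n).

Lemma lebesgue_outer_image_le (h : 'rV[R]_n -> 'rV[R]_n) (c : R) A : 0 < c ->
  (forall a b, (forall i, a 0 i <= b 0 i) ->
    (lambda (h @` box a b) <= (c * \prod_i (b 0 i - a 0 i))%:E)%E) ->
  (lambda (h @` A) <= c%:E * lambda A)%E.
Proof.
move=> c0 hbox; rewrite -lee_pdivrMl//.
apply: le_ereal_inf_tmp => _ [F [_ AF] <-]; rewrite lee_pdivrMl//.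
apply: (@le_trans _ _ (lambda (\bigcup_k (h @` F k)))).
  apply: le_lebesgue_outer => _ [x Ax <-]; have [k _ Fkx] := AF _ Ax.
  by exists k => //; exists x.
apply: (le_trans (outer_measure_sigma_subadditive _ _)).
rewrite -nneseriesZl//; last by move=> k _; exact: box_volume_ge0.
apply: lee_nneseries => k; first by move=> *; exact: lebesgue_outer_ge0.
move=> _; have [->|[a [b [ab [Fk ->]]]]] := box_volumeP (F k).
  by rewrite gt0_muley ?leey// lte_fin.
have [F0|F0] := eqVneq (F k) set0.
  by rewrite F0 image_set0 outer_measure0 mule0.
case: Fk => [->|Fk]; first exact: hbox.
by rewrite Fk eqxx in F0.
Qed.

Lemma poly_ge_at0 (p : {poly R}) (w l : R) :
  (forall N : nat, l <= p.[w / N.+1%:R]) -> l <= p.[0].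
Proof.
move=> H; rewrite leNgt; apply/negP => pl.
have : (fun N : nat => p.[w / N.+1%:R]) @ \oo --> p.[0].
  apply: continuous_cvg; first exact: continuous_horner.
  rewrite -[X in _ --> X](mulr0 w); apply: cvgMr; exact: cvg_harmonic.
move=> /cvgrPdist_lt/(_ (l - p.[0])); rewrite subr_gt0 => /(_ pl)[N _ /(_ N (leqnn N))/=].
have := H N; rewrite distrC; have := ler_norm (p.[w / N.+1%:R] - p.[0]); lra.
Qed.

(* [x *m E], where [E] is the identity matrix with [k]-th row replaced by [r] *)
Definition row_change (k : 'I_n) r x := x + x 0 k *: (r - delta_mx 0 k).

Lemma row_changeE k r x i :
  row_change k r x 0 i = (if i == k then 0 else x 0 i) + x 0 k * r 0 i.
Proof.
rewrite !mxE eqxx/= eq_sym; case: eqVneq => [->|_]/=; first by ring.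
by rewrite subr0.
Qed.

Lemma row_change_box k r a b (N : nat) : (forall i, a 0 i <= b 0 i) ->
  (lambda (row_change k r @` box a b) <=
   (`|r 0 k| * (b 0 k - a 0 k) * \prod_(i < n | i != k)
      ((b 0 i - a 0 i) + `|r 0 i| * ((b 0 k - a 0 k) / N.+1%:R)))%:E)%E.
Proof.
move=> ab; set w := b 0 k - a 0 k; set h := w / N.+1%:R.
have w0 : 0 <= w by rewrite subr_ge0.
have h0 : 0 <= h by rewrite divr_ge0.
pose mid (j : nat) := a 0 k + (j%:R + 2^-1) * h.
pose lo (j : nat) := \row_i ((if i == k then 0 else a 0 i) + mid j * r 0 i
                             - `|r 0 i| * (h / 2)).
pose hi (j : nat) := \row_i ((if i == k then 0 else b 0 i) + mid j * r 0 i
                             + `|r 0 i| * (h / 2)).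
have lohi j i : lo j 0 i <= hi j 0 i.
  rewrite !mxE; have : 0 <= `|r 0 i| * (h / 2) by rewrite mulr_ge0// divr_ge0.
  by case: eqVneq => _; [lra|have := ab i; lra].
have cov : row_change k r @` box a b `<=` \bigcup_(j : 'I_N.+1) box (lo j) (hi j).
  move=> _ [x xab <-].
  have [j jN xj] : exists2 j : nat, (j < N.+1)%N & `|x 0 k - mid j| <= h / 2.
    have [w00|wn0] := eqVneq w 0.
      have h00 : h = 0 by rewrite /h w00 mul0r.
      exists 0%N => //; rewrite /mid h00 !mulr0 mul0r addr0.
      have /andP[ax xb] := xab k; move: w00 => /eqP; rewrite subr_eq0 => /eqP ba.
      by rewrite normr_le0 subr_eq0 eq_le ax -ba xb.
    have hp : 0 < h by rewrite divr_gt0// lt_neqAle eq_sym wn0.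
    set q := (x 0 k - a 0 k) / h.
    have /andP[ax xb] := xab k.
    have q0 : 0 <= q by rewrite divr_ge0// subr_ge0.
    have qN : q <= N.+1%:R.
      rewrite ler_pdivrMr// /h mulrCA divff ?pnatr_eq0// mulr1 /w; lra.
    have xq : x 0 k = a 0 k + q * h by rewrite /q divfK ?gt_eqF//; ring.
    have [qlt|qge] := ltP q N.+1%:R.
      exists (Num.truncn q).
        by rewrite -(ltr_nat R) (le_lt_trans _ qlt)// truncn_le.
      have /andP[] := truncn_itv q0; set t := Num.truncn q => tq qt.
      rewrite /mid xq (_ : _ - _ = (q - t%:R - 2^-1) * h); last by ring.
      rewrite normrM (ger0_norm h0) mulrC ler_wpM2l// ler_norml.
      by move: qt; rewrite -natr1 => qt; apply/andP; split; lra.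
    exists N => //; have {}qN : q = N.+1%:R by apply/le_anti; rewrite qN.
    rewrite /mid xq qN -natr1 (_ : _ - _ = h / 2); last by field.
    by rewrite ger0_norm// divr_ge0.
  exists (Ordinal jN) => // i; rewrite row_changeE !mxE.
  have : `|(x 0 k - mid j) * r 0 i| <= `|r 0 i| * (h / 2).
    by rewrite normrM mulrC ler_wpM2l.
  rewrite ler_norml mulrBl => /andP[h1 h2] /=.
  by case: eqVneq => _; apply/andP; [split; lra|have := xab i; split; lra].
apply: (le_trans (le_lebesgue_outer cov)).
apply: (le_trans (@le_sigma_subadditive_fin R _ lambda 'I_N.+1
  (fun j => box (lo j) (hi j)) (outer_measure0 _) lebesgue_outer_ge0
  (outer_measure_sigma_subadditive _) le_lebesgue_outer)).
apply: (@le_trans _ _ (\sum_(j < N.+1) (`|r 0 k| * h *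
    \prod_(i < n | i != k) ((b 0 i - a 0 i) + `|r 0 i| * h))%:E)%E).
  apply: lee_sum => j _; apply: (le_trans (lebesgue_outer_box_le (lohi j))).
  rewrite lee_fin (bigD1 k)//= !mxE eqxx.
  have -> : 0 + mid j * r 0 k + `|r 0 k| * (h / 2) -
      (0 + mid j * r 0 k - `|r 0 k| * (h / 2)) = `|r 0 k| * h by field.
  rewrite ler_wpM2l ?mulr_ge0// le_eqVlt; apply/orP; left; apply/eqP.
  by apply: eq_bigr => i ik; rewrite !mxE (negbTE ik); field.
rewrite sumEFin lee_fin sumr_const card_ord -mulr_natl mulrA.
rewrite (_ : N.+1%:R * (`|r 0 k| * h) = `|r 0 k| * w)//.
by rewrite mulrCA; congr (_ * _); rewrite mulrC divfK ?pnatr_eq0.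
Qed.

Lemma lebesgue_outer_row_change_le k r A : r 0 k != 0 ->
  (lambda (row_change k r @` A) <= `|r 0 k|%:E * lambda A)%E.
Proof.
move=> rk; apply: lebesgue_outer_image_le; first by rewrite normr_gt0.
move=> a b ab; set w := b 0 k - a 0 k.
pose p : {poly R} := (`|r 0 k| * w)%:P *
  \prod_(i < n | i != k) ((b 0 i - a 0 i)%:P + `|r 0 i|%:P * 'X).
have pE h : p.[h] = `|r 0 k| * w *
    \prod_(i < n | i != k) ((b 0 i - a 0 i) + `|r 0 i| * h).
  by rewrite !hornerE horner_prod; congr (_ * _); apply: eq_bigr => i _; rewrite !hornerE.
have fin : lambda (row_change k r @` box a b) \is a fin_num.
  rewrite ge0_fin_numE ?lebesgue_outer_ge0//.
  exact: le_lt_trans (row_change_box k r 0 ab) (ltry _).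
rewrite -(fineK fin) lee_fin.
have -> : `|r 0 k| * \prod_i (b 0 i - a 0 i) = p.[0].
  rewrite pE (bigD1 k)//= mulrA; congr (_ * _).
  by apply: eq_bigr => i _; rewrite mulr0 addr0.
apply: (@poly_ge_at0 _ w) => N; rewrite pE -lee_fin fineK//.
exact: row_change_box.
Qed.

Lemma lebesgue_outer_row_change k r A : r 0 k != 0 ->
  lambda (row_change k r @` A) = (`|r 0 k|%:E * lambda A)%E.
Proof.
move=> rk; apply/le_anti; rewrite lebesgue_outer_row_change_le//=.
pose r' : 'rV[R]_n := (r 0 k)^-1 *: ((1 + r 0 k) *: delta_mx 0 k - r).
have r'k : r' 0 k = (r 0 k)^-1 by rewrite !mxE !eqxx/=; field.
have r'K x : row_change k r' (row_change k r x) = x.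
  apply/rowP => i; rewrite (row_changeE k r') !(row_changeE k r) eqxx add0r !mxE eqxx/=.
  by case: eqVneq => [->|_] /=; field.
rewrite -lee_pdivlMl ?normr_gt0//.
have {1}-> : A = row_change k r' @` (row_change k r @` A).
  rewrite image_comp -[LHS]image_id; apply: eq_imagel => x _ /=.
  by rewrite r'K.
apply: le_trans (lebesgue_outer_row_change_le _ _) _.
  by rewrite r'k invr_eq0.
by rewrite r'k normfV.
Qed.

Lemma lebesgue_outer_trig M A : is_trig_mx M -> (forall i, M i i != 0) ->
  lambda ((fun x => x *m M) @` A) = (`|\det M|%:E * lambda A)%E.
Proof.
move=> trigM M0; rewrite det_trig// normr_prod.
pose L (k : nat) := \matrix_(i < n, j < n) if (i < k)%N then M i j else (i == j)%:R.
suff H k : (k <= n)%N -> lambda ((fun x => x *m L k) @` A) =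
    ((\prod_(i < n | (i < k)%N) `|M i i|)%:E * lambda A)%E.
  have := H n (leqnn n); rewrite (_ : L n = M); last first.
    by apply/matrixP => i j; rewrite mxE ltn_ord.
  by move=> ->; congr (_%:E * _)%E; apply: eq_bigl => i; rewrite ltn_ord.
elim: k => [_|k IH kn].
  rewrite big1 ?mul1e; last by move=> i; rewrite ltn0.
  rewrite (_ : L 0%N = 1%:M); last by apply/matrixP => i j; rewrite !mxE.
  congr lambda; rewrite -[RHS]image_id; apply: eq_imagel => x _.
  by rewrite mulmx1.
pose k' := Ordinal kn.
have -> : (fun x => x *m L k.+1) @` A =
    row_change k' (row k' M) @` ((fun x => x *m L k) @` A).
  rewrite image_comp; apply: eq_imagel => x _ /=.
  apply/rowP => j; rewrite row_changeE.
  have Lk : (x *m L k) 0 k' = x 0 k'.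
    rewrite mxE (bigD1 k')//= big1 ?addr0; last first.
      move=> i ik; rewrite mxE; case: ltnP => [ik'|_]; last by rewrite (negbTE ik) mulr0.
      by have /is_trig_mxP -> := trigM; rewrite ?mulr0.
    by rewrite mxE ltnn eqxx mulr1.
  rewrite Lk !mxE (bigD1 k')//= mxE/= ltnS leqnn addrC; congr (_ + _).
  case: eqVneq => [->|jk].
    rewrite big1// => i ik; rewrite mxE ltnS leq_eqVlt (_ : (i == k :> nat) = false); last first.
      by apply/negbTE; apply: contra ik => /eqP ik; apply/eqP/val_inj.
    case: ltnP => [ik'|_]/=; last by rewrite (negbTE ik) mulr0.
    by have /is_trig_mxP -> := trigM; rewrite ?mulr0.
  rewrite [RHS](bigD1 k')//= mxE ltnn eq_sym (negbTE jk) mulr0 add0r.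
  apply: eq_bigr => i ik; rewrite !mxE ltnS leq_eqVlt (_ : (i == k :> nat) = false)//.
  by apply/negbTE; apply: contra ik => /eqP ik; apply/eqP/val_inj.
rewrite lebesgue_outer_row_change ?mxE// IH; last exact: ltnW.
rewrite muleA -EFinM; congr (_%:E * _)%E.
rewrite [RHS](bigD1 k')//=; congr (_ * _); apply: eq_bigl => i.
rewrite [in RHS]ltnS [in RHS]leq_eqVlt andb_orl; case: eqVneq => [ik|ik] /=.
  by rewrite -val_eqE/= ik ltnn eqxx.
by rewrite -val_eqE/= ik andbT.
Qed.

End LinearImages.

Section PositiveDefinite.
Context {R : realType}.

Definition pos_def n (A : 'M[R]_n) :=
  A^T = A /\ forall w : 'rV[R]_n, w != 0 -> 0 < dot (w *m A) w.

Lemma pos_def_ge0 n (A : 'M[R]_n) w : pos_def A -> 0 <= dot (w *m A) w.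
Proof.
by move=> [_ pA]; have [->|/pA/ltW//] := eqVneq w 0; rewrite dot0r.
Qed.

Lemma dotmx1 (x y : 'rV[R]_1) : dot x y = x 0 0 * y 0 0.
Proof. by rewrite dotE big_ord1. Qed.

Lemma dot_row_mx m n (x x' : 'rV[R]_m) (y y' : 'rV[R]_n) :
  dot (row_mx x y) (row_mx x' y') = dot x x' + dot y y'.
Proof. by rewrite /dot tr_row_mx mul_row_col mxE. Qed.

(* The Schur complement of the upper left entry gives the induction step. *)
Lemma cholesky n (A : 'M[R]_n) : pos_def A ->
  exists M, [/\ is_trig_mx M, forall i, 0 < M i i & A = M *m M^T].
Proof.
elim: n A => [|n IH] A.
  move=> _; exists 1%:M; split; last by apply/matrixP => -[].
    exact: scalar_mx_is_trig.
  by case.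
move=> [symA posA].
set a := ulsubmx (A : 'M[R]_(1 + n)); set b := ursubmx (A : 'M[R]_(1 + n)).
set D := drsubmx (A : 'M[R]_(1 + n)).
have AE : A = block_mx a b b^T D :> 'M[R]_(1 + n).
  rewrite -(_ : dlsubmx (A : 'M[R]_(1 + n)) = b^T); first exact/esym/submxK.
  by rewrite /b trmx_ursub symA.
have symD : D^T = D by rewrite /D trmx_drsub symA.
pose al := a 0 0.
have aE : a = al%:M by exact: mx11_scalar.
have formE (x : 'rV[R]_1) (w : 'rV[R]_n) :
    dot (row_mx x w *m (A : 'M[R]_(1 + n))) (row_mx x w) =
    al * (x 0 0) ^+ 2 + 2 * x 0 0 * dot b w + dot (w *m D) w.
  rewrite AE mul_row_block dot_row_mx aE mul_mx_scalar !dotDl dotZl dotmx1.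
  have -> : dot (w *m b^T) x = x 0 0 * dot b w.
    by rewrite dotmx1 mulrC; congr (_ * _); rewrite -dotC.
  have -> : dot (x *m b) w = x 0 0 * dot b w.
    by rewrite {1}(mx11_scalar x) mul_scalar_mx dotZl.
  ring.
have al0 : 0 < al.
  have := posA (row_mx 1 0 : 'rV[R]_(1 + n)); rewrite formE !dot0r mxE eqxx.
  rewrite expr1n !mulr1 mulr0 !addr0; apply; apply/eqP.
  move=> /(congr1 (fun v : 'rV[R]_(1 + n) => lsubmx v)); rewrite row_mxKl.
  by move=> /matrixP/(_ 0 0)/eqP; rewrite !mxE oner_eq0.
pose s : R := Num.sqrt al; have s0 : 0 < s by rewrite sqrtr_gt0.
have ss : s * s = al by rewrite -expr2 sqr_sqrtr// ltW.
have [M' [trigM' M'0 M'E]] : exists M', [/\ is_trig_mx M', forall i, 0 < M' i i &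
    D - al^-1 *: (b^T *m b) = M' *m M'^T].
  apply: IH; split; first by rewrite linearB/= linearZ/= trmx_mul trmxK symD.
  move=> w w0; set x : 'rV[R]_1 := (- al^-1 * dot b w)%:M.
  have := posA (row_mx x w : 'rV[R]_(1 + n)); rewrite formE mulmxBr dotBl.
  have -> : dot (w *m (al^-1 *: (b^T *m b))) w = al^-1 * dot b w ^+ 2.
    rewrite -scalemxAr dotZl mulmxA; congr (_ * _).
    rewrite (mx11_scalar (w *m b^T)) mul_scalar_mx dotZl -[(w *m b^T) 0 0]/(dot w b).
    by rewrite (dotC w b) expr2.
  rewrite /x mxE eqxx mulr1n => H; apply: (lt_le_trans (H _)).
    apply: contra w0 => /eqP/(congr1 (fun v : 'rV[R]_(1 + n) => rsubmx v)).
    by rewrite row_mxKr => ->; apply/eqP/rowP => i; rewrite !mxE.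
  by rewrite le_eqVlt; apply/orP; left; apply/eqP; field; rewrite gt_eqF.
pose N : 'M[R]_(1 + n) := block_mx s%:M 0 (s^-1 *: b^T) M'.
have trigN : is_trig_mx N.
  rewrite is_trig_block_mx// eqxx trigM'/= andbT; exact: scalar_mx_is_trig.
have N0 : forall i : 'I_(1 + n), 0 < fun_of_matrix N i i.
  move=> i; case: (split_ordP i) => j -> /=; last by rewrite block_mxEdr.
  by rewrite block_mxEul mxE eqxx.
suff NN : N *m N^T = block_mx a b b^T D by exists N; split; rewrite // AE.
rewrite /N tr_block_mx mulmx_block !trmx0 !mul0mx !mulmx0 !addr0 -M'E.
rewrite tr_scalar_mx -scalar_mxM ss aE linearZ/= trmxK.
rewrite mul_scalar_mx scalerA divff ?gt_eqF// scale1r.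
rewrite mul_mx_scalar scalerA divff ?gt_eqF// scale1r.
by rewrite -scalemxAl -scalemxAr scalerA -invfM ss addrC subrK.
Qed.

Lemma pos_def_det n (A : 'M[R]_n) : pos_def A -> 0 < \det A.
Proof.
move=> /cholesky[M [trigM M0 ->]]; rewrite det_mulmx det_tr det_trig//.
by rewrite mulr_gt0// prodr_gt0.
Qed.

Lemma pos_def_psd n (A : 'M[R]_n) : A^T = A ->
  (forall w, 0 <= dot (w *m A) w) -> \det A != 0 -> pos_def A.
Proof.
move=> symA psdA detA; split=> // w w0; rewrite lt_neqAle psdA andbT eq_sym.
apply: contra w0 => /eqP wA0.
have wA : w *m A = 0.
  apply: dot_eq0; have := psd_dot_sqr w (w *m A) symA psdA.
  by rewrite wA0 mul0r => le0; apply/eqP; rewrite -sqrf_eq0 eq_le le0 sqr_ge0.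
by rewrite -[w](mulmxK (_ : A \in unitmx)) ?wA ?mul0mx// unitmxE unitfE.
Qed.

Lemma mulmx_enorm_le m n (N : 'M[R]_(m, n)) :
  exists2 K, 0 < K & forall y, enorm (y *m N) <= K * enorm y.
Proof.
exists (1 + \sum_i enorm (row i N)) => [|y].
  by rewrite ltr_pwDl// sumr_ge0// => i _; exact: enorm_ge0.
rewrite mulmx_sum_row mulrDl mul1r (@le_trans _ _ (\sum_i enorm (y 0 i *: row i N)))//.
  elim/big_ind2 : _ => [|x1 x2 y1 y2 h1 h2|//]; first by rewrite enorm0.
  by rewrite (le_trans (ler_enormD _ _))// lerD.
rewrite -[leLHS]add0r lerD ?enorm_ge0// mulr_suml ler_sum// => i _.
by rewrite enormZ mulrC ler_wpM2l ?enorm_ge0// coord_le_enorm.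
Qed.

Lemma pos_def_coercive n (A : 'M[R]_n) : pos_def A ->
  exists2 c, 0 < c & forall w, c * dot w w <= dot (w *m A) w.
Proof.
move=> /cholesky[M [trigM M0 ->]].
have uM : M \in unitmx.
  by rewrite unitmxE unitfE det_trig// gt_eqF// prodr_gt0.
have [K K0 HK] := mulmx_enorm_le (invmx M).
exists (K ^+ 2)^-1 => [|w]; first by rewrite invr_gt0 exprn_gt0.
rewrite ler_pdivrMl ?exprn_gt0// mulmxA dot_mulmx trmxK -!enorm_sqr -exprMn.
rewrite ler_sqr ?nnegrE ?mulr_ge0 ?enorm_ge0 ?(ltW K0)//.
by have := HK (w *m M); rewrite mulmxK.
Qed.

End PositiveDefinite.

Section EllipsoidVolume.
Context {R : realType}.

Lemma closed_eball_volume n : 0 < @unit_ball_volume R n /\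
  @lebesgue_outer R n (closed_eball 1) = (unit_ball_volume n)%:E.
Proof.
have r0 : 0 < (n.+1%:R)^-1 :> R by rewrite invr_gt0.
have fin : @lebesgue_outer R n (closed_eball 1) \is a fin_num.
  rewrite ge0_fin_numE ?lebesgue_outer_ge0//.
  apply: (le_lt_trans (le_lebesgue_outer (B := box (const_mx (-1)) (const_mx 1)) _)).
    move=> x /= x1 i; rewrite !mxE -ler_norml.
    exact: le_trans (coord_le_enorm _ _) x1.
  apply: (le_lt_trans (lebesgue_outer_box_le _)); last exact: ltry.
  by move=> i; rewrite !mxE; lra.
split; last by rewrite fineK.
rewrite -lte_fin fineK//.
apply: (lt_le_trans _ (le_lebesgue_outer (A := box (const_mx 0) (const_mx n.+1%:R^-1)) _)).
  apply: (lt_le_trans _ (lebesgue_outer_box_ge _)); last by move=> i; rewrite !mxE ltW.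
  by rewrite lte_fin prodr_gt0// => i _; rewrite !mxE subr0.
move=> x xbox; rewrite /closed_eball/= (le_trans (enorm_le_norm _))//.
apply: (@le_trans _ _ (n.+1%:R * n.+1%:R^-1)); last by rewrite divff ?pnatr_eq0.
rewrite ler_pM ?ler_nat//.
rewrite {1}/Num.norm/= mx_normrE; apply: bigmax_le; first exact: ltW.
move=> [i j] _/=; rewrite (ord1 i) ger0_norm; have := xbox j; rewrite !mxE; case/andP => //.
Qed.

Lemma ellipsoid_volume n (Q : 'M[R]_n) : pos_def Q ->
  @lebesgue_outer R n [set v | dot (v *m Q) v <= 1] =
  (unit_ball_volume n / Num.sqrt (\det Q))%:E.
Proof.
move=> /cholesky[M [trigM M0 QE]]; have dM : 0 < \det M.
  by rewrite det_trig// prodr_gt0.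
have -> : Num.sqrt (\det Q) = \det M.
  by rewrite QE det_mulmx det_tr -expr2 sqrtr_sqr gtr0_norm.
have uM : M \in unitmx by rewrite unitmxE unitfE gt_eqF.
have := lebesgue_outer_trig [set v | dot (v *m Q) v <= 1] trigM (fun i => lt0r_neq0 (M0 i)).
rewrite (_ : _ @` _ = closed_eball 1); last first.
  apply/seteqP; split => [_ [v /= v1 <-]|v /= v1].
    by rewrite /closed_eball/= enorm_le_sqr// expr1n dot_mulmx -mulmxA -QE dotC.
  exists (v *m invmx M); last by rewrite mulmxKV.
  rewrite /= QE mulmxA mulmxKV// dot_mulmx trmxK mulmxKV//.
  by move: v1; rewrite /closed_eball/= enorm_le_sqr// expr1n.
rewrite (closed_eball_volume n).2 gtr0_norm// => volE.
by rewrite EFinM volE muleC muleA -EFinM mulVf ?gt_eqF// mul1e.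
Qed.

Lemma frame_ellipsoid_volume d (u : 'rV[R]_d.+1) B (g : 'rV[R]_d) (p : R) (A : 'M[R]_d) :
  orthonormal_frame u B -> 0 < p -> pos_def A ->
  lebesgue_outer [set v | p * dot v (u + g *m B) ^+ 2
                          + dot (v *m B^T *m A) (v *m B^T) <= 1] =
  (unit_ball_volume d.+1 / Num.sqrt (p * \det A))%:E.
Proof.
move=> uB p0 posA; pose S : 'M[R]_(1 + d) := col_mx (u + g *m B) B.
pose T : 'M[R]_(1 + d) := block_mx p%:M 0 0 A.
have SE : S = block_mx 1%:M g 0 1%:M *m col_mx u B.
  by rewrite /S mul_block_col !mul1mx mul0mx add0r.
have dS : \det S ^+ 2 = 1.
  by rewrite SE det_mulmx det_ublock !det1 !mul1r frame_det.
have uS : S \in unitmx by rewrite unitmxE unitfE -sqrf_eq0 dS oner_eq0.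
have formE (v : 'rV[R]_(1 + d)) : dot (v *m (S^T *m T *m S)) v =
    p * dot v (u + g *m B) ^+ 2 + dot (v *m B^T *m A) (v *m B^T).
  rewrite !mulmxA dot_mulmx /S tr_col_mx mul_mx_row /T mul_row_block !mulmx0.
  rewrite addr0 add0r dot_row_mx mul_mx_scalar dotZl dotmx1; congr (_ * _ + _).
have posQ : pos_def (S^T *m T *m S).
  split; first by rewrite !trmx_mul trmxK /T tr_block_mx !trmx0 tr_scalar_mx posA.1 mulmxA.
  move=> v v0; rewrite formE.
  have [vB|vB] := eqVneq (v *m B^T) 0; last first.
    by rewrite ltr_wpDl ?posA.2// mulr_ge0 ?sqr_ge0// ltW.
  rewrite vB mul0mx dot0l addr0 mulr_gt0// exprn_even_gt0//=.
  apply: contra v0 => /eqP; rewrite dotDr (dotC v (g *m B)) dot_mulmx vB dot0r addr0.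
  by move=> vu0; rewrite (frame_decomp v uB) vB mul0mx add0r vu0 scale0r.
have -> : [set v | p * dot v (u + g *m B) ^+ 2 +
    dot (v *m B^T *m A) (v *m B^T) <= 1] =
    [set v : 'rV[R]_(1 + d) | dot (v *m (S^T *m T *m S)) v <= 1].
  by apply/seteqP; split => v /=; rewrite formE.
rewrite ellipsoid_volume//; congr (_ / Num.sqrt _)%:E.
have dT : \det T = p * \det A by rewrite /T det_ublock det_scalar1.
have -> : \det (S^T *m T *m S) = \det S ^+ 2 * \det T.
  by rewrite !det_mulmx det_tr; ring.
by rewrite dS dT mul1r.
Qed.

End EllipsoidVolume.

(** * Hausdorff measure *)

Section CoverOuter.
Context {R : realType} {T : pointedType}.
Implicit Types (g : set T -> \bar R) (A : set T).
Local Open Scope ereal_scope.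

Lemma cover_outer_le_sum g A (F : (set T)^nat) :
  A `<=` \bigcup_k F k -> cover_outer g A <= \sum_(k <oo) g (F k).
Proof.
move=> AF; apply: ge_ereal_inf; exists (\sum_(k <oo) g (F k)) => //.
by exists F => //; split => // k; exact: sub_gen_smallest.
Qed.

Lemma cover_outer_ge g A (x : \bar R) :
  (forall F : (set T)^nat, A `<=` \bigcup_k F k -> x <= \sum_(k <oo) g (F k)) ->
  x <= cover_outer g A.
Proof. by move=> H; apply: le_ereal_inf_tmp => _ [F [_ AF] <-]; exact: H. Qed.

End CoverOuter.

Section HausdorffLipschitz.
Context {R : realType}.
Local Open Scope ereal_scope.

Lemma diam_ge0 n (A : set 'rV[R]_n) : A !=set0 -> 0 <= diam A.
Proof.
move=> [x Ax]; apply: (@le_trans _ _ (enorm (x - x))%:E); first by rewrite lee_fin enorm_ge0.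
by apply: ereal_sup_ubound; exists (x, x).
Qed.

Lemma le_diam n (A : set 'rV[R]_n) x y : A x -> A y -> (enorm (x - y))%:E <= diam A.
Proof. by move=> Ax Ay; apply: ereal_sup_ubound; exists (x, y). Qed.

Lemma diam_le n (A : set 'rV[R]_n) (r : \bar R) :
  (forall x y, A x -> A y -> (enorm (x - y))%:E <= r) -> diam A <= r.
Proof. by move=> H; apply: ge_ereal_sup => _ [[x y] [/= Ax Ay] <-]; exact: H. Qed.

Lemma expe_le_pmul (x y : \bar R) (L : R) k : (0 <= L)%R -> 0 <= x -> 0 <= y ->
  x <= L%:E * y -> x ^+ k <= (L ^+ k)%:E * y ^+ k.
Proof.
move=> L0 x0 y0 xy; elim: k => [|k IH]; first by rewrite !expr0 !expe0 mul1e.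
by rewrite !expeS exprS EFinM muleACA lee_pmul// expe_ge0.
Qed.

Lemma hausdorff_gauge_le d n delta (A : set 'rV[R]_n) (r : R) :
  A !=set0 -> diam A <= r%:E -> (r <= delta)%R ->
  hausdorff_gauge d delta A <= (unit_ball_volume d / 2 ^+ d * r ^+ d)%:E.
Proof.
move=> A0 Ar rd; rewrite /hausdorff_gauge ifF; last exact/negbTE/set0P.
rewrite ifT; last by apply: (le_trans Ar); rewrite lee_fin.
have v0 : (0 <= @unit_ball_volume R d / 2 ^+ d)%R.
  by rewrite divr_ge0 ?exprn_ge0// fine_ge0// outer_measure_ge0.
have r0 : (0 <= r)%R by rewrite -lee_fin (le_trans (diam_ge0 A0)).
rewrite [leRHS]EFinM lee_pmul// ?lee_fin ?expe_ge0 ?diam_ge0//.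
have := @expe_le_pmul (diam A) 1 r d r0 (diam_ge0 A0).
rewrite mule1; move=> /(_ _ Ar); rewrite lee_fin ler01 => /(_ isT).
by rewrite (_ : 1 ^+ d = 1) ?mule1//; elim: (d) => // k IH; rewrite expeS IH mule1.
Qed.

Lemma hausdorff_lipschitz m n d (h : 'rV[R]_m -> 'rV[R]_n) (A : set 'rV[R]_m) (L : R) :
  (0 < L)%R ->
  (forall x y, A x -> A y -> (enorm (h x - h y) <= L * enorm (x - y))%R) ->
  hausdorff d (h @` A) <= (L ^+ d)%:E * hausdorff d A.
Proof.
move=> L0 hL; apply: ge_ereal_sup => _ [delta /= delta0 <-].
apply: (@le_trans _ _ ((L ^+ d)%:E * cover_outer (hausdorff_gauge d (delta / L)) A)).
  rewrite -lee_pdivrMl ?exprn_gt0//; apply: cover_outer_ge => F AF.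
  rewrite lee_pdivrMl ?exprn_gt0//.
  apply: (le_trans (cover_outer_le_sum _ (F := fun k => h @` (F k `&` A)) _)).
    by move=> _ [x Ax <-]; have [k _ Fkx] := AF _ Ax; exists k => //; exists x.
  rewrite -nneseriesZl; last by move=> k _; exact: hausdorff_gauge_ge0.
  apply: lee_nneseries => k _; first by move=> *; exact: hausdorff_gauge_ge0.
  rewrite {1}/hausdorff_gauge; case: ifPn => [_|].
    by rewrite mule_ge0 ?hausdorff_gauge_ge0// lee_fin exprn_ge0// ltW.
  move=> /set0P hF0; have [_ [x [Fx Ax] _]] := hF0.
  have F0 : F k !=set0 by exists x.
  rewrite /hausdorff_gauge (_ : (F k == set0) = false); last exact/negbTE/set0P.
  case: (ifPn (diam (F k) <= _)) => [Fd|_]; last first.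
    rewrite gt0_muley ?leey// lte_fin exprn_gt0//.
  have diam_h : diam (h @` (F k `&` A)) <= L%:E * diam (F k).
    apply: diam_le => _ _ [y [Fy Ay] <-] [z [Fz Az] <-].
    apply: (@le_trans _ _ (L * enorm (y - z))%:E); first by rewrite lee_fin hL.
    by rewrite EFinM; apply: lee_wpmul2l; [rewrite lee_fin ltW|exact: le_diam].
  rewrite ifT; last first.
    apply: (le_trans diam_h); rewrite -lee_pdivlMl//.
    by rewrite -EFinM mulrC.
  rewrite muleCA; apply: lee_wpmul2l.
    by rewrite lee_fin divr_ge0 ?exprn_ge0// fine_ge0// outer_measure_ge0.
  apply: expe_le_pmul; [exact: ltW| |exact: diam_ge0|exact: diam_h].
  by apply: diam_ge0; exists (h x), x.
apply: lee_wpmul2l; first by rewrite lee_fin exprn_ge0// ltW.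
by apply: ereal_sup_ubound; exists (delta / L)%R => //=; rewrite divr_gt0.
Qed.

Lemma hausdorff_scale n d (a : R) (A : set 'rV[R]_n) : (0 < a)%R ->
  hausdorff d ((fun x => a *: x)%R @` A) = (a ^+ d)%:E * hausdorff d A.
Proof.
have le (b : R) (B : set 'rV[R]_n) : (0 < b)%R ->
    hausdorff d ((fun x => b *: x)%R @` B) <= (b ^+ d)%:E * hausdorff d B.
  move=> b0; apply: hausdorff_lipschitz => // x y _ _.
  by rewrite -scalerBr enormZ gtr0_norm.
move=> a0; apply/le_anti; rewrite le//=.
rewrite -lee_pdivlMl ?exprn_gt0// -exprVn.
rewrite {1}(_ : A = (fun x => a^-1 *: x)%R @` ((fun x => a *: x)%R @` A)).
  by apply: le; rewrite invr_gt0.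
rewrite image_comp -[LHS]image_id; apply: eq_imagel => x _ /=.
by rewrite scalerA mulVf ?scale1r// gt_eqF.
Qed.

(* The cube of side [2 r] is cut into [N ^ d] cubes of side [2 r / N]. *)
Lemma hausdorff_box_fin d (r : R) : (0 < r)%R ->
  hausdorff d (box (const_mx (- r)%R) (const_mx r) : set 'rV[R]_d) < +oo.
Proof.
move=> r0; pose K : R := (unit_ball_volume d / 2 ^+ d * (d%:R * (2 * r)) ^+ d)%R.
suff : hausdorff d (box (const_mx (- r)%R) (const_mx r) : set 'rV[R]_d) <= K%:E.
  by move=> /le_lt_trans; apply; exact: ltry.
apply: ge_ereal_sup => _ [delta /= delta0 <-].
pose N := (Num.truncn (d%:R * (2 * r) / delta)).+1.
have N0 : (0 < N%:R :> R)%R by rewrite ltr0n.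
have hN : (d%:R * (2 * r / N%:R) <= delta)%R.
  rewrite mulrA ler_pdivrMr// [leRHS]mulrC -ler_pdivrMr//.
  have q0 : (0 <= d%:R * (2 * r) / delta)%R.
    by rewrite divr_ge0 ?(ltW delta0)// !mulr_ge0// ltW.
  by apply/ltW; have /andP[] := truncn_itv q0.
pose lo (k : {ffun 'I_d -> 'I_N}) : 'rV[R]_d :=
  (\row_i (- r + (k i)%:R * (2 * r / N%:R)))%R.
pose hi (k : {ffun 'I_d -> 'I_N}) : 'rV[R]_d :=
  (\row_i (- r + (k i).+1%:R * (2 * r / N%:R)))%R.
have cov : box (const_mx (- r)%R) (const_mx r) `<=` \bigcup_k box (lo k) (hi k).
  move=> x xr.
  have /choice[k Hk] : forall i, exists k : 'I_N,
      ((- r + k%:R * (2 * r / N%:R)) <= x 0%R i <= (- r + k.+1%:R * (2 * r / N%:R)))%R.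
    move=> i; have := xr i; rewrite !mxE => /andP[x1 x2].
    set q := ((x 0%R i + r) / (2 * r / N%:R))%R.
    have s0 : (0 < 2 * r / N%:R)%R by rewrite divr_gt0// mulr_gt0.
    have q0 : (0 <= q)%R by rewrite divr_ge0 ?(ltW s0)//; lra.
    have xq : (x 0%R i = - r + q * (2 * r / N%:R))%R by rewrite /q divfK ?gt_eqF//; ring.
    have qN : (q <= N%:R)%R.
      rewrite ler_pdivrMr// mulrC divfK ?gt_eqF//; lra.
    have [qlt|qge] := ltP q N%:R.
      have kN : (Num.truncn q < N)%N by rewrite -(ltr_nat R) (le_lt_trans _ qlt)// truncn_le.
      exists (Ordinal kN) => /=; have /andP[tq qt] := truncn_itv q0.
      by rewrite xq !lerD2l !ler_pM2r// tq ltW.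
    exists ord_max; rewrite xq !lerD2l !ler_pM2r//= qN andbT (le_trans _ qge)//.
    by rewrite ler_nat.
  by exists [ffun i => k i] => // i; rewrite !mxE ffunE.
apply: (le_trans (le_cover_outer _ cov)).
have sub := @le_sigma_subadditive_fin R 'rV[R]_d (cover_outer (hausdorff_gauge d delta))
  {ffun 'I_d -> 'I_N} (fun k => box (lo k) (hi k))
  (cover_outer0 (hausdorff_gauge0 _ _ _) (hausdorff_gauge_ge0 _ _))
  (cover_outer_ge0 (hausdorff_gauge_ge0 _ _))
  (cover_outer_sigma_subadditive (hausdorff_gauge_ge0 _ _))
  (@le_cover_outer R 'rV[R]_d (hausdorff_gauge d delta)).
apply: (le_trans sub); clear sub.
apply: (@le_trans _ _ (\sum_(k : {ffun 'I_d -> 'I_N})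
    (unit_ball_volume d / 2 ^+ d * (d%:R * (2 * r / N%:R)) ^+ d)%:E)).
  apply: lee_sum => k _.
  apply: (le_trans (cover_outer_le _ (hausdorff_gauge0 _ _ _) (hausdorff_gauge_ge0 _ _))).
  apply: hausdorff_gauge_le => //.
    exists (lo k) => i; rewrite lexx/= !mxE lerD2l ler_wpM2r ?ler_nat//.
    by rewrite divr_ge0// mulr_ge0// ltW.
  apply: diam_le => x y xk yk; rewrite lee_fin (le_trans (enorm_le_norm _))// ler_wpM2l//.
  rewrite {1}/Num.norm/= mx_normrE; apply: bigmax_le.
    by rewrite divr_ge0// mulr_ge0// ltW.
  move=> [i j] _/=; rewrite (ord1 i) !mxE ler_norml; have := xk j; have := yk j.
  rewrite !mxE -natr1 mulrDl mul1r => /andP[y1 y2] /andP[x1 x2].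
  by apply/andP; split; lra.
rewrite sumEFin lee_fin sumr_const cardT -cardE card_ffun !card_ord.
rewrite le_eqVlt; apply/orP; left; apply/eqP; rewrite -[LHS]mulr_natr natrX -[LHS]mulrA -exprMn /K.
by congr (_ * _ ^+ _)%R; rewrite !mulrA divfK// gt_eqF.
Qed.

End HausdorffLipschitz.

Section MetricOuterMeasure.
Context {R : realType} (d n : nat).
Implicit Types (A B X : set 'rV[R]_n).
Local Notation mu := (@hausdorff R d n).
Local Open Scope ereal_scope.

Lemma hausdorff_separated A B (r : R) : (0 < r)%R ->
  (forall x y, A x -> B y -> (r <= enorm (x - y))%R) ->
  mu A + mu B <= mu (A `|` B).
Proof.
move=> r0 sep.
have sub delta : (0 < delta < r)%R ->
    cover_outer (hausdorff_gauge d delta) A + cover_outer (hausdorff_gauge d delta) B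
    <= mu (A `|` B).
  move=> /andP[delta0 dr].
  apply: (@le_trans _ _ (cover_outer (hausdorff_gauge d delta) (A `|` B))); last first.
    by apply: ereal_sup_ubound; exists delta.
  apply: cover_outer_ge => F ABF.
  pose G (S : set 'rV[R]_n) k := if pselect (exists x, S x /\ F k x) then F k else set0.
  have GS (S : set 'rV[R]_n) : S `<=` A `|` B -> S `<=` \bigcup_k G S k.
    move=> SAB x Sx; have [k _ Fkx] := ABF _ (SAB _ Sx); exists k => //.
    by rewrite /G; case: pselect => // -[]; exists x.
  apply: (le_trans (leeD (cover_outer_le_sum (hausdorff_gauge d delta) (GS A _))
                         (cover_outer_le_sum (hausdorff_gauge d delta) (GS B _)))).
  - by move=> x; left.
  - by move=> x; right.
  have g0 := @hausdorff_gauge_ge0 R d n delta.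
  rewrite -nneseriesD//; apply: lee_nneseries => k; first by move=> *; rewrite adde_ge0.
  move=> _; rewrite /G.
  case: (pselect (exists x, A x /\ F k x)) => [[x [Ax Fx]]|nA]; last first.
    rewrite hausdorff_gauge0 add0e; case: (pselect (exists x, B x /\ F k x)) => // nB.
    by rewrite hausdorff_gauge0.
  case: (pselect (exists x, B x /\ F k x)) => [[y [By Fy]]|nB]; last first.
    by rewrite hausdorff_gauge0 adde0.
  suff -> : hausdorff_gauge d delta (F k) = +oo by rewrite leey.
  rewrite /hausdorff_gauge ifF; last by apply/negbTE/set0P; exists x.
  rewrite ifF//; apply/negbTE; rewrite -ltNge.
  apply: (@lt_le_trans _ _ (enorm (x - y))%:E); last exact: le_diam.
  by rewrite lte_fin (lt_le_trans dr)// sep.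
have anti delta delta' (S : set 'rV[R]_n) : (delta' <= delta)%R ->
    cover_outer (hausdorff_gauge d delta) S <= cover_outer (hausdorff_gauge d delta') S.
  move=> dd; apply: cover_outer_ge => F SF.
  apply: (le_trans (cover_outer_le_sum _ SF)); apply: lee_nneseries => k.
    by move=> *; exact: hausdorff_gauge_ge0.
  move=> _; rewrite /hausdorff_gauge; case: ifP => // _.
  case: (ifP (diam (F k) <= delta'%:E)) => [Fd|_]; last by rewrite leey.
  by rewrite ifT// (le_trans Fd)// lee_fin.
have cov_ge0 delta S := @cover_outer_ge0 R _ _ (@hausdorff_gauge_ge0 R d n delta) S.
have [->|ABoo] := eqVneq (mu (A `|` B)) +oo; first by rewrite leey.
have AB delta delta' : (0 < delta)%R -> (0 < delta')%R ->
    cover_outer (hausdorff_gauge d delta) A + cover_outer (hausdorff_gauge d delta') B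
    <= mu (A `|` B).
  move=> d0 d0'; pose e : R := Num.min (Num.min delta delta') (r / 2)%R.
  have e0 : (0 < e < r)%R.
    rewrite !lt_min d0 d0' divr_gt0//= gt_min; apply/orP; right; lra.
  apply: le_trans (sub _ e0); apply: leeD; apply: anti.
    by rewrite !ge_min lexx.
  by rewrite !ge_min lexx orbT.
have fin delta' : (0 < delta')%R -> cover_outer (hausdorff_gauge d delta') B \is a fin_num.
  move=> d0; have le := le_trans _ (AB 1%R _ ltr01 d0).
  by rewrite ge0_fin_numE// (le_lt_trans (le _ _))// ?leeDr// ltey.
have Afin : mu A \is a fin_num.
  rewrite ge0_fin_numE ?outer_measure_ge0//; apply: (@le_lt_trans _ _ (mu (A `|` B))).
    by apply: le_outer_measure => x; left.
  by rewrite ltey.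
rewrite addeC -leeBrDr//; apply: ge_ereal_sup => _ [delta' /= d0' <-].
rewrite leeBrDr// addeC -leeBrDr ?fin//; apply: ge_ereal_sup => _ [delta /= d0 <-].
by rewrite leeBrDr ?fin// AB.
Qed.

Lemma hausdorff_lipschitz_measurable (f : 'rV[R]_n -> R) :
  (forall x y, (`|f x - f y| <= enorm (x - y))%R) ->
  mu.-cara.-measurable [set x | (f x <= 0)%R].
Proof.
move=> lipf; apply: le_caratheodory_measurable => X.
set F := [set x | _].
have sep A B (s t : R) : (s < t)%R -> (forall x, A x -> (f x <= s)%R) ->
    (forall x, B x -> (t <= f x)%R) -> mu A + mu B <= mu (A `|` B).
  move=> st As Bt; apply: (@hausdorff_separated _ _ (t - s)); first by rewrite subr_gt0.
  move=> x y /As fxs /Bt fyt; apply: (le_trans _ (lipf x y)).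
  rewrite distrC (le_trans _ (ler_norm _))//; lra.
have [Xoo|Xoo] := eqVneq (mu X) +oo; first by rewrite [leRHS](_ : _ = +oo) ?leey.
pose a (k : nat) : R := (k.+1%:R^-1)%R.
have a0 k : (0 < a k)%R by rewrite invr_gt0.
have aS i j : (i < j)%N -> (a j < a i)%R by move=> ij; rewrite ltf_pV2 ?posrE// ltr_nat ltnS.
pose Y k := X `&` [set x | (a k <= f x)%R].
pose D k := X `&` [set x | (a k.+1 <= f x)%R /\ (f x < a k)%R].
have YX k : mu (Y k) <= mu X by apply: le_outer_measure; exact: subIsetl.
have FY k : mu (X `&` F) + mu (Y k) <= mu X.
  apply: (le_trans (@sep (X `&` F) (Y k) 0%R (a k) (a0 k) _ _)).
  - by move=> x [].
  - by move=> x [].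
  - by apply: le_outer_measure => x [] [].
have sumD i N : \sum_(0 <= j < N) mu (D (j.*2 + i)%N) <= mu X.
  suff H M : \sum_(0 <= j < M.+1) mu (D (j.*2 + i)%N) <= mu (Y (M.*2 + i).+1).
    case: N => [|N]; last exact: le_trans (H N) (YX _).
    by rewrite big_geq// outer_measure_ge0.
  elim: M => [|M IH].
    by rewrite big_nat1; apply: le_outer_measure => x [Xx [Dx _]].
  rewrite big_nat_recr//=; apply: (le_trans (leeD IH (lexx _))).
  rewrite addeC; apply: (le_trans (@sep _ _ (a (M.+1.*2 + i)%N) (a (M.*2 + i).+1) _ _ _)).
  - by apply: aS; rewrite doubleS !addSn ltnS.
  - by move=> x [_ [_ /ltW]].
  - by move=> x [].
  apply: le_outer_measure => x [[Xx [Dx _]]|[Xx Yx]]; split => //.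
  apply: le_trans Yx; apply/ltW/aS; rewrite doubleS !addSn !ltnS; do ?exact: leqW.
have sum2 N : \sum_(0 <= j < N.*2) mu (D j) <= mu X + mu X.
  suff -> : \sum_(0 <= j < N.*2) mu (D j) =
    \sum_(0 <= j < N) mu (D (j.*2 + 0)%N) + \sum_(0 <= j < N) mu (D (j.*2 + 1)%N).
    by apply: leeD; exact: sumD.
  elim: N => [|N IH]; first by rewrite !big_geq// adde0.
  by rewrite doubleS !big_nat_recr//= IH addn0 addn1 -!addeA; congr (_ + _); rewrite addeCA.
have Xfin : mu X \is a fin_num by rewrite ge0_fin_numE ?outer_measure_ge0// ltey.
have sumfin : \sum_(j <oo) mu (D j) < +oo.
  apply: (@le_lt_trans _ _ (mu X + mu X)); last by rewrite -ge0_fin_numE ?fin_numD ?Xfin// adde_ge0 ?outer_measure_ge0.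
  apply: lime_le; first by apply: is_cvg_nneseries => *; exact: outer_measure_ge0.
  near=> N; apply: le_trans (sum2 N).
  by rewrite -addnn [leRHS](big_cat_nat (n := N)) ?leq_addr//= leeDl// sume_ge0// => *; exact: outer_measure_ge0.
have tail0 : \sum_(N <= j <oo) mu (D j) @[N --> \oo] --> 0.
  by apply: nneseries_tail_cvg => // k _; exact: outer_measure_ge0.
apply/lee_addgt0Pr => e e0.
have [N tailN] : exists N, \sum_(N <= j <oo) mu (D j) <= e%:E.
  move/fine_cvgP : tail0 => [[N1 _ finN] /cvgrPdist_le/(_ _ e0)[N2 _ leN]].
  exists (maxn N1 N2); rewrite -(fineK (finN _ (leq_maxl _ _))) lee_fin.
  by have := leN _ (leq_maxr N1 N2); rewrite /= sub0r normrN; apply: le_trans (ler_norm _).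
have cov : X `&` ~` F `<=` Y N `|` \bigcup_(j in ~` `I_N) D j.
  move=> x [Xx /negP]; rewrite -ltNge => fx0.
  have [j fj] : exists j, (a j <= f x)%R.
    exists (Num.truncn (f x)^-1); rewrite /a -[leRHS]invrK lef_pV2 ?posrE ?invr_gt0//.
    have fi0 : (0 <= (f x)^-1)%R by rewrite invr_ge0 ltW.
    by apply/ltW; have /andP[] := truncn_itv fi0.
  have [jN|Nj] := leqP j N.
    by left; split => //; apply: le_trans fj; rewrite lef_pV2 ?posrE// ler_nat ltnS.
  have [fN|fN] := leP (a N) (f x); first by left.
  right; elim: j Nj fj => // j IH; rewrite ltnS => Nj fj.
  have [fj'|fj'] := leP (a j) (f x); last by exists j => //=; apply/negP; rewrite -leqNgt.
  move: Nj; rewrite leq_eqVlt => /predU1P[Nj|/IH]; last exact.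
  by move: fN; rewrite Nj ltNge fj'.
apply: (@le_trans _ _ (mu (X `&` F) + (mu (Y N) + e%:E))).
  apply: leeD => //; apply: (le_trans (le_outer_measure mu _ _ cov)).
  apply: (le_trans (outer_measureU2 _ _ _)); apply: leeD => //.
  exact: le_trans (outer_measure_sigma_subadditive_tail _ _ _) tailN.
by rewrite addeA leeD.
Unshelve. all: by end_near. Qed.

Lemma hausdorff_closed_measurable A : closed A -> mu.-cara.-measurable A.
Proof.
move=> clA; have [->|/set0P[a0 Aa0]] := eqVneq A set0; first exact: measurable0.
pose f x := inf [set enorm (x - y) | y in A].
have lbd x : has_lbound [set enorm (x - y) | y in A].
  by exists 0%R => _ [y _ <-]; exact: enorm_ge0.
have nz x : [set enorm (x - y) | y in A] !=set0 by exists (enorm (x - a0)), a0.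
have lipf x y : (f x - f y <= enorm (x - y))%R.
  rewrite lerBlDl -lerBlDr; apply: lb_le_inf => // _ [z Az <-].
  rewrite lerBlDr; apply: (@le_trans _ _ (enorm (x - z))).
    by apply: ge_inf => //; exists z.
  by rewrite [leRHS]addrC (le_trans _ (ler_enormD _ _))// subrKA.
rewrite (_ : A = [set x | (f x <= 0)%R]).
  apply: hausdorff_lipschitz_measurable => x y; rewrite ler_norml lerNl opprB lipf.
  by rewrite enormBC lipf.
apply/seteqP; split => [x Ax|x /= fx0].
  by apply: ge_inf => //; exists x => //; rewrite subrr enorm0.
apply: clA; move=> U /nbhs_enormP[e e0 eU].
have [_ [y Ay <-]] := inf_adherent e0 (conj (nz x) (lbd x)).
by move=> xy; exists y; split => //; apply: eU; rewrite enormBC (lt_le_trans xy)// gerDr.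
Qed.

Lemma hausdorff_measurable_fun A (f : 'rV[R]_n -> R) : closed A ->
  (forall t : R, closed (A `&` [set x | (t <= f x)%R])) ->
  @measurable_fun _ _ (caratheodory_type mu) R A f.
Proof.
move=> clA clf; apply: (measurability (@RGenCInfty.G R)).
  exact: RGenCInfty.measurableE.
by move=> _ [_ [t ->] <-]; apply: hausdorff_closed_measurable; rewrite set_itvE; exact: clf.
Qed.

End MetricOuterMeasure.

(** * Lower integrals *)

Section LowerIntegral.
Context d (T : measurableType d) (R : realType).
Variables (mu : {measure set T -> \bar R}) (D : set T).
Hypothesis mD : measurable D.
Import HBNNSimple.
Local Open Scope ereal_scope.

Lemma integral_nnsfun_supp (h : {nnsfun T >-> R}) :
  (forall x, ~ D x -> h x = 0%R) -> \int[mu]_(x in D) (h x)%:E = sintegral mu h.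
Proof.
move=> h0; rewrite integral_nnsfun//; congr (sintegral mu _).
apply/funext => x; rewrite patchE; case: ifPn => // /negP; rewrite inE => /h0 ->.
by [].
Qed.

(* For a function that need not be measurable, the integral is a lower integral. *)
Lemma integral_lowerE (f : T -> \bar R) : (forall x, D x -> 0 <= f x) ->
  \int[mu]_(x in D) f x = ereal_sup [set \int[mu]_(x in D) (h x)%:E |
    h in [set h : {nnsfun T >-> R} | (forall x, D x -> (h x)%:E <= f x) /\
                                     (forall x, ~ D x -> h x = 0%R)]].
Proof.
move=> f0; have fD x : 0 <= (f \_ D) x.
  by rewrite patchE; case: ifPn => //; rewrite inE => /f0.
rewrite /integral.
have -> : (f \_ D)^\+ = f \_ D.
  by apply/funext => x; rewrite (ge0_funeposE (D := setT))// ?inE.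
have -> : (f \_ D)^\- = cst 0.
  by apply/funext => x; rewrite (ge0_funenegE (D := setT))// ?inE.
rewrite [X in _ - X](_ : _ = 0); last first.
  apply/le_anti/andP; split; last first.
    by apply: ereal_sup_ubound; exists nnsfun0 => //; exact: sintegral0.
  apply: ge_ereal_sup => _ [h /= h0 <-].
  have -> : h = nnsfun0 :> (T -> R).
    by apply/funext => x; apply/le_anti; rewrite -lee_fin h0/= fun_ge0.
  by rewrite sintegral0.
rewrite sube0; congr ereal_sup; apply/seteqP; split => _ [h /= hf <-].
  have h0 x : ~ D x -> h x = 0%R.
    move=> nDx; have := hf x; rewrite patchE memNset// lee_fin => hx.
    by apply/le_anti; rewrite hx fun_ge0.
  exists h; last exact: integral_nnsfun_supp.
  by split => // x Dx; have := hf x; rewrite patchE mem_set.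
exists h; last exact/esym/integral_nnsfun_supp/hf.2.
by move=> x; rewrite patchE; case: ifPn => [/set_mem/hf.1//|/negP]; rewrite inE => /hf.2 ->.
Qed.

Lemma le_lower_integral (f g : T -> \bar R) : (forall x, D x -> 0 <= f x) ->
  (forall x, D x -> f x <= g x) -> \int[mu]_(x in D) f x <= \int[mu]_(x in D) g x.
Proof.
move=> f0 fg; rewrite !integral_lowerE//; last first.
  by move=> x Dx; rewrite (le_trans (f0 _ Dx))// fg.
apply: ge_ereal_sup => _ [h [hf h0] <-]; apply: ereal_sup_ubound.
by exists h => //; split => // x Dx; rewrite (le_trans (hf _ Dx))// fg.
Qed.

Lemma lower_integral_le (f : T -> \bar R) (X : \bar R) : (forall x, D x -> 0 <= f x) ->
  (forall h : {nnsfun T >-> R}, (forall x, D x -> (h x)%:E <= f x) ->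
    (forall x, ~ D x -> h x = 0%R) -> \int[mu]_(x in D) (h x)%:E <= X) ->
  \int[mu]_(x in D) f x <= X.
Proof.
by move=> f0 H; rewrite integral_lowerE//; apply: ge_ereal_sup => _ [h [hf h0] <-]; exact: H.
Qed.

Hypothesis muD : mu D < +oo.
Variables (a : T -> R) (M : R).
Hypothesis aM : forall x, D x -> (0 <= a x <= M)%R.

Lemma lower_integral_fin : \int[mu]_(x in D) (a x)%:E \is a fin_num.
Proof.
have a0 x : D x -> 0 <= (a x)%:E by move=> /aM/andP[]; rewrite lee_fin.
rewrite ge0_fin_numE; last exact: integral_ge0.
apply: (@le_lt_trans _ _ (\int[mu]_(x in D) cst M%:E x)).
  by apply: le_lower_integral => // x /aM/andP[_]; rewrite lee_fin.
have fin : mu D \is a fin_num by rewrite ge0_fin_numE.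
by rewrite integral_cst// -(fineK fin) -EFinM ltry.
Qed.

(* [m] is a largest measurable minorant of [a]; multiplying [a] by a measurable
   function multiplies the lower integral as if [a] were [m]. *)
Lemma measurable_kernel : exists m : T -> R, [/\ measurable_fun setT m,
  forall x, D x -> (0 <= m x <= a x)%R &
  \int[mu]_(x in D) (m x)%:E = \int[mu]_(x in D) (a x)%:E].
Proof.
have a0 x : D x -> 0 <= (a x)%:E by move=> /aM/andP[]; rewrite lee_fin.
have /choice[h hP] : forall k : nat, exists h : {nnsfun T >-> R},
    [/\ forall x, D x -> (h x <= a x)%R, forall x, ~ D x -> h x = 0%R &
     \int[mu]_(x in D) (a x)%:E <= \int[mu]_(x in D) (h x)%:E + (k.+1%:R^-1)%:E].
  move=> k; have := lower_integral_fin; rewrite [in X in X -> _]integral_lowerE// => fin.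
  have k0 : (0 < k.+1%:R^-1 :> R)%R by rewrite invr_gt0.
  have [_ [h [hf h0] <-] lt] := ub_ereal_sup_adherent k0 fin.
  exists h; split => //; rewrite [leLHS]integral_lowerE// -leeBlDr//; exact: ltW.
have ubD x : has_ubound (range (fun k => h k x)).
  have [Dx|nDx] := pselect (D x).
    by exists (a x) => _ [k _ <-]; have [+ _ _] := hP k; apply.
  by exists 0%R => _ [k _ <-]; have [_ + _] := hP k => ->.
have hm k x : (h k x <= sups (fun k => h k x) 0%N)%R.
  apply: ub_le_sup; last by exists k.
  by have [y uby] := ubD x; exists y => _ [j _ <-]; apply: uby; exists j.
exists (fun x => sups (fun k => h k x) 0%N); split.
- by apply: measurable_fun_sups => // k; exact: measurable_funP.
- move=> x Dx; apply/andP; split; first by apply: le_trans (hm 0%N x); exact: fun_ge0.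
  apply: ge_sup; first by exists (h 0%N x), 0%N.
  by move=> _ [k _ <-]; have [+ _ _] := hP k; apply.
apply/le_anti/andP; split.
  apply: le_lower_integral => x Dx; rewrite lee_fin.
    by apply: le_trans (hm 0%N x); exact: fun_ge0.
  apply: ge_sup; first by exists (h 0%N x), 0%N.
  by move=> _ [k _ <-]; have [+ _ _] := hP k; apply.
apply/lee_addgt0Pr => e e0; pose k := Num.truncn e^-1.
have [_ _ le] := hP k; apply: (le_trans le); apply: leeD.
  by apply: le_lower_integral => x Dx; rewrite lee_fin// fun_ge0.
rewrite lee_fin -[leRHS]invrK lef_pV2 ?posrE ?invr_gt0//.
have e0' : (0 <= e^-1)%R by rewrite invr_ge0 ltW.
by apply/ltW; have /andP[] := truncn_itv e0'.
Qed.

Lemma kernel_mul (m b : T -> R) (N : R) : measurable_fun setT m ->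
  (forall x, D x -> (0 <= m x <= a x)%R) ->
  \int[mu]_(x in D) (m x)%:E = \int[mu]_(x in D) (a x)%:E ->
  measurable_fun D b -> (forall x, D x -> (0 <= b x <= N)%R) ->
  \int[mu]_(x in D) (a x * b x)%:E = \int[mu]_(x in D) (m x * b x)%:E.
Proof.
move=> mm ma mE mb bN; apply/le_anti/andP; split; last first.
  apply: le_lower_integral => x Dx; have /andP[m0 mla] := ma _ Dx; have /andP[b0 _] := bN _ Dx.
    by rewrite lee_fin mulr_ge0.
  by rewrite lee_fin ler_wpM2r.
apply: lower_integral_le.
  move=> x Dx; have /andP[a0 _] := aM Dx; have /andP[b0 _] := bN _ Dx.
  by rewrite lee_fin mulr_ge0.
move=> h hab h0; pose q x := (h x * powR (b x) (-1))%R.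
have mmD : measurable_fun D m by exact: measurable_funTS.
have mq : measurable_fun D q.
  apply: measurable_funM; first exact: measurable_funTS.
  exact: (measurableT_comp (measurable_powR (-1)%R)).
have qE x : D x -> b x != 0%R -> q x = (h x / b x)%R.
  move=> Dx b0; rewrite /q powR_inv1//; by have /andP[] := bN _ Dx.
have q0 x : (0 <= q x)%R by rewrite mulr_ge0 ?fun_ge0 ?powR_ge0.
have qb x : D x -> (q x * b x = h x)%R.
  move=> Dx; have [b0|b0] := eqVneq (b x) 0%R; last by rewrite qE// divfK.
  rewrite b0 mulr0; apply/le_anti; rewrite fun_ge0/=.
  by have := hab _ Dx; rewrite b0 mulr0 lee_fin.
have qa x : D x -> (q x <= a x)%R.
  move=> Dx; have [b0|b0] := eqVneq (b x) 0%R.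
    by rewrite /q b0 powR0 ?oppr_eq0 ?oner_eq0// mulr0; have /andP[] := aM Dx.
  have bp : (0 < b x)%R by rewrite lt_neqAle eq_sym b0; have /andP[] := bN _ Dx.
  by rewrite -(ler_pM2r bp) qb// -lee_fin hab.
pose m' x := Num.max (m x) (q x).
have mm' : measurable_fun D m' by exact: measurable_maxr.
have intm : mu.-integrable D (EFin \o m).
  apply: measurable_bounded_integrable => //.
  exists M; split; rewrite ?num_real// => K MK x Dx /=.
  have /andP[m0 mla] := ma _ Dx; have /andP[_ aleM] := aM Dx.
  by rewrite ger0_norm// (le_trans mla)// (le_trans aleM)// ltW.
have intm' : mu.-integrable D (EFin \o m').
  apply: measurable_bounded_integrable => //.
  exists M; split; rewrite ?num_real// => K MK x Dx /=.
  have /andP[m0 mla] := ma _ Dx; have /andP[_ aleM] := aM Dx.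
  rewrite ger0_norm ?le_max ?m0// ge_max (le_trans mla) ?(le_trans (qa _ Dx))//; exact: le_trans aleM (ltW MK).
have E : \int[mu]_(x in D) `|((m' x - m x)%R)%:E| = 0.
  transitivity (\int[mu]_(x in D) ((m' x)%:E - (m x)%:E)).
    apply: eq_integral => x _; rewrite -EFinB abse_EFin ger0_norm//.
    by rewrite subr_ge0 le_max lexx.
  rewrite integralB_EFin//; apply/le_anti/andP; split; last first.
    by rewrite -integralB_EFin//; apply: integral_ge0 => x _; rewrite -EFinB lee_fin subr_ge0 le_max lexx.
  rewrite leeBlDr ?add0e; last exact: (integrable_fin_num mD intm).
  rewrite mE; apply: le_lower_integral => x Dx; rewrite lee_fin.
    by rewrite le_max q0 orbT.
  by rewrite ge_max qa//; have /andP[] := ma _ Dx => _ ->.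
have /ae_eq_integral_abs : measurable_fun D (fun x => (m' x - m x)%:E).
  by apply/measurable_EFinP; exact: measurable_funB.
move=> /(_ mu mD)/iffLR/(_ E) ae0.
apply: ae_ge0_le_integral => //.
- by move=> x _; rewrite lee_fin fun_ge0.
- by apply/measurable_EFinP; exact: measurable_funTS.
- by move=> x Dx; rewrite lee_fin mulr_ge0//; [have /andP[] := ma _ Dx|have /andP[] := bN _ Dx].
- by apply/measurable_EFinP; exact: measurable_funM.
apply: filterS ae0 => x H Dx; have /eqP := H Dx; rewrite /= eqe subr_eq0 => /eqP mm'x.
rewrite lee_fin -qb// ler_wpM2r//; first by have /andP[] := bN _ Dx.
by rewrite -mm'x le_max lexx orbT.
Qed.

End LowerIntegral.

Section LowerDominatedConvergence.
Context d (T : measurableType d) (R : realType).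
Variables (mu : {measure set T -> \bar R}) (D : set T).
Hypotheses (mD : measurable D) (muD : (mu D < +oo)%E).
Local Open Scope ereal_scope.

Lemma lower_dominated_convergence (a : T -> R) (b : (T -> R)^nat) (f b_ : T -> R) (M N : R) :
  (forall x, D x -> (0 <= a x <= M)%R) ->
  (forall k, measurable_fun D (b k)) ->
  (forall k x, D x -> (0 <= b k x <= N)%R) ->
  (forall x, D x -> (0 < a x)%R -> b k x @[k --> \oo] --> b_ x) ->
  (forall x, D x -> f x = (a x * b_ x)%R) ->
  \int[mu]_(x in D) (a x * b k x)%:E @[k --> \oo] --> \int[mu]_(x in D) (f x)%:E.
Proof.
move=> aM mb bN b_lim fE.
have [m [mm ma mE]] := measurable_kernel mD muD aM.
have bub x : D x -> has_ubound (range (fun k => b k x)).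
  by move=> Dx; exists N => _ [k _ <-]; have /andP[] := bN k x Dx.
have blb x : D x -> has_lbound (range (fun k => b k x)).
  by move=> Dx; exists 0%R => _ [k _ <-]; have /andP[] := bN k x Dx.
pose B x := Num.max 0%R (Num.min N (limn_sup (fun k => b k x))).
have mB : measurable_fun D B.
  apply: measurable_maxr => //; apply: measurable_minr => //.
  exact: measurable_fun_limn_sup.
have BE x : D x -> (0 < a x)%R -> B x = b_ x.
  move=> Dx ax; have lim := b_lim _ Dx ax.
  have -> : B x = Num.max 0%R (Num.min N (b_ x)).
    by rewrite /B; congr (Num.max _ (Num.min _ _)); exact: (cvg_lim _ (cvg_sups lim)).
  have b0 : (0 <= b_ x)%R.
    rewrite -(cvg_lim _ lim)//; apply: limr_ge; first by apply/cvg_ex; exists (b_ x).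
    by apply: nearW => k; have /andP[] := bN k x Dx.
  have bNx : (b_ x <= N)%R.
    rewrite -(cvg_lim _ lim)//; apply: limr_le; first by apply/cvg_ex; exists (b_ x).
    by apply: nearW => k; have /andP[] := bN k x Dx.
  by rewrite (min_idPr bNx); apply/max_idPr.
have N0 x : D x -> (0 <= N)%R.
  by move=> Dx; have /andP[b0 bN'] := bN 0%N x Dx; exact: le_trans bN'.
have BN x : D x -> (0 <= B x <= N)%R.
  by move=> Dx; rewrite le_max lexx/= ge_max (N0 x Dx) ge_min lexx.
have -> : \int[mu]_(x in D) (f x)%:E = \int[mu]_(x in D) (m x * B x)%:E.
  rewrite -(kernel_mul mD muD aM mm ma mE mB BN).
  apply: eq_integral => x /set_mem Dx; rewrite fE//; congr (_%:E).
  have /andP[a0 _] := aM _ Dx; move: a0; rewrite le_eqVlt => /predU1P[<-|a0].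
    by rewrite !mul0r.
  by rewrite BE.
under eq_fun => k do rewrite (kernel_mul mD muD aM mm ma mE (mb k) (bN k)).
have mmD : measurable_fun D m by exact: measurable_funTS.
have [] := @dominated_convergence _ _ _ mu D mD (fun k x => (m x * b k x)%:E)
  (fun x => (m x * B x)%:E) (cst (M * N)%:E).
- by move=> k; apply/measurable_EFinP; exact: measurable_funM.
- by apply/measurable_EFinP; exact: measurable_funM.
- apply: aeW => x Dx; apply: cvg_EFin; first by apply: nearW.
  have /andP[a0 _] := aM _ Dx; move: a0; rewrite le_eqVlt => /predU1P[a0|a0].
    have m0 : m x = 0%R by apply/le_anti; have := ma _ Dx; rewrite -a0 andbC.
    rewrite m0 mul0r (_ : _ \o _ = cst 0%R); first exact: cvg_cst.
    by apply/funext => k /=; rewrite mul0r.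
  by apply: cvgMr; rewrite BE//; exact: b_lim.
- apply: (measurable_bounded_integrable (f := cst (M * N)%R)) => //.
  by exists `|(M * N)%R|%R; split; rewrite ?num_real// => K MK x _; exact: ltW.
- apply: aeW => x k Dx; rewrite lee_fin.
  have /andP[m0 mla] := ma _ Dx; have /andP[_ aleM] := aM _ Dx.
  have /andP[b0 bN'] := bN k _ Dx.
  by rewrite ger0_norm ?mulr_ge0// ler_pM// (le_trans mla).
by [].
Qed.

End LowerDominatedConvergence.

Section HausdorffIntegralScale.
Context {R : realType} (d n : nat).
Local Notation mu := (@hausdorff_measure R d n).
Local Notation X := (caratheodory_type (@hausdorff R d n)).
Import HBNNSimple.
Local Open Scope ereal_scope.

Lemma caratheodory_scale (a : R) (A : set 'rV[R]_n) : (0 < a)%R ->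
  (@hausdorff R d n).-caratheodory A ->
  (@hausdorff R d n).-caratheodory ((fun x => a *: x)%R @^-1` A).
Proof.
move=> a0 mA; apply: le_caratheodory_measurable => Y.
have an : a != 0%R by rewrite gt_eqF.
have S (B : set 'rV[R]_n) : hausdorff d ((fun x => a *: x)%R @` B) =
  (a ^+ d)%:E * hausdorff d B := hausdorff_scale d B a0.
pose P := (fun x : 'rV[R]_n => a *: x)%R @^-1` A.
change (hausdorff d (Y `&` P) + hausdorff d (Y `&` ~` P) <= hausdorff d Y).
have ap : (0 < a ^+ d)%R by rewrite exprn_gt0.
rewrite -(@lee_pmul2l _ (a ^+ d)%:E)// ge0_muleDr ?outer_measure_ge0// -!S.
rewrite [leRHS](mA ((fun x => a *: x)%R @` Y)); apply: leeD; apply: le_outer_measure.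
  by move=> _ [x [Xx Ax] <-]; split => //; exists x.
by move=> _ [x [Xx Ax] <-]; split => //; exists x.
Qed.

Lemma lower_integral_scale_le (a : R) (D : set 'rV[R]_n) (f : 'rV[R]_n -> \bar R) :
  (0 < a)%R -> (@hausdorff R d n).-cara.-measurable D ->
  (forall x, D x -> 0 <= f (a *: x)%R) ->
  \int[mu]_(x in (fun x => a *: x)%R @` D) f x <=
  (a ^+ d)%:E * \int[mu]_(x in D) f (a *: x)%R.
Proof.
move=> a0 mD f0; have an : a != 0%R by rewrite gt_eqF.
set D' := _ @` D.
have DE : D' = (fun x => a^-1 *: x)%R @^-1` D.
  apply/seteqP; split => [_ [x Dx <-]|x Dx]; first by rewrite /= scalerA mulVf// scale1r.
  by exists (a^-1 *: x)%R => //; rewrite scalerA divff// scale1r.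
have mD' : (@hausdorff R d n).-cara.-measurable D'.
  by rewrite DE; apply: caratheodory_scale => //; rewrite invr_gt0.
pose phi : X -> X :=
  fun x => (a^-1 *: (x : 'rV[R]_n))%R.
have mphi : measurable_fun setT phi.
  move=> _ A mA; rewrite setTI; apply: caratheodory_scale => //.
  by rewrite invr_gt0.
have ad : (0 <= a ^+ d)%R by rewrite exprn_ge0// ltW.
apply: lower_integral_le => // [|h hf h0].
  by move=> _ [x Dx <-]; exact: f0.
have mh : @measurable_fun _ _ X _ D (fun x : 'rV[R]_n => (h (a *: x)%R)%:E).
  apply/measurable_EFinP.
  move=> mD0 B mB; have mhB : (@hausdorff R d n).-caratheodory (h @^-1` B).
    by have := measurable_funP h measurableT B mB; rewrite setTI.
  by apply: (@measurableI _ X) => //; exact: (caratheodory_scale a0 mhB).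
have -> : \int[mu]_(x in D') (h x)%:E =
    \int[mu]_(x in phi @^-1` D) ((fun x => (h (a *: x)%R)%:E) \o phi) x.
  rewrite DE; apply: eq_integral => x _ /=; rewrite /phi scalerA divff// scale1r//.
rewrite -ge0_integral_pushforward//; last by move=> x _; rewrite lee_fin fun_ge0.
have -> : \int[pushforward mu phi]_(x in D) (h (a *: x)%R)%:E =
    \int[mscale (NngNum ad) mu]_(x in D) (h (a *: x)%R)%:E.
  apply: eq_measure_integral => A mA _.
  change (hausdorff d (phi @^-1` A : set 'rV[R]_n) =
    (a ^+ d)%:E * hausdorff d (A : set 'rV[R]_n)).
  rewrite -hausdorff_scale//; congr (hausdorff d _); apply/seteqP; split => [x Ax|_ [x Ax <-]].
    by exists (a^-1 *: x)%R => //; rewrite scalerA divff// scale1r.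
  by rewrite /phi/= scalerA mulVf// scale1r.
have h_ge0 (x : X) : D x -> (0 <= (h (a *: x)%R)%:E) by rewrite lee_fin fun_ge0.
rewrite (ge0_integral_mscale mu mD _ mh h_ge0) /=.
apply: lee_wpmul2l; first by rewrite lee_fin.
apply: (le_lower_integral mu mD) => x Dx; first by rewrite lee_fin fun_ge0.
by apply: hf; exists x.
Qed.

Lemma lower_integral_scale (a : R) (D : set 'rV[R]_n) (f : 'rV[R]_n -> \bar R) :
  (0 < a)%R -> (@hausdorff R d n).-cara.-measurable D ->
  (forall x, D x -> 0 <= f (a *: x)%R) ->
  \int[mu]_(x in (fun x => a *: x)%R @` D) f x =
  (a ^+ d)%:E * \int[mu]_(x in D) f (a *: x)%R.
Proof.
move=> a0 mD f0; apply/le_anti; rewrite lower_integral_scale_le//=.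
have an : a != 0%R by rewrite gt_eqF.
have ap : (0 < a ^+ d)%R by rewrite exprn_gt0.
have ai : (0 < a^-1)%R by rewrite invr_gt0.
set D' := _ @` D.
have DE : D = (fun x => a^-1 *: x)%R @` D'.
  rewrite /D' image_comp -[LHS]image_id; apply: eq_imagel => x _ /=.
  by rewrite scalerA mulVf// scale1r.
rewrite -lee_pdivlMl// -exprVn {1}DE.
have mD' : (@hausdorff R d n).-cara.-measurable D'.
  rewrite (_ : D' = (fun x => a^-1 *: x)%R @^-1` D); first exact: caratheodory_scale.
  apply/seteqP; split => [_ [x Dx <-]|x Dx]; first by rewrite /= scalerA mulVf// scale1r.
  by exists (a^-1 *: x)%R => //; rewrite scalerA divff// scale1r.
apply: (le_trans (@lower_integral_scale_le a^-1 D' (fun x => f (a *: x)%R) ai mD' _)).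
  by move=> _ [x Dx <-]; rewrite (scalerA a^-1) mulVf// scale1r f0.
apply: lee_wpmul2l; first by rewrite lee_fin exprn_ge0// ltW.
rewrite le_eqVlt; apply/orP; left; apply/eqP; apply: eq_integral => x _.
by rewrite scalerA divff// scale1r.
Qed.

End HausdorffIntegralScale.

(** * Curvature *)

Section Convexity.
Context {R : realType}.

Lemma convex_setP n (C : set 'rV[R]_n) (x y : 'rV[R]_n) (t : R) :
  @convex_set R 'rV[R]_n C -> C x -> C y -> 0 <= t <= 1 -> C (t *: x + (1 - t) *: y).
Proof.
move=> cC Cx Cy /andP[t0 t1].
have := cC x y (Itv01 t0 t1); rewrite !inE => /(_ Cx Cy).
by [].
Qed.

Lemma closure_enormP n (A : set 'rV[R]_n) x :
  closure A x <-> forall e : R, 0 < e -> exists2 y, A y & enorm (y - x) < e.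
Proof.
split=> [Ax e e0|H U /nbhs_enormP[e e0 eU]].
  have [y [Ay yx]] := Ax _ (near_enorm x e0).
  by exists y.
by have [y Ay yx] := H _ e0; exists y; split => //; exact: eU.
Qed.

Lemma scale_imageE n (a : R) (A : set 'rV[R]_n) x : a != 0 ->
  ((fun x => a *: x) @` A) (a *: x) <-> A x.
Proof.
move=> a0; split; last by move=> Ax; exists x.
by move=> [y Ay] /(scalerI a0) <-.
Qed.

Lemma boundary_scale n (a : R) (A : set 'rV[R]_n) : 0 < a ->
  boundary ((fun x => a *: x) @` A) = (fun x => a *: x) @` boundary A.
Proof.
move=> a0; have an : a != 0 by rewrite gt_eqF.
have clE x : closure ((fun x => a *: x) @` A) (a *: x) <-> closure A x.
  split=> /closure_enormP H; apply/closure_enormP => e e0.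
    have [_ [y Ay <-] yx] := H (a * e) (mulr_gt0 a0 e0); exists y => //.
    by move: yx; rewrite -scalerBr enormZ gtr0_norm// ltr_pM2l.
  have ai0 : 0 < a^-1 by rewrite invr_gt0.
  have [y Ay yx] := H (a^-1 * e) (mulr_gt0 ai0 e0).
  exists (a *: y); first by exists y.
  by rewrite -scalerBr enormZ gtr0_norm// mulrC -ltr_pdivlMr// mulrC.
have inE x : interior ((fun x => a *: x) @` A) (a *: x) <-> interior A x.
  split=> /interior_enormP[e e0 H]; apply/interior_enormP.
    exists (a^-1 * e) => [|y yx]; first by rewrite mulr_gt0// invr_gt0.
    apply/(scale_imageE A y an)/H.
    by rewrite -scalerBr enormZ gtr0_norm// mulrC -ltr_pdivlMr// mulrC.
  exists (a * e) => [|y yx]; first exact: mulr_gt0.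
  have -> : y = a *: (a^-1 *: y) by rewrite scalerA divff// scale1r.
  apply/scale_imageE => //; apply: H.
  rewrite -(ltr_pM2l a0) -[X in X * _]gtr0_norm// -enormZ scalerBr scalerA.
  by rewrite divff// scale1r.
apply/seteqP; split => [y [cy ny]|_ [x [cx nx] <-]]; last first.
  by split; [exact/clE|move=> /inE].
have yE : y = a *: (a^-1 *: y) by rewrite scalerA divff// scale1r.
by exists (a^-1 *: y) => //; split; [apply/clE; rewrite -yE|move=> /inE; rewrite -yE].
Qed.

End Convexity.

Section Curvature.
Context {R : realType} {d : nat}.
Implicit Types (K : set 'rV[R]_d.+1) (x u : 'rV[R]_d.+1) (B : 'M[R]_(d, d.+1)).
Implicit Types (f : 'rV[R]_d -> R^o) (A : 'M[R]_d).

Lemma second_order_le f A : f 0 = 0 -> second_order_expansion f A ->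
  exists2 c : R, 0 < c & exists2 r : R, 0 < r &
    forall w, enorm w < r -> `|f w| <= c * enorm w ^+ 2.
Proof.
move=> f0 /(_ 1 ltr01)/nbhs_enormP[r r0 H].
have [K K0 HK] := mulmx_enorm_le A.
exists (1 + K); first by rewrite addr_gt0.
exists r => // w wr; have := H w; rewrite subr0 => /(_ wr).
have : `|2^-1 * dot (w *m A) w| <= K * enorm w ^+ 2.
  rewrite normrM gtr0_norm ?invr_gt0//.
  have := dot_le_enorm (w *m A) w; have := HK w; have := enorm_ge0 w.
  set e := enorm w; set t := `|_| => e0 wA te.
  have : t <= K * e ^+ 2 by rewrite expr2 mulrA (le_trans te)// ler_wpM2r.
  have : 0 <= t by exact: normr_ge0.
  lra.
rewrite mul1r mulrDl mul1r => h1 h2.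
rewrite -[f w](subrK (2^-1 * dot (w *m A) w)).
by rewrite (le_trans (ler_normD _ _))// lerD.
Qed.

Lemma symmetric_form_eq0 m (N : 'M[R]_m) : N^T = N ->
  (forall w, dot (w *m N) w = 0) -> N = 0.
Proof.
move=> symN N0; have NC v w : dot (v *m N) w = 0.
  have := N0 (v + w); rewrite mulmxDl !dotDl !dotDr !N0 add0r addr0.
  rewrite [dot (w *m N) v]dot_mulmx symN (dotC w) => /eqP.
  by rewrite -mulr2n mulrn_eq0 => /eqP.
apply/row_matrixP => i; rewrite row0 rowE; apply: dot_eq0; exact: NC.
Qed.

Lemma quadratic_little_o m (N : 'M[R]_m) :
  (forall e : R, 0 < e -> exists2 r : R, 0 < r &
    forall w, enorm w < r -> `|dot (w *m N) w| <= e * enorm w ^+ 2) ->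
  forall w, dot (w *m N) w = 0.
Proof.
move=> H w; apply/eqP; rewrite -normr_le0 leNgt; apply/negP => Nw.
have wn : 0 < enorm w ^+ 2.
  rewrite enorm_sqr; apply: dot_gt0; apply: contraTN Nw => /eqP ->.
  by rewrite mul0mx dot0l normr0 ltxx.
set e := `|dot (w *m N) w| / enorm w ^+ 2 / 2.
have e0 : 0 < e by rewrite !divr_gt0.
have [r r0 Hr] := H _ e0.
have en0 : 0 < enorm w.
  by rewrite lt_neqAle enorm_ge0 andbT eq_sym; apply: contraTneq wn => ->; rewrite expr0n ltxx.
have [t t0 tw] : exists2 t, 0 < t & enorm (t *: w) < r.
  exists (r / 2 / enorm w); first by rewrite !divr_gt0.
  rewrite enormZ gtr0_norm ?divr_gt0// divfK ?gt_eqF//; lra.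
have := Hr _ tw; rewrite -scalemxAl dotZl dotZr mulrA -expr2 normrM.
rewrite [`|t ^+ 2|]ger0_norm ?sqr_ge0// enormZ (gtr0_norm t0) exprMn.
rewrite [X in _ <= X]mulrCA ler_pM2l ?exprn_gt0// /e.
rewrite mulrAC divfK ?gt_eqF//; lra.
Qed.

(* In the second frame the first graph is [w |-> f (w *m Q)] for the
   orthogonal matrix [Q = B' *m B^T]. *)
Lemma curvature_spec_inj K x (h h' : R) :
  curvature_spec K x h -> curvature_spec K x h' -> h = h'.
Proof.
move=> [u [B [r [f [A [[nu uniq_u] [[uB r0 gr] [[f_ge0 f0 _] [symA expA ->]]]]]]]]].
move=> [u' [B' [r' [f' [A' [[nu' _] [[uB' r0' gr'] [[f_ge0' f0' _] [symA' expA' ->]]]]]]]]].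
have uu : u' = u by exact: uniq_u.
rewrite {u' nu'}uu in uB' gr'.
have [Q [B'E OO]] : exists Q : 'M[R]_d, B' = Q *m B /\ Q *m Q^T = 1%:M.
  have [_ BB' Bu'] := uB'; have B'E : B' = B' *m B^T *m B.
    rewrite -mulmxA -[LHS]mulmx1 -(frame_id uB) mulmxDr [X in _ + X]mulmxA Bu'.
    by rewrite mul0mx addr0.
  by exists (B' *m B^T) => //; rewrite trmx_mul trmxK mulmxA -B'E.
have dO : \det Q ^+ 2 = 1 by rewrite expr2 -{2}det_tr -det_mulmx OO det1.
have enO w : enorm (w *m Q) = enorm w.
  by rewrite /enorm dot_mulmx -mulmxA OO mulmx1.
have [c c0 [s s0 f'c]] := second_order_le f0' expA'.
have [e1 e10 near1] := iffLR (nbhs_enormP _ _) gr.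
have [e2 e20 near2] := iffLR (nbhs_enormP _ _) gr'.
have [rho rho0 ff'] : exists2 rho : R, 0 < rho &
    forall w, enorm w < rho -> f' w = f (w *m Q).
  pose m := Num.min (Num.min s r') (Num.min 1 (Num.min (e1 / (1 + c)) (e2 / (1 + c)))).
  have c1 : 0 < 1 + c by rewrite addr_gt0.
  exists m; first by rewrite !lt_min s0 r0' ltr01 !divr_gt0.
  move=> w; rewrite !lt_min => /andP[/andP[ws wr] /andP[w1 /andP[we1 we2]]].
  pose y := x + w *m B' - f' w *: u.
  have yx : enorm (y - x) <= (1 + c) * enorm w.
    rewrite /y -[x + _ - _]addrA addrAC subrr add0r (le_trans (ler_enormB _ _))//.
    rewrite (frame_enorm _ uB') enormZ; have [-> _ _] := uB; rewrite mulr1 mulrDl mul1r lerD2l.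
    apply: (le_trans (f'c _ ws)); rewrite ler_pM2l// expr2 ler_piMl ?enorm_ge0//; exact: ltW.
  have Sy : boundary K y.
    apply/near2; first by rewrite (le_lt_trans yx)// mulrC -ltr_pdivlMr.
    by exists w.
  have /near1[H _] : enorm (y - x) < e1 by rewrite (le_lt_trans yx)// mulrC -ltr_pdivlMr.
  have [w2 w2r] := H Sy; rewrite /y -!addrA => /addrI.
  rewrite -!scaleNr B'E mulmxA => E.
  have E1 := congr1 (fun v => v *m B^T) E; rewrite !(frame_coord _ _ uB) in E1.
  have E2 := congr1 (fun v => dot v u) E; rewrite !(frame_dotu _ _ uB) in E2.
  by rewrite E1; apply: oppr_inj.
pose N := A' - Q *m A *m Q^T.
have symN : N^T = N by rewrite /N linearB/= !trmx_mul trmxK symA symA' mulmxA.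
have N0 : N = 0.
  apply: symmetric_form_eq0 => //; apply: quadratic_little_o => e e0.
  have e4 : 0 < e / 4 by rewrite divr_gt0.
  have [r1 r10 H1] := iffLR (nbhs_enormP _ _) (expA _ e4).
  have [r2 r20 H2] := iffLR (nbhs_enormP _ _) (expA' _ e4).
  exists (Num.min rho (Num.min r1 r2)); first by rewrite !lt_min rho0 r10 r20.
  move=> w; rewrite !lt_min => /andP[wrho /andP[wr1 wr2]].
  have := H1 (w *m Q); rewrite subr0 enO => /(_ wr1); rewrite -ff'//.
  have := H2 w; rewrite subr0 => /(_ wr2).
  have -> : dot (w *m Q *m A) (w *m Q) = dot (w *m (Q *m A *m Q^T)) w.
    by rewrite [RHS]dotC !mulmxA -dot_mulmx dotC.
  rewrite /N mulmxBr dotBl.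
  set p := dot _ w; set q := dot _ w; set z := enorm w ^+ 2.
  rewrite !ler_norml => /andP[h1 h2] /andP[h3 h4].
  by apply/andP; split; lra.
have -> : A' = Q *m A *m Q^T by apply/eqP; rewrite -subr_eq0; apply/eqP.
by rewrite !det_mulmx det_tr mulrAC -expr2 dO mul1r.
Qed.

Lemma curvature_spec_scale K x (a h : R) : 0 < a -> curvature_spec K x h ->
  curvature_spec ((fun x => a *: x) @` K) (a *: x) ((a ^+ d)^-1 * h).
Proof.
move=> a0; have an : a != 0 by rewrite gt_eqF.
have ai0 : 0 < a^-1 by rewrite invr_gt0.
move=> [u [B [r [f [A [[nu uniq_u] [[uB r0 gr] [[f_ge0 f0 cvxf] [symA expA ->]]]]]]]]].
have nE v : outer_unit_normal ((fun x => a *: x) @` K) (a *: x) v <->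
    outer_unit_normal K x v.
  split=> -[v1 H]; (split; first exact: v1).
    move=> y Ky; have := H (a *: y); rewrite -scalerBr dotZl pmulr_rle0//; apply.
    by exists y.
  by move=> _ [y Ky <-]; rewrite -scalerBr dotZl pmulr_rle0// H.
exists u, B, (a * r), (fun w => a * f (a^-1 *: w)), (a^-1 *: A).
have ballE w : eball (a * r) w <-> eball r (a^-1 *: w).
  by rewrite /eball/= enormZ gtr0_norm// ltr_pdivrMl.
split; first by split; [exact/nE|move=> v /nE/uniq_u].
split; split => //; rewrite ?mulr_gt0//.
- rewrite /local_graph boundary_scale//.
  have [e e0 H] := iffLR (nbhs_enormP _ _) gr.
  apply/nbhs_enormP; exists (a * e); first exact: mulr_gt0.
  move=> y yx; have yE : y = a *: (a^-1 *: y) by rewrite scalerA divff// scale1r.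
  rewrite {1}yE scale_imageE//.
  have /H -> : enorm (a^-1 *: y - x) < e.
    rewrite -(ltr_pM2l a0) -[X in X * _]gtr0_norm// -enormZ scalerBr scalerA.
    by rewrite divff// scale1r.
  split=> -[w wr wE].
    exists (a *: w); first by apply/ballE; rewrite scalerA mulVf// scale1r.
    by rewrite yE wE !scalerDr scalerN !scalerA -scalemxAl mulVf// scale1r.
  exists (a^-1 *: w); first exact/ballE.
  rewrite wE !scalerDr scalerN !scalerA mulVf// scale1r mulrA mulVf// mul1r.
  by rewrite scalemxAl.
- split=> //; first by move=> w /ballE/f_ge0 fw; rewrite mulr_ge0// ltW.
    by rewrite scaler0 f0 mulr0.
  move=> t v w /set_mem/ballE vr /set_mem/ballE wr.
  have := cvxf t (a^-1 *: v) (a^-1 *: w) (mem_set vr) (mem_set wr).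
  rewrite -(ler_pM2l a0) !convRE /conv/= !scalerDr !scalerA ![_ * a^-1]mulrC.
  have E (s s' p q : R) : a * (s * p + s' * q) = s * (a * p) + s' * (a * q) by ring.
  by move=> H; exact: (eq_ind _ (fun z : R => is_true (_ <= z)) H _ (E _ _ _ _)).
- split.
  + by rewrite linearZ/= symA.
  + move=> e e0; have e1 : 0 < a * e by exact: mulr_gt0.
    have [s s0 H] := iffLR (nbhs_enormP _ _) (expA _ e1).
    apply/nbhs_enormP; exists (a * s); first exact: mulr_gt0.
    move=> w; rewrite subr0 => ws.
    have := H (a^-1 *: w); rewrite subr0 enormZ (gtr0_norm ai0) ltr_pdivrMl// => /(_ ws).
    rewrite -scalemxAl dotZl dotZr -scalemxAr dotZl.
    rewrite -(ler_pM2l a0) -{1}(gtr0_norm a0) -normrM.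
    set q := dot _ _.
    have -> : a * (f (a^-1 *: w) - 2^-1 * (a^-1 * (a^-1 * q))) =
      a * f (a^-1 *: w) - 2^-1 * (a^-1 * q) by field.
    have -> : a * (a * e * (a^-1 * enorm w) ^+ 2) = e * enorm w ^+ 2 by field.
    by [].
  + by rewrite detZ exprVn.
Qed.

Lemma gauss_kronecker_scale K x (a : R) : 0 < a ->
  gauss_kronecker ((fun x => a *: x) @` K) (a *: x) =
  (a ^+ d)^-1 * gauss_kronecker K x.
Proof.
move=> a0; have an : a != 0 by rewrite gt_eqF.
have [[h Kh]|nK] := pselect (exists h, curvature_spec K x h).
  have -> : gauss_kronecker K x = h.
    by apply: xget_unique => // h' /curvature_spec_inj; apply.
  apply: xget_unique; first exact: curvature_spec_scale.
  move=> h' /curvature_spec_inj; apply; exact: curvature_spec_scale.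
have -> : gauss_kronecker K x = 0.
  by apply: xgetPN => h Kh; apply: nK; exists h.
rewrite mulr0; apply: xgetPN => h Kh; apply: nK.
exists ((a^-1 ^+ d)^-1 * h).
have := @curvature_spec_scale _ _ a^-1 _ _ Kh; rewrite invr_gt0 => /(_ a0).
rewrite scalerA mulVf// scale1r image_comp (_ : _ @` K = K)//.
rewrite -[RHS]image_id; apply: eq_imagel => y _ /=.
by rewrite scalerA mulVf// scale1r.
Qed.

End Curvature.

(** * The Hilbert metric *)

Section ExitTime.
Context {R : realType} {n : nat}.
Implicit Types (C : set 'rV[R]_n) (x y v : 'rV[R]_n).

Lemma boundary_sub C : closed C -> boundary C `<=` C.
Proof. by move=> clC x [/clC]. Qed.

Lemma closed_boundary C : closed (boundary C).
Proof.
rewrite (_ : boundary C = closure C `&` ~` interior C)//.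
apply: closedI; first exact: closed_closure.
exact/open_closedC/open_interior.
Qed.

Lemma segment_boundary C x y : closed C -> C x -> ~ C y ->
  exists2 t : R, 0 <= t <= 1 & boundary C (x + t *: (y - x)).
Proof.
move=> clC Cx nCy; pose S := [set t : R | 0 <= t <= 1 /\ C (x + t *: (y - x))].
have S0 : S 0 by rewrite /S/= lexx ler01 scale0r addr0.
have ubS : has_ubound S by exists 1 => t [/andP[]].
pose T := sup S.
have T0 : 0 <= T by exact: ub_le_sup.
have T1 : T <= 1 by apply: ge_sup; [exists 0|move=> t [/andP[]]].
have CT : C (x + T *: (y - x)).
  apply: clC; apply/closure_enormP => e e0.
  pose L := 1 + enorm (y - x).
  have L0 : 0 < L by rewrite ltr_pwDl ?enorm_ge0.
  have [t [t01 Ct] tT] := sup_adherent (divr_gt0 e0 L0) (conj (ex_intro _ _ S0) ubS).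
  exists (x + t *: (y - x)) => //.
  rewrite opprD addrACA subrr add0r -scalerBl enormZ distrC ger0_norm; last first.
    by rewrite subr_ge0 ub_le_sup.
  have : T - t < e / L by rewrite -/T in tT; lra.
  rewrite ltr_pdivlMr// => h; apply: le_lt_trans h.
  by rewrite ler_wpM2l ?subr_ge0 ?ub_le_sup// lerDr.
exists T; first by rewrite T0 T1.
split; first exact: subset_closure.
move=> /interior_enormP[e e0 H].
have Tlt : T < 1.
  rewrite lt_neqAle T1 andbT; apply: contra_notN nCy => /eqP T1E.
  by move: CT; rewrite T1E scale1r addrC subrK.
pose L := 1 + enorm (y - x).
have L0 : 0 < L by rewrite ltr_pwDl ?enorm_ge0.
pose t := T + Num.min (1 - T) (e / L / 2).
have m0 : 0 < Num.min (1 - T) (e / L / 2) by rewrite lt_min subr_gt0 Tlt !divr_gt0.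
suff : S t by move=> /(ub_le_sup ubS); rewrite -/T /t gerDl leNgt m0.
split.
  apply/andP; split; first by rewrite addr_ge0// ltW.
  by rewrite /t -lerBrDl ge_min lexx.
apply: H; rewrite opprD addrACA subrr add0r -scalerBl enormZ /t addrAC subrr add0r.
rewrite gtr0_norm//; apply: (@le_lt_trans _ _ (e / L / 2 * L)).
  rewrite ler_pM ?enorm_ge0 ?(ltW m0)//; first by rewrite ge_min lexx orbT.
  by rewrite lerDr.
rewrite mulrAC divfK ?gt_eqF//; lra.
Qed.

Lemma segment_interior C x y (t : R) : @convex_set R 'rV[R]_n C ->
  interior C x -> C y -> 0 <= t < 1 -> interior C ((1 - t) *: x + t *: y).
Proof.
move=> cC /interior_enormP[e e0 H] Cy /andP[t0 t1].
have s0 : 0 < 1 - t by rewrite subr_gt0.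
apply/interior_enormP; exists ((1 - t) * e); first exact: mulr_gt0.
move=> z zp; set w := x + (1 - t)^-1 *: (z - ((1 - t) *: x + t *: y)).
have Cw : C w.
  apply: H; rewrite /w addrC addKr enormZ gtr0_norm ?invr_gt0//.
  by rewrite ltr_pdivrMl.
have := @convex_setP R n C w y (1 - t) cC Cw Cy.
rewrite ltW//= (_ : 1 - (1 - t) = t) ?gerBl ?t0; last by ring.
move=> /(_ isT); rewrite /w scalerDr scalerA divff ?gt_eqF// scale1r.
by rewrite addrC addrA [t *: y + _]addrC addrC subrK.
Qed.

Lemma exit_timeP C x v : closed C -> (exists M : R, forall y, C y -> enorm y <= M) ->
  @convex_set R 'rV[R]_n C -> interior C x -> v != 0 ->
  0 < exit_time C x v /\
  forall t : R, 0 < t -> (C (x + t *: v) <-> t <= exit_time C x v).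
Proof.
move=> clC [M CM] cC ix v0; have Cx : C x by exact: interior_subset.
have vp : 0 < enorm v.
  by rewrite lt_neqAle enorm_ge0 andbT eq_sym; apply: contra v0 => /eqP/enorm_eq0 ->.
have M0 : 0 <= M by apply: le_trans (CM _ Cx); exact: enorm_ge0.
pose T := (M + enorm x + 1) / enorm v.
have T0 : 0 < T by rewrite divr_gt0// ltr_pwDr// addr_ge0// enorm_ge0.
have nCT : ~ C (x + T *: v).
  move=> /CM; have : enorm (T *: v) <= enorm (x + T *: v) + enorm x.
    by have := ler_enormB (x + T *: v) x; rewrite addrC addKr.
  rewrite enormZ gtr0_norm// {1}/T divfK ?gt_eqF//; lra.
have [t /andP[t0 t1]] := segment_boundary clC Cx nCT.
rewrite [x + T *: v - x]addrAC subrr add0r scalerA => bt.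
have lt_int s q : 0 <= s -> s < q -> C (x + q *: v) -> interior C (x + s *: v).
  move=> s0 sq Cq; have q0 : 0 < q by exact: le_lt_trans sq.
  have sq1 : 0 <= s / q < 1 by rewrite divr_ge0 ?(ltW q0)//= ltr_pdivrMr// mul1r.
  have := segment_interior cC ix Cq sq1.
  by rewrite scalerDr scalerA divfK ?gt_eqF// addrA -scalerDl subrK scale1r.
have tT0 : 0 < t * T.
  rewrite lt_neqAle mulr_ge0 ?(ltW T0)// andbT eq_sym; apply/eqP => tT.
  by move: bt; rewrite tT scale0r addr0 => -[].
have [e0 be] : 0 < exit_time C x v /\ boundary C (x + exit_time C x v *: v).
  rewrite /exit_time; apply: (@xgetPex _ 0 [set t | 0 < t /\ boundary C (x + t *: v)]).
  by exists (t * T).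
split=> // s s0; split=> [Cs|].
  rewrite leNgt; apply/negP => es; case: be => _; apply.
  exact: (lt_int _ s (ltW e0) es Cs).
rewrite le_eqVlt => /predU1P[->|se]; first exact: (boundary_sub clC be).
exact: (interior_subset (lt_int _ _ (ltW s0) se (boundary_sub clC be))).
Qed.

End ExitTime.

Section HilbertNorm.
Context {R : realType} {n : nat}.
Variable C : set 'rV[R]_n.
Hypotheses (clC : closed C) (bdC : exists M : R, forall y, C y -> enorm y <= M)
  (cC : @convex_set R 'rV[R]_n C).
Implicit Types (x y v : 'rV[R]_n).

Definition exit_rate x v : R := (exit_time C x v)^-1.

Lemma exit_rate_gt0 x v : interior C x -> v != 0 -> 0 < exit_rate x v.
Proof. by move=> ix v0; rewrite invr_gt0; have [] := exit_timeP clC bdC cC ix v0. Qed.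

Lemma exit_rate_le x v (t : R) : interior C x -> v != 0 -> 0 < t ->
  (exit_rate x v <= t^-1) <-> C (x + t *: v).
Proof.
move=> ix v0 t0; have [e0 ->//] := exit_timeP clC bdC cC ix v0.
by rewrite lef_pV2 ?posrE.
Qed.

Lemma exit_rate_mono x x' v v' (c : R) : 0 < c -> interior C x -> interior C x' ->
  v != 0 -> v' != 0 ->
  (forall t : R, 0 < t -> C (x + t *: v) -> C (x' + (c * t) *: v')) ->
  c * exit_rate x' v' <= exit_rate x v.
Proof.
move=> c0 ix ix' v0 v0' H; have [e0 He] := exit_timeP clC bdC cC ix v0.
have /H : C (x + exit_time C x v *: v) by apply/He.
have ce : 0 < c * exit_time C x v by exact: mulr_gt0.
move=> /(_ e0)/(exit_rate_le ix' v0' ce).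
rewrite invfM -/(exit_rate x v) => /(ler_wpM2l (ltW c0)).
by rewrite mulrA divff ?gt_eqF// mul1r.
Qed.

Lemma hilbert_normE x v : v != 0 ->
  hilbert_norm C x v = 2^-1 * (exit_rate x v + exit_rate x (- v)).
Proof. by rewrite /hilbert_norm => /negbTE ->. Qed.

Lemma hilbert_norm_mono x x' v (c : R) : 0 < c -> interior C x -> interior C x' ->
  (forall v (t : R), 0 < t -> C (x + t *: v) -> C (x' + t *: (c *: v))) ->
  hilbert_norm C x' (c *: v) <= hilbert_norm C x v.
Proof.
move=> c0 ix ix' H; have [->|v0] := eqVneq v 0.
  by rewrite scaler0 /hilbert_norm eqxx.
have cv0 : c *: v != 0 by rewrite scaler_eq0 negb_or gt_eqF.
rewrite (hilbert_normE x' cv0) (hilbert_normE x v0) -scalerN.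
apply: ler_wpM2l; first by rewrite invr_ge0.
apply: lerD.
  rewrite -[leLHS]mul1r; apply: exit_rate_mono => // t t0 /H; rewrite mul1r; exact.
rewrite -[leLHS]mul1r; apply: exit_rate_mono; rewrite ?oppr_eq0 ?scalerN ?oppr_eq0//.
by move=> t t0 /H; rewrite mul1r scalerN; exact.
Qed.

Lemma hilbert_normZ x v (c : R) : 0 < c -> interior C x ->
  hilbert_norm C x (c *: v) = c * hilbert_norm C x v.
Proof.
move=> c0 ix; have ci : 0 < c^-1 by rewrite invr_gt0.
have [->|v0] := eqVneq v 0; first by rewrite scaler0 /hilbert_norm eqxx/= mulr0.
have cv0 : c *: v != 0 by rewrite scaler_eq0 negb_or gt_eqF.
have rateZ w : w != 0 -> exit_rate x (c *: w) = c * exit_rate x w.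
  move=> w0; have cw0 : c *: w != 0 by rewrite scaler_eq0 negb_or gt_eqF.
  apply/le_anti/andP; split.
    rewrite -ler_pdivrMl//; apply: exit_rate_mono => // t t0.
    by rewrite scalerA mulrAC mulVf ?gt_eqF// mul1r.
  by apply: exit_rate_mono => // t t0; rewrite scalerA mulrC.
have nv0 : - v != 0 by rewrite oppr_eq0.
by rewrite (hilbert_normE x cv0) (hilbert_normE x v0) -scalerN !rateZ// -mulrDr mulrCA.
Qed.

Lemma hilbert_unit_ball_fin x : interior C x ->
  (lebesgue_outer (hilbert_unit_ball C x) < +oo)%E.
Proof.
move=> ix; have [M CM] := bdC; have Cx : C x by exact: interior_subset.
have M0 : 0 <= M by apply: le_trans (CM _ Cx); exact: enorm_ge0.
pose a : 'rV[R]_n := const_mx (- (4 * M)); pose b : 'rV[R]_n := const_mx (4 * M).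
apply: (@le_lt_trans _ _ (lebesgue_outer (box a b))).
  apply: le_lebesgue_outer => v; rewrite /hilbert_unit_ball/= => Nv i; rewrite !mxE -ler_norml.
  apply: (le_trans (coord_le_enorm _ _)).
  have [->|v0] := eqVneq v 0; first by rewrite enorm0 mulr_ge0.
  have : exit_rate x v <= (2^-1)^-1.
    have nv0 : - v != 0 by rewrite oppr_eq0.
    have -> : (2^-1)^-1 = 2 :> R by rewrite invrK.
    move: (exit_rate_gt0 ix nv0) Nv; rewrite hilbert_normE//.
    move: (exit_rate x v) (exit_rate x (- v)) => p q; lra.
  have h0 : 0 < 2^-1 :> R by rewrite invr_gt0.
  move=> /(exit_rate_le ix v0 h0)/CM; have := CM _ Cx.
  have := ler_enormB (x + 2^-1 *: v) x.
  have -> : x + 2^-1 *: v - x = 2^-1 *: v by rewrite addrAC subrr add0r.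
  rewrite enormZ gtr0_norm//; move: (enorm v) (enorm x) (enorm _) => p q s; lra.
apply: (le_lt_trans (lebesgue_outer_box_le _)); last exact: ltry.
by move=> i; rewrite !mxE; lra.
Qed.

End HilbertNorm.

Section HilbertBallVolume.
Context {R : realType} {n : nat}.
Variable C : set 'rV[R]_n.
Hypotheses (clC : closed C) (bdC : exists M : R, forall y, C y -> enorm y <= M)
  (cC : @convex_set R 'rV[R]_n C).
Implicit Types (x y v : 'rV[R]_n).

Lemma lebesgue_outer_scale (a : R) (A : set 'rV[R]_n) : 0 < a ->
  lebesgue_outer ((fun x => a *: x) @` A) = ((a ^+ n)%:E * lebesgue_outer A)%E.
Proof.
move=> a0; have an : a != 0 by rewrite gt_eqF.
have := @lebesgue_outer_trig R n a%:M A (scalar_mx_is_trig _ _).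
rewrite det_scalar ger0_norm ?exprn_ge0 ?(ltW a0)// => <- => [|i].
  by congr lebesgue_outer; apply: eq_imagel => x _; rewrite mul_mx_scalar.
by rewrite mxE eqxx.
Qed.

Lemma dist_lt_of_ratio (V W e k q : R) : 0 < V -> 0 < e -> 0 < k -> k < 1 ->
  k * (V + e) = e / 2 -> 1 - k < q -> q * V <= W -> q * W <= V -> `|V - W| < e.
Proof.
move=> V0 e0 k0 k1 kE kq h1 h2.
have q0 : 0 < q by apply: lt_trans kq; rewrite subr_gt0.
have W0 : 0 <= W by apply: le_trans h1; rewrite mulr_ge0// ltW.
have qV : (1 - k) * V < q * V by rewrite ltr_pM2r.
have kV : k * V <= e / 2 by rewrite -kE ler_pM2l// lerDl ltW.
rewrite ltr_norml; apply/andP; split.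
  have kW : (1 - k) * W <= V by apply: le_trans h2; rewrite ler_wpM2r// ltW.
  have : (1 - k) * W < (1 - k) * (V + e).
    apply: (le_lt_trans kW); rewrite mulrBl mul1r kE; lra.
  by rewrite ltr_pM2l ?subr_gt0//; lra.
rewrite mulrBl mul1r in qV; lra.
Qed.

Definition hilbert_volume x : R := fine (lebesgue_outer (hilbert_unit_ball C x)).

Lemma hilbert_volumeE x : interior C x ->
  lebesgue_outer (hilbert_unit_ball C x) = (hilbert_volume x)%:E.
Proof.
move=> ix; rewrite fineK// ge0_fin_numE ?lebesgue_outer_ge0//.
exact: hilbert_unit_ball_fin.
Qed.

Lemma hilbert_volume_ge x (c : R) (A : set 'rV[R]_n) : interior C x -> 0 < c ->
  (forall v, A v -> hilbert_norm C x v <= c) ->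
  (lebesgue_outer A <= (c ^+ n * hilbert_volume x)%:E)%E.
Proof.
move=> ix c0 AN; rewrite EFinM -hilbert_volumeE// -lebesgue_outer_scale//.
apply: le_lebesgue_outer => v /AN Nv.
have vE : v = c *: (c^-1 *: v) by rewrite scalerA divff ?gt_eqF// scale1r.
exists (c^-1 *: v); last by rewrite -vE.
have ci : 0 < c^-1 by rewrite invr_gt0.
rewrite /hilbert_unit_ball/= hilbert_normZ//.
by rewrite ler_pdivrMl// mulr1.
Qed.

Lemma hilbert_volume_le x (c : R) (A : set 'rV[R]_n) : interior C x -> 0 < c ->
  (forall v, hilbert_norm C x v <= c -> A v) ->
  ((c ^+ n * hilbert_volume x)%:E <= lebesgue_outer A)%E.
Proof.
move=> ix c0 AN; rewrite EFinM -hilbert_volumeE// -lebesgue_outer_scale//.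
apply: le_lebesgue_outer => _ [v + <-]; rewrite /hilbert_unit_ball/= => Nv.
by apply: AN; rewrite hilbert_normZ// -[leRHS]mulr1 ler_pM2l.
Qed.

Lemma hilbert_volume_gt0 x : interior C x -> 0 < hilbert_volume x.
Proof.
move=> ix; have /interior_enormP[e e0 H] := ix.
have e2 : 0 < e / 2 by rewrite divr_gt0.
rewrite -lte_fin -hilbert_volumeE//.
apply: (@lt_le_trans _ _ (lebesgue_outer ((fun x => (e / 2) *: x) @` closed_eball 1))).
  rewrite lebesgue_outer_scale// (closed_eball_volume n).2 -EFinM lte_fin.
  by rewrite mulr_gt0 ?exprn_gt0// (closed_eball_volume n).1.
apply: le_lebesgue_outer => _ [w + <-]; rewrite /closed_eball /hilbert_unit_ball/= => w1.
have [->|v0] := eqVneq ((e / 2) *: w) 0; first by rewrite /hilbert_norm eqxx.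
have we : enorm ((e / 2) *: w) < e.
  rewrite enormZ gtr0_norm//; apply: (@le_lt_trans _ _ (e / 2 * 1)); last by lra.
  by rewrite ler_pM2l.
have nv0 : - ((e / 2) *: w) != 0 by rewrite oppr_eq0.
have h1 : exit_rate C x ((e / 2) *: w) <= 1^-1.
  by apply/exit_rate_le => //; rewrite scale1r; apply: H; rewrite addrAC subrr add0r.
have h2 : exit_rate C x (- ((e / 2) *: w)) <= 1^-1.
  apply/exit_rate_le => //; rewrite scale1r; apply: H.
  by rewrite addrAC subrr add0r enormN.
rewrite hilbert_normE//; move: h1 h2; rewrite invr1.
move: (exit_rate _ _ _) (exit_rate _ _ _) => p q; lra.
Qed.

Lemma hilbert_volume_shift x x' (rho eta : R) :
  (forall y, enorm (y - x) < rho -> C y) -> interior C x -> interior C x' ->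
  0 < eta < 1 -> enorm (x' - x) < eta * rho ->
  (1 - eta) ^+ n * hilbert_volume x <= hilbert_volume x'.
Proof.
move=> H ix ix' /andP[eta0 eta1] x'x; have s0 : 0 < 1 - eta by rewrite subr_gt0.
have si : 0 < (1 - eta)^-1 by rewrite invr_gt0.
rewrite -ler_pdivlMl ?exprn_gt0// -exprVn -lee_fin -(hilbert_volumeE ix).
apply: hilbert_volume_ge => // v; rewrite /hilbert_unit_ball/= => Nv.
suff : hilbert_norm C x' ((1 - eta) *: v) <= 1.
  rewrite (hilbert_normZ clC bdC cC v s0 ix').
  by move: (hilbert_norm C x' v) => p; rewrite -ler_pdivlMl// mulr1.
apply: le_trans Nv; apply: hilbert_norm_mono => // w t t0 Cw.
pose z := x + eta^-1 *: (x' - x).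
have Cz : C z.
  by apply: H; rewrite /z addrAC subrr add0r enormZ gtr0_norm ?invr_gt0// ltr_pdivrMl.
have := @convex_setP R n C z (x + t *: w) eta cC Cz Cw.
rewrite !ltW// => /(_ isT).
rewrite (_ : eta *: z + (1 - eta) *: (x + t *: w) = x' + t *: ((1 - eta) *: w))//.
by apply/rowP => i; rewrite /z !mxE; field; rewrite gt_eqF.
Qed.

Lemma hilbert_volume_near x (e : R) : interior C x -> 0 < e ->
  \forall x' \near x, `|hilbert_volume x - hilbert_volume x'| < e.
Proof.
move=> ix e0; have [rho rho0 H] := iffLR (interior_enormP _ _) ix.
have V0 := hilbert_volume_gt0 ix; set V := hilbert_volume x in V0.
have near_x (eta : R) : 0 < eta < 1 -> \forall x' \near x,
    (1 - eta) ^+ n * V <= hilbert_volume x' /\ (1 - eta) ^+ n * hilbert_volume x' <= V.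
  move=> eta01; have /andP[eta0 eta1] := eta01.
  have er0 : 0 < eta * (rho / 2) by rewrite mulr_gt0// divr_gt0.
  apply: filterS (near_enorm x er0) => x' x'x.
  have r2 : enorm (x' - x) < rho / 2.
    apply: (lt_le_trans x'x); apply: ler_piMl; last exact: ltW.
    by rewrite divr_ge0// ltW.
  have H' y : enorm (y - x') < rho / 2 -> C y.
    move=> yx'; apply: H; have := ler_enormD (y - x') (x' - x).
    rewrite addrA subrK => le; apply: (le_lt_trans le); lra.
  have ix' : interior C x' by apply/interior_enormP; exists (rho / 2) => //; rewrite divr_gt0.
  split; last by apply: (hilbert_volume_shift H' ix' ix eta01); rewrite enormBC.
  apply: (hilbert_volume_shift H ix ix' eta01); apply: (lt_le_trans x'x).
  rewrite ler_pM2l//; lra.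
have cvgp := @continuous_horner R ((1 - 'X) ^+ n) 0.
pose k := e / (V + e) / 2.
have Ve : 0 < V + e by rewrite addr_gt0.
have k0 : 0 < k by rewrite !divr_gt0.
have [/= r r0 Hr] := iffLR (cvgrPdist_lt _ _) cvgp _ k0.
pose eta := Num.min (1 / 2) (r / 2).
have eta0 : 0 < eta by rewrite lt_min !divr_gt0.
have eta1 : eta < 1 by rewrite gt_min; apply/orP; left; lra.
have etar : `|0 - eta| < r.
  by rewrite sub0r normrN gtr0_norm// gt_min; apply/orP; right; lra.
have := Hr _ etar; rewrite /= !hornerE subr0 expr1n; set q := (1 - eta) ^+ n => hq.
have q1 : 1 - k < q by have := ler_norm (1 - q); lra.
have kE : k * (V + e) = e / 2 by rewrite /k mulrAC divfK ?gt_eqF.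
have k1 : k < 1 by rewrite /k ltr_pdivrMr// ltr_pdivrMr// mul1r; lra.
apply: filterS (near_x _ (introT andP (conj eta0 eta1))) => x' [h1 h2].
exact: (dist_lt_of_ratio V0 e0 k0 k1 kE q1 h1 h2).
Qed.

End HilbertBallVolume.

(** * Asymptotics of the Busemann density *)

Section LocalRegion.
Context {R : realType} {d : nat}.
Implicit Types (C : set 'rV[R]_d.+1) (u x v : 'rV[R]_d.+1) (B : 'M[R]_(d, d.+1)).
Implicit Types (f : 'rV[R]_d -> R^o) (w : 'rV[R]_d).

Definition frame_point x u B w (s : R) : 'rV[R]_d.+1 := x + w *m B - s *: u.

Lemma frame_point_dist x u B w s w' s' : orthonormal_frame u B ->
  enorm (frame_point x u B w s - frame_point x u B w' s') <= enorm (w - w') + `|s - s'|.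
Proof.
move=> uB; have [u1 _ _] := uB.
have -> : frame_point x u B w s - frame_point x u B w' s' =
    (w - w') *m B - (s - s') *: u.
  rewrite /frame_point mulmxBl scalerBl !opprD !opprK; apply/rowP => i; rewrite !mxE; ring.
by rewrite (le_trans (ler_enormB _ _))// (frame_enorm _ uB) enormZ u1 mulr1.
Qed.

Lemma frame_pointP x u B v : orthonormal_frame u B ->
  v = frame_point x u B ((v - x) *m B^T) (- dot (v - x) u).
Proof.
move=> uB; rewrite /frame_point scaleNr opprK -addrA -(frame_decomp _ uB).
by rewrite addrC subrK.
Qed.

Lemma frame_point_inj x u B w s w' s' : orthonormal_frame u B ->
  frame_point x u B w s = frame_point x u B w' s' -> w = w' /\ s = s'.
Proof.
move=> uB; rewrite /frame_point -!addrA => /addrI; rewrite -!scaleNr => E; split.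
  by have := congr1 (fun v => v *m B^T) E; rewrite !(frame_coord _ _ uB).
by have := congr1 (fun v => dot v u) E; rewrite !(frame_dotu _ _ uB) => /oppr_inj.
Qed.

Lemma frame_point_segment x u B w s w' s' (t : R) :
  frame_point x u B w s + t *: (frame_point x u B w' s' - frame_point x u B w s) =
  frame_point x u B (w + t *: (w' - w)) (s + t * (s' - s)).
Proof.
rewrite /frame_point mulmxDl -scalemxAl mulmxBl scalerDl -scalerA scalerBl.
by apply/rowP => i; rewrite !mxE; ring.
Qed.

Lemma local_region C x u B (r : R) f : closed C -> @convex_set R 'rV[R]_d.+1 C ->
  interior C !=set0 -> boundary C x -> orthonormal_frame u B -> 0 < r ->
  local_graph (boundary C) x u B r f -> f 0 = 0 ->
  (forall e : R, 0 < e -> exists2 rho : R, 0 < rho & forall w, enorm w < rho -> `|f w| < e) ->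
  exists2 rho : R, 0 < rho &
    (forall w s, enorm w < rho -> `|s| < rho -> (C (frame_point x u B w s) <-> f w <= s)) \/
    (forall w s, enorm w < rho -> `|s| < rho -> (C (frame_point x u B w s) <-> s <= f w)).
Proof.
move=> clC cC [b /interior_enormP[e0 e00 Hb]] bx uB r0 gr f0 fc.
have Cx : C x by exact: boundary_sub.
have xE : frame_point x u B 0 0 = x by rewrite /frame_point mul0mx scale0r addr0 subr0.
have [e ep near_x] := iffLR (nbhs_enormP _ _) gr.
have e4 : 0 < e / 4 by rewrite divr_gt0.
set c := e / 4 in e4.
have [r1 r10 fr1] := fc _ e4.
pose rho := Num.min (Num.min r r1) c.
have rho0 : 0 < rho by rewrite !lt_min r0 r10 e4.
have rho_lt w : enorm w < rho -> [/\ enorm w < r, `|f w| < c & enorm w < c].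
  by rewrite !lt_min => /andP[/andP[wr wr1] wc]; split => //; exact: fr1.
have bE w s : enorm w < rho -> `|s| <= c -> (boundary C (frame_point x u B w s) <-> s = f w).
  move=> wrho sc; have [wr fw wc] := rho_lt _ wrho.
  have near_z : enorm (frame_point x u B w s - x) < e.
    rewrite -[X in _ - X]xE (le_lt_trans (frame_point_dist _ _ _ _ _ uB))//.
    rewrite !subr0; rewrite /c in sc wc; lra.
  have := near_x _ near_z; rewrite -/(frame_point x u B w s) => ->.
  split=> [[w' _ E]|->]; last by exists w.
  by have [-> ->] := frame_point_inj uB (E : _ = frame_point x u B w' (f w')).
have seg w s w' s' : (forall t : R, 0 <= t <= 1 ->
     ~ boundary C (frame_point x u B (w + t *: (w' - w)) (s + t * (s' - s)))) ->
   C (frame_point x u B w s) -> C (frame_point x u B w' s').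
  move=> nb Cz; apply: contrapT => nCz'.
  have [t t01] := segment_boundary clC Cz nCz'.
  by rewrite frame_point_segment; exact: nb.
have small_seg w (t : R) : 0 <= t <= 1 -> enorm w < rho -> enorm (t *: w) < rho.
  move=> /andP[t0 t1] wr; rewrite enormZ ger0_norm//; apply: le_lt_trans wr.
  by rewrite ler_piMl ?enorm_ge0.
have c0 : `|c| <= c by rewrite gtr0_norm.
have Nc0 : `|- c| <= c by rewrite normrN gtr0_norm.
have between (a1 a2 t : R) : 0 <= t <= 1 -> `|a1| <= c -> `|a2| <= c -> `|a1 + t * (a2 - a1)| <= c.
  move=> /andP[t0 t1] h1 h2.
  have -> : a1 + t * (a2 - a1) = (1 - t) * a1 + t * a2 by ring.
  rewrite (le_trans (ler_normD _ _))// !normrM (ger0_norm t0) ger0_norm ?subr_ge0//.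
  have : t * `|a2| <= t * c by rewrite ler_wpM2l.
  have : (1 - t) * `|a1| <= (1 - t) * c by rewrite ler_wpM2l// subr_ge0.
  lra.
have vert w s s' : enorm w < rho -> `|s| <= c -> `|s'| <= c ->
    ((f w < s) && (f w < s')) || ((s < f w) && (s' < f w)) ->
    C (frame_point x u B w s) -> C (frame_point x u B w s').
  move=> wr sc s'c ss; apply: seg => t t01; rewrite subrr scaler0 addr0.
  move=> /(bE _ _ wr (between _ _ _ t01 sc s'c)).
  have -> : s + t * (s' - s) = (1 - t) * s + t * s' by ring.
  move=> E; case/andP: t01 => t0 t1; case/orP: ss => /andP[h1 h2].
    have h3 : 0 <= t * (s' - f w) by rewrite mulr_ge0// subr_ge0 ltW.
    have h4 : 0 <= (1 - t) * (s - f w) by rewrite mulr_ge0// subr_ge0// ltW.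
    have [t00|tn0] := eqVneq t 0; first by move: E; rewrite t00; lra.
    have : 0 < t * (s' - f w) by rewrite mulr_gt0// ?subr_gt0// lt_neqAle eq_sym tn0.
    lra.
  have h3 : 0 <= t * (f w - s') by rewrite mulr_ge0// subr_ge0 ltW.
  have h4 : 0 <= (1 - t) * (f w - s) by rewrite mulr_ge0// subr_ge0// ltW.
  have [t00|tn0] := eqVneq t 0; first by move: E; rewrite t00; lra.
  have : 0 < t * (f w - s') by rewrite mulr_gt0// ?subr_gt0// lt_neqAle eq_sym tn0.
  lra.
have horz w w' (s : R) : enorm w < rho -> enorm w' < rho -> w = 0 \/ w' = 0 -> `|s| = c ->
    C (frame_point x u B w s) -> C (frame_point x u B w' s).
  move=> wr wr' ww' sc; apply: seg => t t01; rewrite subrr mulr0 addr0.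
  have wt : enorm (w + t *: (w' - w)) < rho.
    case: ww' => ->; first by rewrite add0r subr0; exact: small_seg.
    rewrite sub0r scalerN -{1}[w]scale1r -scalerBl; apply: small_seg => //.
    by rewrite subr_ge0 gerBl andbC; case/andP: t01 => -> ->.
  move=> /(bE _ _ wt); rewrite sc lexx => /(_ isT) E.
  by have [_ + _] := rho_lt _ wt; rewrite -E sc ltxx.
have w0 : enorm (0 : 'rV[R]_d) < rho by rewrite enorm0.
have up w s : enorm w < rho -> `|s| <= c -> f w < s ->
    (C (frame_point x u B w s) <-> C (frame_point x u B 0 c)).
  move=> wr sc fs; have [_ /ltr_normlW fwc _] := rho_lt _ wr.
  have cc : `|c| = c by rewrite gtr0_norm.
  split=> H.
    apply: (horz w 0 c wr w0 _ cc); first by right.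
    by apply: (vert w s c wr sc c0 _ H); rewrite fs fwc.
  apply: (vert w c s wr c0 sc); first by rewrite fs fwc.
  by apply: (horz 0 w c w0 wr _ cc H); left.
have down w s : enorm w < rho -> `|s| <= c -> s < f w ->
    (C (frame_point x u B w s) <-> C (frame_point x u B 0 (- c))).
  move=> wr sc fs; have [_ + _] := rho_lt _ wr; rewrite ltr_norml => /andP[fwc _].
  have cc : `|- c| = c by rewrite normrN gtr0_norm.
  split=> H.
    apply: (horz w 0 (- c) wr w0 _ cc); first by right.
    by apply: (vert w s (- c) wr sc Nc0 _ H); rewrite fs fwc orbT.
  apply: (vert w (- c) s wr Nc0 sc); first by rewrite fs fwc orbT.
  by apply: (horz 0 w (- c) w0 wr _ cc H); left.
have onb w : enorm w < rho -> C (frame_point x u B w (f w)).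
  move=> wr; apply: boundary_sub => //; apply/bE => //.
  by have [_ /ltW] := rho_lt _ wr.
have rho_c (s : R) : `|s| < rho -> `|s| <= c.
  by rewrite !lt_min => /andP[_ /ltW].
exists rho => //.
have [P|P] := pselect (C (frame_point x u B 0 c)); have [M|M] := pselect (C (frame_point x u B 0 (- c))).
- exfalso; case: bx => _; apply; apply/interior_enormP; exists rho => // y yx.
  rewrite (frame_pointP x y uB); set w := _ *m B^T; set s := - dot _ _.
  have wr : enorm w < rho by rewrite (le_lt_trans (frame_enorm_le _ uB)).
  have sr : `|s| <= c by apply: rho_c; rewrite normrN (le_lt_trans (frame_dotu_le _ uB)).
  have [fs|fs|<-] := ltgtP (f w) s; last exact: onb.
    exact/up.
  exact/down.
- left=> w s wr /rho_c sc; have [fs|fs|<-] := ltgtP (f w) s.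
  + by split=> // _; apply/up.
  + by split=> // /(down _ _ wr sc fs).
  + by split=> // _; exact: onb.
- right=> w s wr /rho_c sc; have [fs|fs|<-] := ltgtP (f w) s.
  + by split=> // /(up _ _ wr sc fs).
  + by split=> // _; apply/down.
  + by split=> // _; exact: onb.
- exfalso.
  have only w s : enorm w < rho -> `|s| < rho -> C (frame_point x u B w s) -> s = f w.
    move=> wr /rho_c sc Cz; have [fs|fs|//] := ltgtP (f w) s.
      by move: Cz => /(up _ _ wr sc fs).
    by move: Cz => /(down _ _ wr sc fs).
  have [u1 _ _] := uB.
  pose L := enorm (b - x) + e0 + 1.
  have L0 : 0 < L by rewrite ltr_pwDr// addr_ge0 ?enorm_ge0// ltW.
  pose t := Num.min 1 (rho / (2 * L)).
  have t0 : 0 < t by rewrite lt_min ltr01 divr_gt0// mulr_gt0.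
  have t1 : t <= 1 by rewrite ge_min lexx.
  have tL : t * L <= rho / 2.
    have : t <= rho / (2 * L) by rewrite ge_min lexx orbT.
    by rewrite invfM mulrA ler_pdivlMr.
  have key (a : R) : `|a| < e0 -> a * t = - f (t *: ((b - x) *m B^T)) - t * dot (b - x) u.
    move=> ae; have Cba : C (b + a *: u).
      by apply: Hb; rewrite addrAC subrr add0r enormZ u1 mulr1.
    have := @convex_setP R _ C (b + a *: u) x t cC Cba Cx; rewrite (ltW t0) t1 => /(_ isT).
    set z := _ + _; have zx : z - x = t *: (b - x) + (t * a) *: u.
      by rewrite /z scalerBl scale1r !scalerDr scalerN scalerA; apply/rowP => i; rewrite !mxE; ring.
    have zxr : enorm (z - x) < rho.
      rewrite zx (le_lt_trans (ler_enormD _ _))// !enormZ u1 mulr1 normrM (gtr0_norm t0) -mulrDr.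
      apply: (@le_lt_trans _ _ (t * L)); last by lra.
      by rewrite ler_wpM2l ?(ltW t0)// /L; lra.
    rewrite (frame_pointP x z uB) => /only.
    rewrite (le_lt_trans (frame_enorm_le _ uB) zxr) normrN.
    rewrite (le_lt_trans (frame_dotu_le _ uB) zxr) => /(_ isT isT).
    rewrite zx [(_ + _ *: u) *m _]mulmxDl -!scalemxAl [dot (_ + _ *: u) u]dotDl !dotZl.
    rewrite -(enorm_sqr u) u1 expr1n mulr1.
    have -> : u *m B^T = 0 by case: uB => _ _ Bu; rewrite -[LHS]trmxK trmx_mul trmxK Bu trmx0.
    rewrite scaler0 addr0; lra.
  have := key 0; rewrite normr0 mul0r => /(_ e00) k1.
  have := key (e0 / 2); rewrite ger0_norm ?divr_ge0 ?(ltW e00)//.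
  rewrite -k1 => k2; have /k2/eqP : e0 / 2 < e0 by lra.
  by rewrite mulf_eq0 (gt_eqF t0) orbF gt_eqF// divr_gt0.
Qed.

End LocalRegion.

Section ModelRoots.
Context {R : realType}.
Implicit Types (de b Q eta : R).

(* [de u ^ 2 + b u - Q / 2] has discriminant [(2 de) ^ 2], hence the roots
   [p = (2 de - b) / (2 de)] and [p - 2]. *)
Lemma model_root_upper de b Q eta : 0 < de -> 0 < eta <= 1 ->
  b ^+ 2 + 2 * de * Q = (2 * de) ^+ 2 -> 0 <= Q ->
  let u := (2 * de - b) / (2 * de) + eta in
  [/\ 0 < u, u^-1 <= eta^-1 &
   2^-1 * (u^-1 ^+ 2 * Q) + de * eta / 4 <= de + u^-1 * b].
Proof.
move=> de0 /andP[eta0 eta1] disc Q0 u.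
set p := (2 * de - b) / (2 * de).
have bE : b = 2 * de * (1 - p) by rewrite /p; field; rewrite gt_eqF.
have QE : Q = 2 * de * p * (2 - p).
  have d2 : 2 * de != 0 by rewrite mulf_neq0 ?gt_eqF.
  apply: (mulfI d2); have -> : 2 * de * Q = (2 * de) ^+ 2 - b ^+ 2 by rewrite -disc; ring.
  by rewrite bE; ring.
have p02 : 0 <= p <= 2.
  have : 0 <= p * (2 - p).
    by rewrite -(pmulr_rge0 _ (_ : 0 < 2 * de)) ?mulr_gt0// mulrA -QE.
  have := sqr_ge0 (p - 1); move=> h1 h2; apply/andP; split; rewrite leNgt; apply/negP => h3; nra.
have /andP[p0 p2] := p02.
have u0 : 0 < u by rewrite /u -/p ltr_wpDl.
split=> //; first by rewrite lef_pV2 ?posrE// /u -/p lerDr.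
rewrite -(ler_pM2l (exprn_gt0 2 u0)).
have -> : u ^+ 2 * (2^-1 * (u^-1 ^+ 2 * Q) + de * eta / 4) =
    2^-1 * Q + u ^+ 2 * (de * eta / 4) by field; rewrite gt_eqF.
have -> : u ^+ 2 * (de + u^-1 * b) = de * u ^+ 2 + b * u by field; rewrite gt_eqF.
rewrite QE bE -subr_ge0.
have -> : de * u ^+ 2 + 2 * de * (1 - p) * u - (2^-1 * (2 * de * p * (2 - p)) + u ^+ 2 * (de * eta / 4))
  = de * ((u - p) * (u + (2 - p)) - u ^+ 2 * eta / 4) by field.
rewrite mulr_ge0 ?(ltW de0)// subr_ge0.
have -> : u - p = eta by rewrite /u -/p addrAC subrr add0r.
have u3 : u <= 3 by rewrite /u -/p; lra.
have : u ^+ 2 <= 3 * u by rewrite expr2 ler_pM2r.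
have : 0 <= eta * (2 - p) by rewrite mulr_ge0 ?subr_ge0// ltW.
have : 0 <= eta * u by rewrite mulr_ge0// ltW.
move: (u) => v; nra.
Qed.

Lemma model_root_lower de b Q eta : 0 < de -> 0 < eta <= 1 ->
  b ^+ 2 + 2 * de * Q = (2 * de) ^+ 2 -> 0 <= Q ->
  2 * eta < (2 * de - b) / (2 * de) ->
  let u := (2 * de - b) / (2 * de) - eta in
  [/\ 0 < u, u^-1 <= eta^-1 &
   de + u^-1 * b <= 2^-1 * (u^-1 ^+ 2 * Q) - de * eta / 4].
Proof.
move=> de0 /andP[eta0 eta1] disc Q0.
set p := (2 * de - b) / (2 * de) => etap u.
have bE : b = 2 * de * (1 - p) by rewrite /p; field; rewrite gt_eqF.
have QE : Q = 2 * de * p * (2 - p).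
  have d2 : 2 * de != 0 by rewrite mulf_neq0 ?gt_eqF.
  apply: (mulfI d2); have -> : 2 * de * Q = (2 * de) ^+ 2 - b ^+ 2 by rewrite -disc; ring.
  by rewrite bE; ring.
have p2 : p <= 2.
  have : 0 <= p * (2 - p).
    by rewrite -(pmulr_rge0 _ (_ : 0 < 2 * de)) ?mulr_gt0// mulrA -QE.
  by rewrite pmulr_rge0 ?subr_ge0//; apply: lt_trans etap; rewrite mulr_gt0.
have u_eta : eta <= u by rewrite /u; lra.
have u0 : 0 < u by exact: lt_le_trans u_eta.
split=> //; first by rewrite lef_pV2 ?posrE.
rewrite -(ler_pM2l (exprn_gt0 2 u0)).
have -> : u ^+ 2 * (2^-1 * (u^-1 ^+ 2 * Q) - de * eta / 4) =
    2^-1 * Q - u ^+ 2 * (de * eta / 4) by field; rewrite gt_eqF.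
have -> : u ^+ 2 * (de + u^-1 * b) = de * u ^+ 2 + b * u by field; rewrite gt_eqF.
rewrite QE bE -subr_ge0.
have -> : 2^-1 * (2 * de * p * (2 - p)) - u ^+ 2 * (de * eta / 4) - (de * u ^+ 2 + 2 * de * (1 - p) * u)
  = de * ((p - u) * (u + (2 - p)) - u ^+ 2 * eta / 4) by field.
rewrite mulr_ge0 ?(ltW de0)// subr_ge0.
have -> : p - u = eta by rewrite /u opprB addrC subrK.
have u3 : u <= 3 by rewrite /u; lra.
have : u ^+ 2 <= 3 * u by rewrite expr2 ler_pM2r.
have : 0 <= eta * (2 - p) by rewrite mulr_ge0 ?subr_ge0// ltW.
have : 0 <= eta * u by rewrite mulr_ge0// ltW.
move: (u) => v; nra.
Qed.

End ModelRoots.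

Lemma dist_lt_of_squeeze (R : realType) (G e z p1 p2 : R) : 0 < G ->
  z <= p1 -> p2 <= z -> `|1 - p1| < e / G -> `|1 - p2| < e / G -> `|G * z - G| < e.
Proof.
move=> G0 h1 h2; rewrite !ltr_norml => /andP[h3 _] /andP[_ h4].
have eG : G * (e / G) = e by rewrite mulrCA divff ?gt_eqF// mulr1.
have l1 : G * (z - 1) < G * (e / G) by rewrite ltr_pM2l//; lra.
have l2 : G * (1 - z) < G * (e / G) by rewrite ltr_pM2l//; lra.
move: l1 l2; rewrite eG mulrBr mulrBr mulr1 => l1 l2; apply/andP; split; lra.
Qed.

Section Asymptotics.
Context {R : realType} {d : nat}.
Variable C : set 'rV[R]_d.+1.
Hypotheses (clC : closed C) (bdC : exists M : R, forall y, C y -> enorm y <= M)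
  (cC : @convex_set R 'rV[R]_d.+1 C) (iC : interior C 0).
Implicit Types (y u v : 'rV[R]_d.+1) (B : 'M[R]_(d, d.+1)) (A : 'M[R]_d).

Lemma interior_shrink y (e : R) : C y -> 0 < e <= 1 -> interior C ((1 - e) *: y).
Proof.
move=> Cy /andP[e0 e1].
have := @segment_interior _ _ C 0 y (1 - e) cC iC Cy.
rewrite scaler0 add0r; apply; rewrite subr_ge0 e1/=; lra.
Qed.

Lemma normal_dot_gt0 y u : outer_unit_normal C y u -> 0 < dot y u.
Proof.
move=> [u1 H]; have /interior_enormP[e e0 He] := iC.
have := H ((e / 2) *: u); rewrite dotBl dotZl -(enorm_sqr u) u1 expr1n mulr1 => le.
have : C ((e / 2) *: u).
  by apply: He; rewrite subr0 enormZ u1 mulr1 gtr0_norm ?divr_gt0//; lra.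
by move=> /le; have : 0 < e / 2 by [rewrite divr_gt0]; lra.
Qed.

Lemma paraboloid_model y u B (r : R) f A (K ka : R) :
  boundary C y -> outer_unit_normal C y u -> orthonormal_frame u B -> 0 < r ->
  local_graph (boundary C) y u B r f -> f 0 = 0 -> second_order_expansion f A ->
  A^T = A -> 0 < K -> 0 < ka ->
  exists2 q0 : R, 0 < q0 & forall q a b, 0 < q < q0 -> enorm a <= K -> `|b| <= K ->
    let z := (1 - q ^+ 2) *: y + (q *: (a *m B) - (q ^+ 2 * b) *: u) in
    (2^-1 * dot (a *m A) a + ka <= dot y u + b -> C z) /\
    (dot y u + b <= 2^-1 * dot (a *m A) a - ka -> ~ C z).
Proof.
move=> by_ nu uB r0 gr f0 expA symA K0 ka0.
have [c c0 [rc rc0 fc]] := second_order_le f0 expA.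
have f_cvg e : 0 < e -> exists2 rho : R, 0 < rho & forall w, enorm w < rho -> `|f w| < e.
  move=> e0; exists (Num.min rc (Num.min 1 (e / c / 2))).
    by rewrite !lt_min rc0 ltr01 !divr_gt0.
  move=> w; rewrite !lt_min => /andP[wr /andP[w1 we]].
  apply: (le_lt_trans (fc _ wr)).
  have : enorm w ^+ 2 <= enorm w by rewrite expr2 ler_piMl ?enorm_ge0 ?(ltW w1).
  have : c * enorm w <= e / 2.
    by rewrite mulrC -ler_pdivlMr// mulrAC; exact: ltW.
  move: (enorm w) => t h1 h2.
  have : c * t ^+ 2 <= c * t by rewrite ler_pM2l.
  lra.
have ne : interior C !=set0 by exists 0.
have [rho rho0 [reg|reg]] := local_region clC cC ne by_ uB r0 gr f0 f_cvg; last first.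
  exfalso; have := reg 0 (- (rho / 2)); rewrite enorm0 f0 normrN.
  have r2 : 0 < rho / 2 by rewrite divr_gt0.
  rewrite (gtr0_norm r2); case=> //; first by lra.
  move=> _ /(_ _)/(nu.2 _); rewrite /frame_point mul0mx addr0 scaleNr opprK addrAC subrr add0r.
  by rewrite dotZl -(enorm_sqr u) nu.1 expr1n mulr1 oppr_le0 (ltW r2) leNgt r2 => /(_ isT).
have de0 := normal_dot_gt0 nu; set de := dot y u in de0 *.
have [NA NA0 HNA] := mulmx_enorm_le A.
pose yT := y *m B^T; pose L := K + enorm y + 1.
have L0 : 0 < L by rewrite ltr_pwDr// addr_ge0 ?enorm_ge0// ltW.
have yTy : enorm yT <= enorm y by exact: (frame_enorm_le _ uB).
have ka1 : 0 < ka / 4 / L ^+ 2 by rewrite !divr_gt0// exprn_gt0.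
have [r2 r20 Hexp] := iffLR (nbhs_enormP _ _) (expA _ ka1).
pose M := NA * (2 * K * enorm y + enorm y ^+ 2) + 1.
have M0 : 0 < M.
  by rewrite ltr_pwDr// mulr_ge0 ?(ltW NA0)// addr_ge0 ?sqr_ge0// mulr_ge0 ?enorm_ge0// mulr_ge0// ltW.
pose q0 := Num.min 1 (Num.min (rho / L) (Num.min (r2 / L) (Num.min (rho / (de + K)) (ka / 4 / M)))).
exists q0.
  by rewrite !lt_min ltr01 !divr_gt0// addr_gt0.
move=> q a b /andP[q0' qlt] aK bK; rewrite !lt_min in qlt.
case/andP: qlt => q1 /andP[qrho /andP[qr2 /andP[qde qM]]].
move=> z.
pose w := q *: (a - q *: yT); pose s := q ^+ 2 * (de + b).
have zE : z = frame_point y u B w s.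
  rewrite /z /frame_point /w /s -[(_ *: (_ - _)) *m B]scalemxAl mulmxBl -[(_ *: yT) *m B]scalemxAl.
  have yE : yT *m B = y - de *: u.
    by apply/eqP; rewrite eq_sym subr_eq; apply/eqP; exact: frame_decomp.
  rewrite yE; apply/rowP => i; rewrite !mxE; ring.
have aq : enorm (a - q *: yT) <= L.
  rewrite (le_trans (ler_enormB _ _))// enormZ gtr0_norm// /L.
  have : q * enorm yT <= enorm y.
    by apply: le_trans yTy; rewrite ler_piMl ?enorm_ge0// ltW.
  lra.
have wL : enorm w <= q * L by rewrite enormZ gtr0_norm// ler_pM2l.
have wrho : enorm w < rho by rewrite (le_lt_trans wL)// -ltr_pdivlMr.
have srho : `|s| < rho.
  rewrite normrM (ger0_norm (sqr_ge0 _)).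
  apply: (@le_lt_trans _ _ (q * (de + K))); last by rewrite -ltr_pdivlMr// addr_gt0.
  apply: ler_pM; rewrite ?sqr_ge0//.
    by rewrite expr2 ler_piMl ?(ltW q0')// ltW.
  by rewrite (le_trans (ler_normD _ _))// (gtr0_norm de0) lerD2l.
rewrite zE.
have zP := reg w s wrho srho.
have fw : `|f w - 2^-1 * dot (w *m A) w| <= q ^+ 2 * (ka / 4).
  have wr2 : enorm (w - 0) < r2 by rewrite subr0 (le_lt_trans wL)// -ltr_pdivlMr.
  apply: (le_trans (Hexp _ wr2)); rewrite mulrAC ler_pdivrMr ?exprn_gt0//.
  have -> : q ^+ 2 * (ka / 4) * L ^+ 2 = ka / 4 * (q * L) ^+ 2 by ring.
  rewrite ler_wpM2l ?divr_ge0 ?(ltW ka0)//.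
  by rewrite ler_sqr ?nnegrE ?enorm_ge0// mulr_ge0// ltW.
have Aw : dot (w *m A) w = q ^+ 2 * (dot (a *m A) a
    - q * (2 * dot (a *m A) yT - q * dot (yT *m A) yT)).
  rewrite /w -scalemxAl dotZl dotZr mulmxBl -scalemxAl !dotBl !dotBr !dotZl !dotZr.
  have -> : dot (yT *m A) a = dot (a *m A) yT by rewrite dot_mulmx symA dotC.
  ring.
have bnd : `|q * (2 * dot (a *m A) yT - q * dot (yT *m A) yT)| <= ka / 4.
  rewrite normrM gtr0_norm//; apply: (@le_trans _ _ (q * M)); last first.
    by rewrite -ler_pdivlMr// ltW.
  rewrite ler_pM2l// (le_trans (ler_normB _ _))// /M.
  have h1 : `|2 * dot (a *m A) yT| <= NA * (2 * K * enorm y).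
    rewrite normrM ger0_norm//.
    apply: (@le_trans _ _ (2 * ((NA * K) * enorm y))); last by rewrite le_eqVlt; apply/orP; left; apply/eqP; ring.
    rewrite ler_pM2l// (le_trans (dot_le_enorm _ _))// ler_pM ?enorm_ge0//.
    by rewrite (le_trans (HNA _))// ler_pM2l.
  have h2 : `|q * dot (yT *m A) yT| <= NA * enorm y ^+ 2.
    rewrite normrM gtr0_norm//; apply: (@le_trans _ _ (1 * (NA * enorm y * enorm y))); last first.
      by rewrite mul1r expr2 mulrA.
    apply: ler_pM => //; [exact: ltW|exact: ltW|].
    rewrite (le_trans (dot_le_enorm _ _))// ler_pM ?enorm_ge0//.
    by rewrite (le_trans (HNA _))// ler_pM2l.
  rewrite mulrDr; lra.
move: fw bnd; rewrite Aw /s !ler_norml; set t := q * _ => /andP[f1 f2] /andP[t1 t2].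
have q2 : 0 < q ^+ 2 by rewrite exprn_gt0.
set P := dot (a *m A) a in f1 f2 *.
split=> H.
  apply/zP; apply: (@le_trans _ _ (q ^+ 2 * (2^-1 * P + ka))); last by rewrite ler_pM2l.
  have : q ^+ 2 * (2^-1 * (P - t) + ka / 4) <= q ^+ 2 * (2^-1 * P + ka).
    by rewrite ler_pM2l//; lra.
  rewrite mulrDr; lra.
move=> /zP; apply/negP; rewrite -ltNge /s.
have : q ^+ 2 * (de + b) <= q ^+ 2 * (2^-1 * P - ka) by rewrite ler_pM2l.
have : q ^+ 2 * (2^-1 * P - ka) < q ^+ 2 * (2^-1 * (P - t) - ka / 4).
  by rewrite ltr_pM2l//; lra.
rewrite mulrBr [q ^+ 2 * (2^-1 * (P - t) - ka / 4)]mulrBr; lra.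
Qed.

(* Parabolic rescaling: near [y] lengths scale like [q] along the boundary and
   like [q ^ 2] across it, and in these units [C] becomes a paraboloid. *)
Lemma hilbert_norm_model y u B (r : R) f A (eta : R) :
  boundary C y -> outer_unit_normal C y u -> orthonormal_frame u B -> 0 < r ->
  local_graph (boundary C) y u B r f -> f 0 = 0 -> second_order_expansion f A ->
  pos_def A -> 0 < eta <= 1 ->
  exists2 q0 : R, 0 < q0 <= 1 & forall q a b, 0 < q < q0 ->
    b ^+ 2 + 2 * dot y u * dot (a *m A) a = (2 * dot y u) ^+ 2 ->
    `|hilbert_norm C ((1 - q ^+ 2) *: y) (q *: (a *m B) - (q ^+ 2 * b) *: u) - 1|
      <= 2 * eta.
Proof.
move=> by_ nu uB r0 gr f0 expA posA eta01; have /andP[eta0 eta1] := eta01.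
have de0 := normal_dot_gt0 nu; set de := dot y u in de0 *.
have [c c0 coer] := pos_def_coercive posA.
pose K := (2 * de / c + 1 + 2 * de) / eta.
have d20 : 0 < 2 * de by rewrite mulr_gt0.
have K'0 : 0 < 2 * de / c + 1 + 2 * de by rewrite addr_gt0// addr_gt0// divr_gt0.
have K0 : 0 < K by rewrite divr_gt0.
have ka0 : 0 < de * eta / 4 by rewrite divr_gt0// mulr_gt0.
have [q0 q00 model] := paraboloid_model by_ nu uB r0 gr f0 expA posA.1 K0 ka0.
exists (Num.min 1 q0); first by rewrite lt_min ltr01 q00 ge_min lexx.
move=> q a b /andP[qp]; rewrite lt_min => /andP[q1 qq0] disc.
have q01 : 0 < q < q0 by rewrite qp qq0.
have ix : interior C ((1 - q ^+ 2) *: y).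
  apply: interior_shrink => //; first exact: boundary_sub.
  by rewrite exprn_gt0//= expr_le1// ltW.
set x := (1 - q ^+ 2) *: y in ix *.
have rate a' b' : b' ^+ 2 + 2 * de * dot (a' *m A) a' = (2 * de) ^+ 2 ->
    let v := q *: (a' *m B) - (q ^+ 2 * b') *: u in
    v != 0 /\ `|exit_rate C x v - (2 * de - b') / (2 * de)| <= 2 * eta.
  move=> disc' v; have Q0 : 0 <= dot (a' *m A) a' by exact: pos_def_ge0.
  have v0 : v != 0.
    apply/eqP => v0.
    have vE : (q *: a') *m B + (- (q ^+ 2 * b')) *: u = 0.
      by rewrite -v0 /v scaleNr scalemxAl.
    have := congr1 (fun v => v *m B^T) vE; rewrite /= (frame_coord _ _ uB) mul0mx => /eqP.
    rewrite scaler_eq0 (gt_eqF qp)/= => /eqP a0.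
    have := congr1 (fun v => dot v u) vE; rewrite /= (frame_dotu _ _ uB) dot0l => /eqP.
    rewrite oppr_eq0 mulf_eq0 sqrf_eq0 (gt_eqF qp)/= => /eqP b0.
    move: disc'; rewrite a0 b0 mul0mx dot0l mulr0 addr0 expr0n/= => /esym/eqP.
    by rewrite sqrf_eq0 gt_eqF.
  have bK : `|b'| <= 2 * de.
    rewrite -ler_sqr ?nnegrE ?(ltW d20)// real_normK ?num_real// -disc' lerDl.
    by rewrite mulr_ge0// ltW.
  have aK : enorm a' <= 2 * de / c + 1.
    have : enorm a' ^+ 2 <= 2 * de / c.
      rewrite enorm_sqr ler_pdivlMr// mulrC (le_trans (coer _))//.
      rewrite -(ler_pM2l d20) -expr2 -disc' lerDr sqr_ge0//.
    have := sqr_ge0 (enorm a' - 1); rewrite sqrrB1.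
    have := enorm_ge0 a'; move: (enorm a') (2 * de / c) => s t; lra.
  have scaled (u' : R) : 0 < u' -> u'^-1 <= eta^-1 ->
      [/\ enorm (u'^-1 *: a') <= K, `|u'^-1 * b'| <= K,
      dot (u'^-1 *: a' *m A) (u'^-1 *: a') = u'^-1 ^+ 2 * dot (a' *m A) a' &
      q *: (u'^-1 *: a' *m B) - (q ^+ 2 * (u'^-1 * b')) *: u = u'^-1 *: v].
    move=> u'0 u'eta; have i0 : 0 < u'^-1 by rewrite invr_gt0.
    have ie0 : 0 < eta^-1 by rewrite invr_gt0.
    split.
    - rewrite enormZ gtr0_norm// /K mulrC ler_pM ?enorm_ge0 ?(ltW i0)//.
      by rewrite (le_trans aK)// lerDl ltW.
    - rewrite normrM gtr0_norm// /K mulrC ler_pM ?(ltW i0)//.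
      by rewrite (le_trans bK)// lerDr addr_ge0// divr_ge0// ltW.
    - by rewrite -scalemxAl dotZl dotZr mulrA -expr2.
    - rewrite /v scalerBr -scalemxAl; congr (_ - _); rewrite !scalerA; first by rewrite mulrC.
      by congr (_ *: _); ring.
  split=> //.
  have upper : exit_rate C x v <= (2 * de - b') / (2 * de) + eta.
    have [] := model_root_upper de0 eta01 disc' Q0.
    set u' := _ + eta => u'0 u'eta key; have [h1 h2 h3 h4] := scaled _ u'0 u'eta.
    have [+ _] := model q _ _ q01 h1 h2; rewrite h3 h4 => /(_ key) Cz.
    have i0 : 0 < u'^-1 by rewrite invr_gt0.
    by have := iffRL (exit_rate_le clC bdC cC ix v0 i0) Cz; rewrite invrK.
  have lower : (2 * de - b') / (2 * de) - 2 * eta <= exit_rate C x v.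
    have [etap|petal] := ltP (2 * eta) ((2 * de - b') / (2 * de)).
      have [] := model_root_lower de0 eta01 disc' Q0 etap.
      set u' := _ - eta => u'0 u'eta key; have [h1 h2 h3 h4] := scaled _ u'0 u'eta.
      have [_ +] := model q _ _ q01 h1 h2; rewrite h3 h4 => /(_ key) nCz.
      have i0 : 0 < u'^-1 by rewrite invr_gt0.
      have u'lt : u' < exit_rate C x v.
        rewrite ltNge; apply/negP => le; apply: nCz.
        by apply/(exit_rate_le clC bdC cC ix v0 i0); rewrite invrK.
      apply: le_trans (ltW u'lt); rewrite /u'; lra.
    have := exit_rate_gt0 clC bdC cC ix v0.
    by move: petal; move: (exit_rate C x v) (_ / _) => s t; lra.
  by move: upper lower; move: (exit_rate C x v) (_ / _) => s t h1 h2; rewrite ler_norml; apply/andP; split; lra.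
have [v0 h1] := rate a b disc.
have disc2 : (- b) ^+ 2 + 2 * de * dot (- a *m A) (- a) = (2 * de) ^+ 2.
  by rewrite sqrrN mulNmx dotNl dotNr opprK.
have [_ h2] := rate (- a) (- b) disc2.
rewrite hilbert_normE//.
have -> : - (q *: (a *m B) - (q ^+ 2 * b) *: u) =
    q *: (- a *m B) - (q ^+ 2 * - b) *: u.
  by rewrite mulNmx scalerN mulrN scaleNr opprK opprB addrC.
have e1 : (2 * de - b) / (2 * de) = 1 - b / (2 * de) by field; rewrite gt_eqF.
have e2 : (2 * de - - b) / (2 * de) = 1 + b / (2 * de) by field; rewrite gt_eqF.
move: h1 h2; rewrite e1 e2.
move: (exit_rate C x _) (exit_rate C x _) (b / (2 * de)) => s t w.
rewrite !ler_norml => /andP[h1 h2] /andP[h3 h4]; apply/andP; split; lra.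
Qed.

Lemma hilbert_norm_sandwich y u B (r : R) f A (eta : R) :
  boundary C y -> outer_unit_normal C y u -> orthonormal_frame u B -> 0 < r ->
  local_graph (boundary C) y u B r f -> f 0 = 0 -> second_order_expansion f A ->
  pos_def A -> 0 < eta < 1 / 2 ->
  exists2 q0 : R, 0 < q0 <= 1 & forall q v, 0 < q < q0 ->
    let F := ((2 * dot y u * q ^+ 2) ^+ 2)^-1 * dot v (u + 0 *m B) ^+ 2 +
      dot (v *m B^T *m ((2 * dot y u * q ^+ 2)^-1 *: A)) (v *m B^T) in
    let N := hilbert_norm C ((1 - q ^+ 2) *: y) v in
    (F <= 1 -> N <= 1 + 2 * eta) /\ (N <= 1 - 2 * eta -> F <= 1).
Proof.
move=> by_ nu uB r0 gr f0 expA posA /andP[eta0 eta2].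
have eta01 : 0 < eta <= 1 by rewrite eta0/=; lra.
have de0 := normal_dot_gt0 nu; set de := dot y u in de0 *.
have [q0 /andP[q00 q01] model] := hilbert_norm_model by_ nu uB r0 gr f0 expA posA eta01.
exists q0; first by rewrite q00.
move=> q v /andP[qp qq0] F N.
have q2 : 0 < q ^+ 2 by rewrite exprn_gt0.
have ix : interior C ((1 - q ^+ 2) *: y).
  apply: interior_shrink => //; first exact: boundary_sub.
  by rewrite exprn_gt0//= expr_le1 ?(ltW qp)// (le_trans (ltW qq0)).
have d20 : 0 < 2 * de by rewrite mulr_gt0.
pose a := q^-1 *: (v *m B^T); pose b := - (q ^+ 2)^-1 * dot v u.
have vE : v = q *: (a *m B) - (q ^+ 2 * b) *: u.
  rewrite /a /b -scalemxAl scalerA divff ?gt_eqF// scale1r mulNr mulrN mulrA divff ?gt_eqF//.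
  by rewrite mul1r scaleNr opprK; exact: frame_decomp.
have FE : F = (b ^+ 2 + 2 * de * dot (a *m A) a) / (2 * de) ^+ 2.
  rewrite /F mul0mx addr0 /a /b -scalemxAr dotZl -scalemxAl dotZl dotZr -/de.
  by field; rewrite !gt_eqF.
have [v0|v0] := eqVneq v 0.
  split=> _; rewrite /N /F v0.
    rewrite /hilbert_norm eqxx; lra.
  by rewrite dot0l mul0mx dot0r expr0n/= mulr0 addr0 ler01.
have Q0 : 0 <= dot (a *m A) a by exact: pos_def_ge0.
have F0 : 0 < F.
  rewrite FE divr_gt0 ?exprn_gt0//.
  have [a0|a0] := eqVneq a 0; last first.
    by rewrite ltr_wpDl ?sqr_ge0// mulr_gt0// posA.2.
  rewrite a0 dot0r mulr0 addr0 exprn_even_gt0//=; apply: contra v0 => /eqP b0.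
  by rewrite vE a0 b0 mul0mx scaler0 mulr0 scale0r subrr.
pose m := Num.sqrt F; have m0 : 0 < m by rewrite sqrtr_gt0.
have mm : m ^+ 2 = F by rewrite sqr_sqrtr// ltW.
have q0q : 0 < q < q0 by rewrite qp.
have disc : (m^-1 * b) ^+ 2 + 2 * de * dot (m^-1 *: a *m A) (m^-1 *: a) = (2 * de) ^+ 2.
  rewrite -scalemxAl dotZl dotZr.
  have -> : (m^-1 * b) ^+ 2 + 2 * de * (m^-1 * (m^-1 * dot (a *m A) a)) =
    (b ^+ 2 + 2 * de * dot (a *m A) a) / m ^+ 2 by field; rewrite gt_eqF.
  rewrite mm; have -> : b ^+ 2 + 2 * de * dot (a *m A) a = F * (2 * de) ^+ 2.
    by rewrite FE divfK// gt_eqF// exprn_gt0.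
  by rewrite mulrAC divff ?gt_eqF// mul1r.
have := model q (m^-1 *: a) (m^-1 * b) q0q disc.
have -> : q *: (m^-1 *: a *m B) - (q ^+ 2 * (m^-1 * b)) *: u =
    m^-1 *: (q *: (a *m B) - (q ^+ 2 * b) *: u).
  rewrite scalerBr -scalemxAl !scalerA; congr (_ *: _ - _ *: _); first by rewrite mulrC.
  by ring.
have mi0 : 0 < m^-1 by rewrite invr_gt0.
rewrite -vE (hilbert_normZ clC bdC cC v mi0 ix) -/N; clearbody N.
rewrite ler_norml => /andP[N1 N2].
have mN : m * (m^-1 * N) = N by rewrite mulrA divff ?gt_eqF// mul1r.
split=> H.
  have m1 : m <= 1 by rewrite -(@expr_le1 _ 2) ?(ltW m0)// mm.
  rewrite -mN; apply: (@le_trans _ _ (m * (1 + 2 * eta))).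
    by rewrite ler_pM2l//; lra.
  by rewrite ler_piMl//; lra.
rewrite -mm expr_le1 ?(ltW m0)// leNgt; apply/negP => m1.
have : m * (1 - 2 * eta) <= N by rewrite -mN ler_pM2l//; lra.
have : 1 - 2 * eta < m * (1 - 2 * eta) by rewrite ltr_pMl//; lra.
lra.
Qed.

Lemma busemann_density_asymptotic y (h : R) :
  boundary C y -> curvature_spec C y h -> h != 0 ->
  0 < h /\ exists u, [/\ outer_unit_normal C y u,
    forall u', outer_unit_normal C y u' -> u' = u &
    forall e : R, 0 < e -> exists2 q0 : R, 0 < q0 & forall q, 0 < q < q0 ->
      `|busemann_density C ((1 - q ^+ 2) *: y) * q ^+ d.+2
        - Num.sqrt h / Num.sqrt (2 * dot y u) ^+ d.+2| < e].
Proof.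
move=> by_ [u [B [r [f [A [[nu uniq_u] [[uB r0 gr] [[f_ge0 f0 _] [symA expA hE]]]]]]]]] hn0.
have posA : pos_def A.
  apply: pos_def_psd => //; last by rewrite -hE.
  move=> w; rewrite leNgt; apply/negP => Aw.
  pose k := - dot (w *m A) w / 4.
  have k0 : 0 < k by rewrite divr_gt0// oppr_gt0.
  pose e := k / (1 + dot w w).
  have w10 : 0 < 1 + dot w w by rewrite ltr_pwDl ?dot_ge0.
  have e0 : 0 < e by rewrite divr_gt0.
  have [s s0 Hs] := iffLR (nbhs_enormP _ _) (expA _ e0).
  pose t := Num.min s r / 2 / (1 + enorm w).
  have w1 : 0 < 1 + enorm w by rewrite ltr_pwDl ?enorm_ge0.
  have t0 : 0 < t by rewrite !divr_gt0// lt_min s0.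
  have tw : enorm (t *: w) < Num.min s r.
    rewrite enormZ gtr0_norm// /t mulrAC ltr_pdivrMr//.
    have : 0 < Num.min s r by rewrite lt_min s0.
    have := enorm_ge0 w; move: (enorm w) (Num.min s r) => z m z0 m0; nra.
  move: tw; rewrite lt_min => /andP[ts tr].
  have := Hs (t *: w); rewrite subr0 => /(_ ts).
  rewrite -scalemxAl dotZl dotZr enormZ exprMn [`|t|]gtr0_norm// enorm_sqr.
  have : 0 <= f (t *: w) by apply: f_ge0.
  have ek : e * (t ^+ 2 * dot w w) <= t ^+ 2 * k.
    rewrite mulrCA ler_pM2l ?exprn_gt0// /e mulrAC ler_pdivrMr// ler_pM2l//; lra.
  move=> f1 f2; have := le_trans f2 ek; rewrite ler_norml => /andP[_].
  have : 0 < t ^+ 2 * k by rewrite mulr_gt0// exprn_gt0.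
  have -> : t * (t * dot (w *m A) w) = - 4 * (t ^+ 2 * k) by rewrite /k; field.
  move: (t ^+ 2 * k) f1 => z; lra.
have h0 : 0 < h by rewrite hE pos_def_det.
split=> //; exists u; split => // e e0.
have de0 := normal_dot_gt0 nu; set de := dot y u in de0 *.
have d20 : 0 < 2 * de by rewrite mulr_gt0.
set G := _ / _ ^+ _; have G0 : 0 < G by rewrite divr_gt0 ?exprn_gt0 ?sqrtr_gt0.
have cvgp := @continuous_horner R ((1 + 'X) ^+ d.+1) 0.
have eG : 0 < e / G by rewrite divr_gt0.
have [/= s s0 Hs] := iffLR (cvgrPdist_lt _ _) cvgp _ eG.
have pow_near t : `|t| < s -> `|1 - (1 + t) ^+ d.+1| < e / G.
  by move=> ts; have := Hs t; rewrite !(hornerE, addr0, expr1n) /= sub0r normrN; exact.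
pose eta := Num.min (1 / 4) (s / 4).
have eta0 : 0 < eta by rewrite lt_min !divr_gt0.
have eta2 : eta < 1 / 2 by rewrite gt_min; apply/orP; left; lra.
have etas : 2 * eta < s.
  by have : eta <= s / 4 by [rewrite ge_min lexx orbT]; lra.
have eta02 : 0 < eta < 1 / 2 by rewrite eta0.
have [q0 /andP[q00 q01] sand] := hilbert_norm_sandwich by_ nu uB r0 gr f0 expA posA eta02.
exists q0 => // q /andP[qp qq0].
have q2 : 0 < q ^+ 2 by rewrite exprn_gt0.
have ix : interior C ((1 - q ^+ 2) *: y).
  apply: interior_shrink => //; first exact: boundary_sub.
  by rewrite exprn_gt0//= expr_le1 ?(ltW qp)// (le_trans (ltW qq0)).
set p := ((2 * de * q ^+ 2) ^+ 2)^-1.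
have dq0 : 0 < 2 * de * q ^+ 2 by rewrite mulr_gt0.
have p0 : 0 < p by rewrite invr_gt0 exprn_gt0.
have posA' : pos_def ((2 * de * q ^+ 2)^-1 *: A).
  split; first by rewrite linearZ/= symA.
  by move=> w w0; rewrite -scalemxAr dotZl mulr_gt0 ?invr_gt0// posA.2.
have volE := frame_ellipsoid_volume 0 uB p0 posA'.
have sqrtE : Num.sqrt (p * \det ((2 * de * q ^+ 2)^-1 *: A)) = G / q ^+ d.+2.
  rewrite -[RHS]ger0_norm ?divr_ge0 ?(ltW G0) ?exprn_ge0 ?(ltW qp)// -sqrtr_sqr.
  pose k := Num.sqrt (2 * de); have k0 : 0 < k by rewrite sqrtr_gt0.
  have kq0 : 0 < k * q by rewrite mulr_gt0.
  have kqE : 2 * de * q ^+ 2 = (k * q) ^+ 2 by rewrite exprMn sqr_sqrtr// ltW.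
  have -> : G / q ^+ d.+2 = Num.sqrt h / ((k * q) ^+ 2 * (k * q) ^+ d).
    by rewrite -exprD add2n exprMn [in RHS]invfM [RHS]mulrA.
  congr (Num.sqrt _); rewrite detZ -hE /p kqE.
  have -> : ((k * q) ^+ 2)^-1 ^+ d = ((k * q) ^+ d)^-1 ^+ 2.
    by rewrite !exprVn -!exprM mulnC.
  rewrite -[in LHS](sqr_sqrtr (ltW h0)); have w0 : 0 < (k * q) ^+ d by rewrite exprn_gt0.
  move: ((k * q) ^+ d) w0 => w w0; move: (k * q) kq0 (Num.sqrt h) => t t0 g.
  by field; rewrite !gt_eqF.
set V := hilbert_volume C ((1 - q ^+ 2) *: y).
have V0 : 0 < V by exact: hilbert_volume_gt0.
set vn := unit_ball_volume d.+1 in volE.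
have vn0 : 0 < vn by have [] := @closed_eball_volume R d.+1.
rewrite sqrtE in volE.
have c1 : 0 < 1 + 2 * eta by rewrite addr_gt0// mulr_gt0.
have c2 : 0 < 1 - 2 * eta by lra.
have up : vn / (G / q ^+ d.+2) <= (1 + 2 * eta) ^+ d.+1 * V.
  rewrite -lee_fin -volE; apply: hilbert_volume_ge => // v Fv.
  by have [+ _] := sand q v (introT andP (conj qp qq0)); apply.
have lo : (1 - 2 * eta) ^+ d.+1 * V <= vn / (G / q ^+ d.+2).
  rewrite -lee_fin -volE; apply: hilbert_volume_le => // v Nv.
  by have [_ +] := sand q v (introT andP (conj qp qq0)); apply.
change (`|vn / V * q ^+ d.+2 - G| < e).
have qd : 0 < q ^+ d.+2 by rewrite exprn_gt0.
have E : vn / V * q ^+ d.+2 = G * (vn / (G / q ^+ d.+2) / V).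
  by field; rewrite !gt_eqF.
have n1 : `|2 * eta| < s by rewrite gtr0_norm// mulr_gt0.
have n2 : `|- (2 * eta)| < s by rewrite normrN.
move: (pow_near _ n1) (pow_near _ n2); rewrite E.
move: (vn / (G / q ^+ d.+2)) up lo => X.
rewrite -(ler_pdivrMr _ _ V0) -(ler_pdivlMr _ _ V0); exact: dist_lt_of_squeeze.
Qed.

End Asymptotics.

(** * Uniform bounds for a C^{1,1} boundary *)

Section SecondOrderBounds.
Context {R : realType} {m : nat}.
Implicit Types (f : 'rV[R]_m -> R^o) (w v : 'rV[R]_m).

Lemma diff_gradient f w v : differentiable f w -> 'd f w v = dot (gradient f w) v.
Proof.
move=> df; rewrite {1}[v]row_sum_delta linear_sum dotE; apply: eq_bigr => i _.
by rewrite linearZ/= mxE mulrC.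
Qed.

Lemma is_derive_line f w v (t : R) : differentiable f (w + t *: v) ->
  is_derive t 1 (fun t : R => f (w + t *: v)) (dot (gradient f (w + t *: v)) v).
Proof.
move=> df; rewrite -diff_gradient// -deriveE//.
have E : (fun h : R => h^-1 *: (((fun t : R => f (w + t *: v)) \o shift t) (h *: 1) - f (w + t *: v)))
  = (fun h : R => h^-1 *: ((f \o shift (w + t *: v)) (h *: v) - f (w + t *: v))).
  apply/funext => h /=; congr (_ *: (f _ - _)).
  by rewrite [h *: 1]mulr1 scalerDl addrCA addrC -addrA addrC.
split; last by rewrite /derive /= E.
by have := @diff_derivable R _ _ f (w + t *: v) v df; rewrite /derivable -E.
Qed.

Lemma mean_value f w v : (forall t : R, 0 <= t <= 1 -> differentiable f (w + t *: v)) ->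
  exists2 t : R, 0 <= t <= 1 & f (w + v) - f w = dot (gradient f (w + t *: v)) v.
Proof.
move=> df; pose phi (t : R) : R := f (w + t *: v).
pose dphi (t : R) : R := dot (gradient f (w + t *: v)) v.
have dline (t : R) : 0 <= t <= 1 -> is_derive t 1 phi (dphi t).
  by move=> /df; exact: is_derive_line.
have dline' : forall t : R, t \in `]0, 1[%R -> is_derive t 1 phi (dphi t).
  by move=> t /subset_itv_oo_cc; rewrite in_itv/=; exact: dline.
have cphi : {within `[0, 1], continuous phi}.
  by apply: derivable_within_continuous => t; rewrite in_itv/= => /dline[].
have [t] := MVT_segment ler01 dline' cphi.
rewrite in_itv/= /phi scale1r scale0r addr0 subr0 mulr1 => t01 E; by exists t.
Qed.

Lemma C11_second_order f (r : R) : 0 < r -> C11_on (eball r) f ->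
  exists L K : R, [/\ 0 <= L, 0 <= K,
    forall w, enorm w < r -> enorm (gradient f w) <= L &
    forall w w', enorm w < r -> enorm w' < r ->
      `|f w' - f w - dot (gradient f w) (w' - w)| <= K * enorm (w' - w) ^+ 2].
Proof.
move=> r0 [df [k lip]].
have klip w w' : enorm w < r -> enorm w' < r ->
    enorm (gradient f w' - gradient f w) <= m%:R * `|k| * enorm (w' - w).
  move=> wr w'r; apply: (le_trans (enorm_le_norm _)); rewrite -mulrA ler_wpM2l//.
  have := lip (w', w) (conj w'r wr) => /=; move=> /le_trans; apply.
  apply: (@le_trans _ _ (`|k| * `|w' - w|)); first by rewrite ler_wpM2r// ler_norm.
  by rewrite ler_wpM2l// norm_le_enorm.
exists (enorm (gradient f 0) + m%:R * `|k| * r), (m%:R * `|k|).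
have mk : 0 <= m%:R * `|k| by rewrite mulr_ge0.
split=> //; first by rewrite addr_ge0 ?enorm_ge0// mulr_ge0// ltW.
  move=> w wr; rewrite -[gradient f w](subrK (gradient f 0)) (le_trans (ler_enormD _ _))//.
  rewrite addrC lerD2l (le_trans (klip _ _ _ _)) ?enorm0//.
  by rewrite subr0 ler_wpM2l// ltW.
move=> w w' wr w'r.
have seg (t : R) : 0 <= t <= 1 -> enorm (w + t *: (w' - w)) < r.
  move=> /andP[t0 t1]; have -> : w + t *: (w' - w) = (1 - t) *: w + t *: w'.
    by apply/rowP => i; rewrite !mxE; ring.
  apply: (le_lt_trans (ler_enormD _ _)); rewrite !enormZ !ger0_norm ?subr_ge0//.
  have [t00|tn0] := eqVneq t 0; first by rewrite t00 subr0 mul1r mul0r addr0.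
  have tp : 0 < t by rewrite lt_neqAle eq_sym tn0.
  have h1 : (1 - t) * enorm w <= (1 - t) * r by rewrite ler_wpM2l ?subr_ge0// ltW.
  have h2 : t * enorm w' < t * r by rewrite ltr_pM2l.
  by move: h1 h2; rewrite mulrBl mul1r; lra.
have [|t t01] := @mean_value f w (w' - w).
  by move=> t /seg; exact: df.
rewrite [w + (w' - w)]addrC subrK => ->; rewrite -dotBl (le_trans (dot_le_enorm _ _))//.
rewrite expr2 mulrA ler_wpM2r ?enorm_ge0// (le_trans (klip _ _ wr (seg _ t01)))//.
rewrite ler_wpM2l// addrAC subrr add0r enormZ ger0_norm; last by case/andP: t01.
by rewrite ler_piMl ?enorm_ge0//; case/andP: t01.
Qed.

End SecondOrderBounds.

Section LocalEpigraph.
Context {R : realType} {d : nat}.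
Implicit Types (C : set 'rV[R]_d.+1) (u x y z v : 'rV[R]_d.+1) (B : 'M[R]_(d, d.+1)).
Implicit Types (f : 'rV[R]_d -> R^o) (g : 'rV[R]_d -> 'rV[R]_d) (w : 'rV[R]_d).

Definition local_epigraph C x u B f g (rho L K : R) :=
  [/\ orthonormal_frame u B, f 0 = 0,
    forall w, enorm w < rho -> enorm (g w) <= L,
    forall w w', enorm w < rho -> enorm w' < rho ->
      `|f w' - f w - dot (g w) (w' - w)| <= K * enorm (w' - w) ^+ 2 &
    forall w s, enorm w < rho -> `|s| < rho -> (C (frame_point x u B w s) <-> f w <= s)].

Lemma graph_lipschitz f g (rho L K : R) :
  0 <= K ->
  (forall w, enorm w < rho -> enorm (g w) <= L) ->
  (forall w w', enorm w < rho -> enorm w' < rho ->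
      `|f w' - f w - dot (g w) (w' - w)| <= K * enorm (w' - w) ^+ 2) ->
  forall w w', enorm w < rho -> enorm w' < rho ->
    `|f w' - f w| <= (L + K * (2 * rho)) * enorm (w' - w).
Proof.
move=> K0 gL fK w w' wr w'r.
have -> : f w' - f w = (f w' - f w - dot (g w) (w' - w)) + dot (g w) (w' - w) by rewrite subrK.
rewrite (le_trans (ler_normD _ _))// [leRHS]mulrDl addrC; apply: lerD.
  by rewrite (le_trans (dot_le_enorm _ _))// ler_wpM2r ?enorm_ge0// gL.
rewrite (le_trans (fK _ _ wr w'r))// expr2 mulrA ler_wpM2r ?enorm_ge0// ler_wpM2l//.
rewrite (le_trans (ler_enormB _ _))//; move: wr w'r; move: (enorm w) (enorm w') => p q.
lra.
Qed.

Lemma C11_local_epigraph C x : closed C -> @convex_set R 'rV[R]_d.+1 C ->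
  interior C !=set0 -> C11_boundary C -> boundary C x ->
  exists u B f g (rho L K : R),
    [/\ 0 < rho, 0 <= L, 0 <= K & local_epigraph C x u B f g rho L K].
Proof.
move=> clC cC iC C11 bx; have [u [B [r [f [uB r0 fC11 gr]]]]] := C11 _ bx.
have [L [K [L0 K0 gL fK]]] := C11_second_order r0 fC11.
have f0 : f 0 = 0.
  have /nbhs_singleton[/(_ bx)[w _ E] _] := gr.
  have {}E : frame_point x u B 0 0 = frame_point x u B w (f w).
    by rewrite /frame_point -E mul0mx scale0r subr0 addr0.
  by have [<- <-] := frame_point_inj uB E.
have lip := graph_lipschitz K0 gL fK.
have fc e : 0 < e -> exists2 rho : R, 0 < rho & forall w, enorm w < rho -> `|f w| < e.
  move=> e0; pose M := L + K * (2 * r) + 1.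
  have M0 : 0 < M by rewrite ltr_pwDr// addr_ge0// !mulr_ge0// ltW.
  exists (Num.min r (e / M)); first by rewrite lt_min r0 divr_gt0.
  move=> w; rewrite lt_min => /andP[wr]; rewrite ltr_pdivlMr// => we.
  have z0 : enorm (0 : 'rV[R]_d) < r by rewrite enorm0.
  have := lip _ _ z0 wr; rewrite f0 !subr0 => /le_lt_trans; apply.
  apply: le_lt_trans we; rewrite mulrC ler_wpM2l ?enorm_ge0// /M; lra.
have [rho rho0 reg] := local_region clC cC iC bx uB r0 gr f0 fc.
pose r' := Num.min r rho; have r'0 : 0 < r' by rewrite lt_min r0.
have lt_r (a : R) : a < r' -> a < r by rewrite lt_min => /andP[].
have lt_rho (a : R) : a < r' -> a < rho by rewrite lt_min => /andP[].
case: reg => reg.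
  exists u, B, f, (gradient f), r', L, K; split => //; split=> //.
  - by move=> w /lt_r; exact: gL.
  - by move=> w w' /lt_r wr /lt_r w'r; exact: fK.
  - by move=> w s /lt_rho wr /lt_rho sr; exact: reg.
exists (- u), B, (fun w => - f w), (fun w => - gradient f w), r', L, K.
split => //; split=> //=.
- by case: uB => u1 BB Bu; split; rewrite ?enormN// linearN/= mulmxN Bu oppr0.
- by rewrite f0 oppr0.
- by move=> w /lt_r wr; rewrite enormN gL.
- move=> w w' /lt_r wr /lt_r w'r; rewrite dotNl opprK -[leLHS]normrN.
  by rewrite !opprD !opprK addrAC -addrA [- dot _ _ + _]addrC addrA [_ - f w]addrC; have := fK _ _ wr w'r; congr (`|_| <= _); ring.
- move=> w s /lt_rho wr /lt_rho sr.
  have -> : frame_point x (- u) B w s = frame_point x u B w (- s).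
    by rewrite /frame_point scalerN scaleNr.
  by rewrite reg ?normrN// lerNl.
Qed.

Section Fixed.
Variables (C : set 'rV[R]_d.+1) (x u : 'rV[R]_d.+1) (B : 'M[R]_(d, d.+1)).
Variables (f : 'rV[R]_d -> R^o) (g : 'rV[R]_d -> 'rV[R]_d) (rho L K : R).
Hypotheses (clC : closed C) (bdC : exists M : R, forall y, C y -> enorm y <= M)
  (cC : @convex_set R 'rV[R]_d.+1 C) (iC : interior C 0).
Hypotheses (rho0 : 0 < rho) (L0 : 0 <= L) (K0 : 0 <= K)
  (loc : local_epigraph C x u B f g rho L K).

Let uB : orthonormal_frame u B. Proof. by case: loc. Qed.
Let gL w : enorm w < rho -> enorm (g w) <= L. Proof. by case: loc => _ _ + _ _; apply. Qed.
Let fK w w' : enorm w < rho -> enorm w' < rho ->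
  `|f w' - f w - dot (g w) (w' - w)| <= K * enorm (w' - w) ^+ 2.
Proof. by case: loc => _ _ _ + _; apply. Qed.
Let reg w s : enorm w < rho -> `|s| < rho -> (C (frame_point x u B w s) <-> f w <= s).
Proof. by case: loc => _ _ _ _; apply. Qed.

Lemma local_epigraph_coord y : enorm (y - x) < rho ->
  enorm ((y - x) *m B^T) < rho /\ `|- dot (y - x) u| < rho.
Proof.
move=> yr; rewrite normrN; split; apply: le_lt_trans yr.
  exact: (frame_enorm_le _ uB).
exact: (frame_dotu_le _ uB).
Qed.

Lemma local_epigraph_boundary y : boundary C y -> enorm (y - x) < rho ->
  f ((y - x) *m B^T) = - dot (y - x) u.
Proof.
move=> by_ yr; have [wr sr] := local_epigraph_coord yr.
have := boundary_sub clC by_; rewrite {1}(frame_pointP x y uB) => /(reg wr sr).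
rewrite le_eqVlt => /predU1P[//|lt]; exfalso; case: by_ => _; apply.
set w := (y - x) *m B^T in wr lt *; set s := - dot _ _ in sr lt *.
pose M := L + K * (2 * rho) + 2.
have M0 : 0 < M by rewrite ltr_pwDr// addr_ge0// !mulr_ge0// ltW.
apply/interior_enormP; exists (Num.min (rho - enorm (y - x)) ((s - f w) / M)).
  by rewrite lt_min subr_gt0 yr divr_gt0// subr_gt0.
move=> z; rewrite lt_min => /andP[zy1]; rewrite ltr_pdivlMr// => zy2.
have zr : enorm (z - x) < rho.
  have -> : z - x = (z - y) + (y - x) by rewrite addrA subrK.
  by have := ler_enormD (z - y) (y - x); lra.
have [wr' sr'] := local_epigraph_coord zr.
rewrite (frame_pointP x z uB); apply/reg => //.
have zE : (z - x) *m B^T - w = (z - y) *m B^T.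
  by rewrite /w -mulmxBl opprB addrA subrK.
have sE : dot (z - x) u = dot (z - y) u - s by rewrite /s opprK -dotDl addrA subrK.
have h1 : `|f ((z - x) *m B^T) - f w| <= (L + K * (2 * rho)) * enorm (z - y).
  apply: (le_trans (graph_lipschitz K0 gL fK wr wr')); rewrite zE ler_wpM2l//.
    by rewrite addr_ge0// !mulr_ge0// ltW.
  exact: (frame_enorm_le _ uB).
have h2 : dot (z - y) u <= enorm (z - y).
  by rewrite (le_trans (ler_norm _))// (frame_dotu_le _ uB).
have h3 := ler_norm (f ((z - x) *m B^T) - f w).
have h4 := enorm_ge0 (z - y).
rewrite sE; move: zy2; rewrite /M.
have -> : enorm (z - y) * (L + K * (2 * rho) + 2) = (L + K * (2 * rho)) * enorm (z - y) + 2 * enorm (z - y) by ring.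
move: h1 h2 h3 h4; rewrite -/s; move: (dot (z - y) u) (enorm (z - y)) (_ * enorm _) (`|_|).
move: (f _) (f w) (s) => p q s' t1 t2 t3 t4; lra.
Qed.

Lemma local_epigraph_support y z : boundary C y -> enorm (y - x) < rho -> C z ->
  dot (z - y) (u + g ((y - x) *m B^T) *m B) <= 0.
Proof.
move=> by_ yr Cz; have [wr sr] := local_epigraph_coord yr.
have fE := local_epigraph_boundary by_ yr.
set w := (y - x) *m B^T in wr fE *; set N := u + _.
pose w1 := (z - y) *m B^T.
rewrite leNgt; apply/negP => N0; set e := dot _ _ in N0.
pose P := enorm (z - y) + K * enorm w1 ^+ 2 + 1.
have P0 : 0 < P by rewrite ltr_pwDr// addr_ge0 ?enorm_ge0// mulr_ge0// sqr_ge0.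
pose t := Num.min 1 (Num.min ((rho - enorm (y - x)) / P) (e / P)).
have t0 : 0 < t by rewrite !lt_min ltr01 !divr_gt0// subr_gt0.
have t1 : t <= 1 by rewrite ge_min lexx.
have tP1 : t * P <= rho - enorm (y - x).
  by rewrite -ler_pdivlMr// !ge_min lexx !orbT.
have tP2 : t * P <= e by rewrite -ler_pdivlMr// !ge_min lexx !orbT.
have Czt : C (y + t *: (z - y)).
  have -> : y + t *: (z - y) = t *: z + (1 - t) *: y by apply/rowP => i; rewrite !mxE; ring.
  by apply: convex_setP => //; [exact: boundary_sub|rewrite (ltW t0)].
have E : y + t *: (z - y) - x = (y - x) + t *: (z - y) by rewrite addrAC.
have zr : enorm (y + t *: (z - y) - x) < rho.
  rewrite E (le_lt_trans (ler_enormD _ _))// enormZ gtr0_norm//.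
  have : t * enorm (z - y) < t * P.
    by rewrite ltr_pM2l// /P -addrA ltrDl ltr_wpDl// mulr_ge0 ?sqr_ge0.
  by move: tP1; lra.
have [wr' sr'] := local_epigraph_coord zr.
move: Czt; rewrite (frame_pointP x (y + _) uB) => /(reg wr' sr').
have wE : (y + t *: (z - y) - x) *m B^T = w + t *: w1.
  by rewrite E mulmxDl -scalemxAl.
rewrite wE in wr' *; rewrite E dotDl dotZl => le.
have := fK wr wr'; rewrite [w + _]addrC addrK dotZr enormZ (gtr0_norm t0) fE ler_norml => /andP[lo _].
have eE : e = dot (z - y) u + dot (g w) w1.
  by rewrite /e /N dotDr [dot (z - y) (_ *m B)]dotC dot_mulmx.
have tE : t * e = t * dot (z - y) u + t * dot (g w) w1 by rewrite eE mulrDr.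
have : K * (t * enorm w1) ^+ 2 < t * e.
  have -> : K * (t * enorm w1) ^+ 2 = t * (t * (K * enorm w1 ^+ 2)) by ring.
  rewrite ltr_pM2l//; apply: lt_le_trans tP2; rewrite ltr_pM2l// /P.
  by have := enorm_ge0 (z - y); lra.
rewrite [w + _]addrC in le; move: lo le; rewrite tE.
move: (dot (y - x) u) (t * dot (z - y) u) (t * dot (g w) w1) (K * _) (f _) => a1 a2 a3 a4 a5.
lra.
Qed.

End Fixed.
End LocalEpigraph.

Section LocalBounds.
Context {R : realType} {d : nat}.
Variables (C : set 'rV[R]_d.+1) (x u : 'rV[R]_d.+1) (B : 'M[R]_(d, d.+1)).
Variables (f : 'rV[R]_d -> R^o) (g : 'rV[R]_d -> 'rV[R]_d) (rho L K : R).
Hypotheses (clC : closed C) (bdC : exists M : R, forall y, C y -> enorm y <= M)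
  (cC : @convex_set R 'rV[R]_d.+1 C) (iC : interior C 0).
Hypotheses (rho0 : 0 < rho) (L0 : 0 <= L) (K0 : 0 <= K)
  (loc : local_epigraph C x u B f g rho L K).

Lemma local_hausdorff_fin :
  (hausdorff d (boundary C `&` [set y | enorm (y - x)%R < rho]%R) < +oo)%E.
Proof.
have [uB f0 gL fK reg] := loc.
pose h w : 'rV[R]_d.+1 := frame_point x u B w (f w).
pose M := 1 + (L + K * (2 * rho)).
have M0 : 0 < M by rewrite ltr_pwDl// addr_ge0// !mulr_ge0// ltW.
apply: (@le_lt_trans _ _ (hausdorff d (h @` [set w | enorm w < rho]))).
  apply: le_outer_measure => y [by_ yr]; exists ((y - x) *m B^T).
    by have [] := local_epigraph_coord loc yr.
  by rewrite /h (local_epigraph_boundary clC rho0 L0 K0 loc by_ yr) -(frame_pointP _ _ uB).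
apply: (@le_lt_trans _ _ ((M ^+ d)%:E * hausdorff d [set w : 'rV[R]_d | enorm w < rho]%R)%E).
  apply: hausdorff_lipschitz => // w w' wr w'r.
  rewrite (le_trans (frame_point_dist _ _ _ _ _ uB))// /M mulrDl mul1r lerD2l.
  exact: (graph_lipschitz K0 gL fK).
rewrite lte_mul_pinfty ?lee_fin ?exprn_ge0 ?(ltW M0)//.
apply: le_lt_trans (hausdorff_box_fin d rho0); apply: le_outer_measure => w /= wr i.
by rewrite !mxE -ler_norml (le_trans (coord_le_enorm _ _))// ltW.
Qed.

(* The hyperplane orthogonal to [u + g w *m B] supports [C] at [y], and [C] leaves
   it at most quadratically. So a half-ellipsoid with axes of order [q] along this
   hyperplane and [q ^ 2] across it fits in [C - (1 - q ^ 2) y], as does its opposite. *)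
Lemma local_volume_ge : exists2 k : R, 0 < k & exists2 q1 : R, 0 < q1 <= 1 &
  forall y q, boundary C y -> enorm (y - x) < rho / 2 -> 0 < q < q1 ->
    unit_ball_volume d.+1 * k * q ^+ d.+2 <= hilbert_volume C ((1 - q ^+ 2) *: y).
Proof.
have [uB f0 gL fK reg] := loc; have [u1 _ _] := uB.
have [M CM] := bdC; have /interior_enormP[e e0 He] := iC.
have C0 : C 0 by apply: He; rewrite subrr enorm0.
have M0 : 0 <= M by apply: le_trans (CM _ C0); exact: enorm_ge0.
have e20 : 0 < e / 2 by rewrite divr_gt0.
have K1 : 0 < 1 + 4 * K by rewrite ltr_pwDl// mulr_ge0.
pose ka := Num.min 1 (e / 2 / (1 + 4 * K)).
have ka0 : 0 < ka by rewrite lt_min ltr01 divr_gt0.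
have ka1 : ka <= 1 by rewrite ge_min lexx.
have kaK : ka * (1 + 4 * K) <= e / 2 by rewrite -ler_pdivlMr// ge_min lexx orbT.
have M10 : 0 < M + 1 by rewrite ltr_pwDr.
have P0 : 0 < M + 2 + L by rewrite ltr_pwDl// ltr_wpDl.
pose q1 := Num.min 1 (Num.min (ka / (M + 1)) (rho / 2 / (M + 2 + L))).
exists (ka ^+ d.+1); first by rewrite exprn_gt0.
exists q1; first by rewrite !lt_min ltr01 !divr_gt0//= ge_min lexx.
move=> y q by_ yr /andP[qp]; rewrite !lt_min => /and3P[q1' qM qrho].
have Cy := boundary_sub clC by_.
have yr' : enorm (y - x) < rho by apply: lt_trans yr _; rewrite ltr_pdivrMr// mulr2n mulrDr mulr1 ltrDl.
have [wr sr] := local_epigraph_coord loc yr'.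
have fE := local_epigraph_boundary clC rho0 L0 K0 loc by_ yr'.
have supp z := local_epigraph_support clC cC rho0 L0 K0 loc by_ yr' (z := z).
set w := (y - x) *m B^T in wr fE supp; set N := u + g w *m B in supp.
have Nu : dot N u = 1.
  by have := frame_dotu (g w) 1 uB; rewrite scale1r addrC.
have N1 : 1 <= enorm N.
  by have := dot_le_enorm N u; rewrite Nu u1 mulr1 normr1.
have N0 : 0 < enorm N by exact: lt_le_trans N1.
have yN : e / 2 <= dot y N.
  have /supp : C ((e / 2 / enorm N) *: N).
    apply: He; rewrite subr0 enormZ gtr0_norm ?divr_gt0// divfK ?gt_eqF//; lra.
  rewrite dotBl dotZl -enorm_sqr expr2 mulrA divfK ?gt_eqF// subr_le0; apply: le_trans.
  by rewrite ler_peMr// ltW.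
have q2 : 0 < q ^+ 2 by rewrite exprn_gt0.
have qqq : q ^+ 2 <= q by rewrite expr2 ler_piMl ?(ltW qp)// ltW.
have ix : interior C ((1 - q ^+ 2) *: y).
  by apply: interior_shrink; rewrite ?q2//=; apply: le_trans qqq (ltW q1').
have inC v : enorm (v *m B^T) <= ka * q -> `|dot v N| <= ka * q ^+ 2 ->
    C ((1 - q ^+ 2) *: y + v).
  move=> va vN; set z := _ + v.
  have zx : z - x = (y - x) + (v - q ^+ 2 *: y) by apply/rowP => i; rewrite !mxE; ring.
  have vu : `|dot v u| <= q * (1 + L).
    have -> : dot v u = dot v N - dot (v *m B^T) (g w).
      by rewrite /N dotDr [dot v (_ *m B)]dotC dot_mulmx [dot (g w) _]dotC addrK.
    rewrite (le_trans (ler_normB _ _))// mulrDr mulr1; apply: lerD.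
      by rewrite (le_trans vN)// (le_trans _ qqq)// ler_piMl// ltW.
    rewrite (le_trans (dot_le_enorm _ _))//; apply: ler_pM; rewrite ?enorm_ge0 ?gL//.
    by rewrite (le_trans va)// ler_piMl// ltW.
  have ve : enorm v <= q * (2 + L).
    rewrite (frame_decomp v uB) (le_trans (ler_enormD _ _))// (frame_enorm _ uB) enormZ u1 mulr1.
    have : ka * q <= q by rewrite ler_piMl// ltW.
    by move: va vu; rewrite !mulrDr; lra.
  have qy : enorm (q ^+ 2 *: y) <= q * M.
    by rewrite enormZ ger0_norm ?(ltW q2)// ler_pM ?enorm_ge0 ?(ltW q2)// CM.
  have zr : enorm (z - x) < rho.
    rewrite zx (le_lt_trans (ler_enormD _ _))//.
    have := ler_enormB v (q ^+ 2 *: y).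
    by move: qrho; rewrite ltr_pdivlMr// !mulrDr; move: ve; rewrite mulrDr; move: yr qy; lra.
  have [wr' sr'] := local_epigraph_coord loc zr.
  rewrite (frame_pointP x z uB); apply/reg => //.
  have wE : (z - x) *m B^T = w + (v - q ^+ 2 *: y) *m B^T.
    by rewrite zx [LHS]mulmxDl.
  rewrite wE in wr' *; set a := (v - _) *m B^T in wr' *.
  have aq : enorm a <= 2 * ka * q.
    rewrite /a mulmxBl -scalemxAl (le_trans (ler_enormB _ _))//.
    have : enorm (q ^+ 2 *: (y *m B^T)) <= ka * q.
      rewrite enormZ ger0_norm ?(ltW q2)// expr2 -mulrA mulrC ler_pM2r//.
      have yM : enorm (y *m B^T) <= M by rewrite (le_trans (frame_enorm_le _ uB))// CM.
      have : q * enorm (y *m B^T) <= q * M by rewrite ler_pM2l.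
      by move: qM; rewrite ltr_pdivlMr// mulrDr mulr1; lra.
    by move: va; lra.
  have := fK _ _ wr wr'; rewrite [w + a]addrC addrK => /ler_normlP[_].
  rewrite fE.
  have -> : dot (z - x) u = dot (y - x) u + dot (v - q ^+ 2 *: y) u by rewrite zx [LHS]dotDl.
  have -> : dot (g w) a = dot (v - q ^+ 2 *: y) N - dot (v - q ^+ 2 *: y) u.
    by rewrite /N dotDr [dot _ (_ *m B)]dotC dot_mulmx addrAC subrr add0r.
  have Ka : K * enorm a ^+ 2 <= q ^+ 2 * (4 * K * ka).
    have -> : q ^+ 2 * (4 * K * ka) = K * (2 * q) ^+ 2 * ka by ring.
    apply: (@le_trans _ _ (K * (2 * ka * q) ^+ 2)).
      by rewrite ler_wpM2l// ler_sqr ?nnegrE ?enorm_ge0// !mulr_ge0// ltW.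
    have -> : K * (2 * ka * q) ^+ 2 = K * (2 * q) ^+ 2 * ka * ka by ring.
    by rewrite ler_piMr// !mulr_ge0 ?sqr_ge0// ltW.
  have key : dot (v - q ^+ 2 *: y) N + K * enorm a ^+ 2 <= 0.
    rewrite dotBl dotZl.
    have h1 : q ^+ 2 * (e / 2) <= q ^+ 2 * dot y N by rewrite ler_pM2l.
    have h2 : q ^+ 2 * (ka * (1 + 4 * K)) <= q ^+ 2 * (e / 2) by rewrite ler_pM2l.
    have h3 := ler_normlW vN.
    have h4 : q ^+ 2 * (ka * (1 + 4 * K)) = ka * q ^+ 2 + q ^+ 2 * (4 * K * ka) by ring.
    by move: h1 h2 h3 Ka; rewrite h4; move: (_ * enorm a ^+ 2) (dot v N) (q ^+ 2 * dot y N) (q ^+ 2 * _) (ka * _) (q ^+ 2 * _); intros; lra.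
  move: key; move: (f _) (dot (v - _) N) (dot (v - _) u) (dot (y - x) u) (K * _).
  by intros; lra.
pose p := ((ka * q ^+ 2) ^+ 2)^-1.
pose c := ((ka * q) ^+ 2)^-1.
have kq : 0 < ka * q by rewrite mulr_gt0.
have kq2 : 0 < ka * q ^+ 2 by rewrite mulr_gt0.
have p0 : 0 < p by rewrite invr_gt0 exprn_gt0.
have c0 : 0 < c by rewrite invr_gt0 exprn_gt0.
have pdA : pos_def (c%:M : 'M[R]_d).
  split; first by rewrite tr_scalar_mx.
  by move=> a a0; rewrite mul_mx_scalar dotZl mulr_gt0// dot_gt0.
have V0 := hilbert_volume_gt0 clC bdC cC ix.
have : (lebesgue_outer [set v | p * dot v (u + g w *m B) ^+ 2 +
    dot (v *m B^T *m c%:M) (v *m B^T) <= 1]%R <= (1 ^+ d.+1 * hilbert_volume C ((1 - q ^+ 2) *: y))%:E)%E.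
  apply: hilbert_volume_ge => // v /=; rewrite -/N mul_mx_scalar dotZl => Fv.
  have va : enorm (v *m B^T) <= ka * q.
    rewrite enorm_le_sqr ?(ltW kq)// -[leRHS]mulr1 -ler_pdivrMl ?exprn_gt0// -/c.
    by move: Fv; have := mulr_ge0 (ltW p0) (sqr_ge0 (dot v N)); lra.
  have vN : `|dot v N| <= ka * q ^+ 2.
    rewrite -ler_sqr ?nnegrE ?(ltW kq2)// real_normK ?num_real//.
    rewrite -[leRHS]mulr1 -ler_pdivrMl ?exprn_gt0// -/p.
    by move: Fv; have := mulr_ge0 (ltW c0) (dot_ge0 (v *m B^T)); lra.
  have [->|v0] := eqVneq v 0; first by rewrite /hilbert_norm eqxx.
  have nv0 : - v != 0 by rewrite oppr_eq0.
  have r1 : exit_rate C ((1 - q ^+ 2) *: y) v <= 1^-1.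
    by apply/(exit_rate_le clC bdC cC ix v0 ltr01); rewrite scale1r; exact: inC.
  have r2 : exit_rate C ((1 - q ^+ 2) *: y) (- v) <= 1^-1.
    apply/(exit_rate_le clC bdC cC ix nv0 ltr01); rewrite scale1r; apply: inC.
      by rewrite mulNmx enormN.
    by rewrite dotNl normrN.
  rewrite (hilbert_normE C _ v0); move: r1 r2; rewrite invr1.
  by move: (exit_rate C _ v) (exit_rate C _ (- v)) => a b; lra.
rewrite (frame_ellipsoid_volume (g w) uB p0 pdA) lee_fin expr1n mul1r; apply: le_trans.
rewrite det_scalar le_eqVlt; apply/orP; left; apply/eqP.
have -> : p * c ^+ d = ((ka ^+ d.+1 * q ^+ d.+2)^-1) ^+ 2.
  rewrite /p /c !exprVn -invfM; congr (_^-1).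
  have -> : ((ka * q) ^+ 2) ^+ d = ((ka * q) ^+ d) ^+ 2 by rewrite -!exprM mulnC.
  by rewrite -exprMn; congr (_ ^+ 2); rewrite exprMn !exprS; ring.
have : 0 < ka ^+ d.+1 * q ^+ d.+2 by rewrite mulr_gt0 ?exprn_gt0.
rewrite -mulrA; move: (ka ^+ d.+1 * q ^+ d.+2) => s s0.
by rewrite sqrtr_sqr gtr0_norm ?invr_gt0// invrK.
Qed.

End LocalBounds.

Lemma compact_local_to_global (T : topologicalType) (A : set T) (P : set T -> Prop) :
  compact A -> P set0 -> (forall S S', S `<=` S' -> P S' -> P S) ->
  (forall S S', P S -> P S' -> P (S `|` S')) ->
  (forall x, A x -> exists2 U, nbhs x U & P (A `&` U)) -> P A.
Proof.
move=> cA P0 PS PU loc; have [//|nPA] := pselect (P A); exfalso.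
pose F : set_system T := [set S | P (A `\` S)].
have FF : ProperFilter F.
  split; last split.
  - by rewrite /F/= setD0.
  - by rewrite /F/= setDT.
  - by move=> S S'; rewrite /F/= setDIr; exact: PU.
  - by move=> S S' SS'; apply: PS => z [Az nS]; split=> // /SS'.
have FA : F A by rewrite /F/= setDv.
have [z [Az cz]] := cA F FF FA; have [U zU PAU] := loc z Az.
have FU : F (~` U) by apply: PS PAU => t [At /contrapT Ut].
by have [t [nUt Ut]] := cz _ _ FU zU.
Qed.

Section GlobalBounds.
Context {R : realType} {d : nat}.
Variables (C : set 'rV[R]_d.+1).
Hypotheses (coC : compact C) (cC : @convex_set R 'rV[R]_d.+1 C) (iC : interior C 0)
  (C11 : C11_boundary C).

Lemma compact_enorm_bounded : exists M : R, forall y, C y -> enorm y <= M.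
Proof.
have [M [_ HM]] := compact_bounded coC.
exists (d.+1%:R * (M + 1)) => y Cy; rewrite (le_trans (enorm_le_norm _))// ler_wpM2l//.
by apply: HM => //; rewrite ltrDl.
Qed.

Lemma boundary_uniform_bounds : (hausdorff d (boundary C) < +oo)%E /\
  exists M q1 : R, 0 < q1 <= 1 /\ forall y q, boundary C y -> 0 < q < q1 ->
    busemann_density C ((1 - q ^+ 2) *: y) * q ^+ d.+2 <= M.
Proof.
have clC : closed C by apply: compact_closed => //; exact: norm_hausdorff.
have bdC := compact_enorm_bounded.
pose P (S : set 'rV[R]_d.+1) := (hausdorff d S < +oo)%E /\
  exists M q1 : R, 0 < q1 <= 1 /\ forall y q, S y -> 0 < q < q1 ->
    busemann_density C ((1 - q ^+ 2) *: y) * q ^+ d.+2 <= M.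
apply: (@compact_local_to_global _ (boundary C) P).
- apply: (@subclosed_compact _ (boundary C) C) => //; first exact: closed_boundary.
  exact: boundary_sub.
- split; first by rewrite outer_measure0 ltry.
  by exists 0, 1; split; [rewrite ltr01 lexx|].
- move=> S S' SS' [h [M [q1 [q10 b]]]]; split; first exact: le_lt_trans (le_outer_measure _ _ _ SS') h.
  by exists M, q1; split=> // y q /SS'; exact: b.
- move=> S S' [h [M [q1 [/andP[q10 q11] b]]]] [h' [M' [q1' [/andP[q10' q11'] b']]]]; split.
    by apply: le_lt_trans (outer_measureU2 _ _ _) _; rewrite lte_add_pinfty.
  exists (Num.max M M'), (Num.min q1 q1'); split.
    by rewrite lt_min q10 q10' ge_min q11.
  move=> y q Sy /andP[qp]; rewrite lt_min => /andP[qq1 qq1'].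
  rewrite le_max; apply/orP; case: Sy => Sy; [left; apply: b|right; apply: b'] => //.
    by rewrite qp.
  by rewrite qp.
move=> x bx; have ne : interior C !=set0 by exists 0.
have [u [B [f [g [rho [L [K [rho0 L0 K0 loc]]]]]]]] := C11_local_epigraph clC cC ne C11 bx.
have [k k0 [q1 /andP[q10 q11] vol]] := local_volume_ge clC bdC cC iC rho0 L0 K0 loc.
have r20 : 0 < rho / 2 by rewrite divr_gt0.
exists [set y | enorm (y - x) < rho / 2]; first exact: near_enorm.
split.
  apply: le_lt_trans (local_hausdorff_fin clC rho0 L0 K0 loc).
  by apply: le_outer_measure => y [by_ yr]; split=> //=; apply: (lt_trans yr); lra.
exists k^-1, q1; split; first by rewrite q10.
move=> y q [by_ yr] qq; have {}vol := vol _ _ by_ yr qq.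
have /andP[qp qq1] := qq; have [v0 _] := @closed_eball_volume R d.+1.
have qd : 0 < q ^+ d.+2 by rewrite exprn_gt0.
have lb0 : 0 < unit_ball_volume d.+1 * k * q ^+ d.+2.
  by apply: mulr_gt0 => //; exact: mulr_gt0.
have V0 := lt_le_trans lb0 vol.
rewrite /busemann_density -/(hilbert_volume C _); move: (hilbert_volume C _) vol V0 => V vol V0.
rewrite mulrAC ler_pdivrMr// ler_pdivlMl//; apply: le_trans vol.
by rewrite mulrA [k * _]mulrC.
Qed.

End GlobalBounds.

(** * The limit of the floating areas *)

Section LowerIntegralZl.
Context d (T : measurableType d) (R : realType).
Variables (mu : {measure set T -> \bar R}) (D : set T).
Hypothesis mD : measurable D.
Import HBNNSimple.
Local Open Scope ereal_scope.

Lemma lower_integralZl_le (c : R) (f : T -> \bar R) : (0 < c)%R ->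
  (forall x, D x -> 0 <= f x) ->
  \int[mu]_(x in D) (c%:E * f x) <= c%:E * \int[mu]_(x in D) f x.
Proof.
move=> c0 f0; apply: lower_integral_le => [//|x Dx|h hf _].
  by rewrite mule_ge0 ?f0// lee_fin ltW.
have -> : \int[mu]_(x in D) (h x)%:E = c%:E * \int[mu]_(x in D) ((c^-1 * h x)%R)%:E.
  rewrite -ge0_integralZl_EFin//; last exact: ltW.
  - by apply: eq_integral => x _; rewrite -EFinM mulrA divff ?gt_eqF// mul1r.
  - by move=> x _; rewrite lee_fin mulr_ge0 ?invr_ge0 ?(ltW c0)//.
  - by apply/measurable_EFinP; apply: measurable_funM => //; exact: measurable_funTS.
rewrite lee_pmul2l//; apply: le_lower_integral => // x Dx.
  by rewrite lee_fin mulr_ge0 ?invr_ge0 ?(ltW c0)//.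
have := hf x Dx; case: (f x) (f0 x Dx) => [r| |] //; last by move=> _ _; rewrite leey.
by rewrite -EFinM !lee_fin => _; rewrite ler_pdivrMl.
Qed.

Lemma lower_integralZl (c : R) (f : T -> \bar R) : (0 < c)%R ->
  (forall x, D x -> 0 <= f x) ->
  \int[mu]_(x in D) (c%:E * f x) = c%:E * \int[mu]_(x in D) f x.
Proof.
move=> c0 f0; apply/le_anti; rewrite lower_integralZl_le//=.
have ci : (0 < c^-1)%R by rewrite invr_gt0.
have cn : c != 0%R by rewrite gt_eqF.
rewrite -[leRHS]mul1e -(divff cn) EFinM -muleA lee_pmul2l//.
apply: le_trans (lower_integralZl_le ci _); last first.
  by move=> x Dx; rewrite mule_ge0 ?f0// lee_fin ltW.
apply: le_lower_integral => // x Dx.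
by rewrite muleA -EFinM mulVf ?gt_eqF// mul1e.
Qed.

End LowerIntegralZl.

Section RealPowers.
Context {R : realType}.

Lemma powR_cvg (x r : R) : 0 < x -> t `^ r @[t --> x] --> x `^ r.
Proof.
move=> x0; have xI : x \in `]0, +oo[ by rewrite in_itv/= x0.
by have /derivable1_diffP/differentiable_continuous := @derivable_powR R 1 r x xI.
Qed.

Lemma floating_exponents d (h de : R) : 0 < h -> 0 < de ->
  h `^ (d.+2%:R^-1) * (Num.sqrt h / Num.sqrt (2 * de) ^+ d.+2) `^ (d%:R / d.+2%:R) =
  (2 `^ (d%:R / 2))^-1 * (h `^ (2^-1) / de `^ (d%:R / 2)).
Proof.
move=> h0 de0; have d20 : 0 < 2 * de by rewrite mulr_gt0.
have dn : d.+2%:R != 0 :> R by rewrite pnatr_eq0.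
rewrite -(powR12_sqrt (ltW h0)) -(powR12_sqrt (ltW d20)) -powR_mulrn ?powR_ge0// -powRrM.
rewrite -[in LHS]powRN (powRM _ (powR_ge0 _ _) (powR_ge0 _ _)) -!powRrM mulrA -powRD; last by rewrite (gt_eqF h0) implybT.
have -> : d.+2%:R^-1 + 2^-1 * (d%:R / d.+2%:R) = 2^-1 :> R.
  by move: dn; rewrite -[d.+2]addn2 natrD => dn; field.
have -> : - (2^-1 * d.+2%:R) * (d%:R / d.+2%:R) = - (d%:R / 2) :> R by field.
by rewrite powRN powRM ?(ltW de0)// invfM mulrCA.
Qed.

End RealPowers.

Lemma lt_of_dist (R : realType) (a b t : R) : `|a - b| < t - a -> b < t.
Proof. by rewrite ltr_norml => /andP[+ _]; lra. Qed.

Section FloatingLimit.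
Context {R : realType} {d : nat}.
Variable C : set 'rV[R]_d.+1.
Hypotheses (coC : compact C) (cC : @convex_set R 'rV[R]_d.+1 C) (iC : interior C 0)
  (C11 : C11_boundary C).
Implicit Types (x y : 'rV[R]_d.+1) (l : R).

Let clC : closed C. Proof. by apply: compact_closed => //; exact: norm_hausdorff. Qed.
Let bdC := compact_enorm_bounded coC.
Let mD : (@hausdorff R d d.+1).-cara.-measurable (boundary C).
Proof. exact/hausdorff_closed_measurable/closed_boundary. Qed.
Local Notation al := (d.+2%:R^-1 : R).
Local Notation be := (d%:R / d.+2%:R : R).

Lemma gauss_kroneckerP x : gauss_kronecker C x != 0 ->
  curvature_spec C x (gauss_kronecker C x).
Proof. by rewrite /gauss_kronecker; case: xgetP => [h -> //|]; rewrite eqxx. Qed.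

Lemma gauss_kronecker_ge0 x : boundary C x -> 0 <= gauss_kronecker C x.
Proof.
move=> bx; have [->//|h0] := eqVneq (gauss_kronecker C x) 0.
by have [/ltW] := busemann_density_asymptotic clC bdC cC iC bx (gauss_kroneckerP h0) h0.
Qed.

Lemma interior_scale x l : C x -> 0 < l < 1 -> interior C (l *: x).
Proof.
move=> Cx /andP[l0 l1]; rewrite -[l](subKr 1).
by apply: interior_shrink => //; rewrite subr_gt0 l1 gerBl ltW.
Qed.

Definition floating_factor l x : R := l ^+ d / (l ^+ d) `^ al *
  (busemann_density C (l *: x) * Num.sqrt (1 - l) ^+ d.+2) `^ be.

Lemma busemann_density_gt0 y : interior C y -> 0 < busemann_density C y.
Proof.
by move=> iy; rewrite divr_gt0//; [have [] := @closed_eball_volume R d.+1|exact: hilbert_volume_gt0].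
Qed.

Lemma floating_area_scale l : 0 < l < 1 ->
  (busemann_floating_area C ((fun x => l *: x) @` C) * ((1 - l) `^ (d%:R / 2))%:E =
  \int[surface_measure]_(x in boundary C) (gauss_kronecker C x `^ al * floating_factor l x)%:E)%E.
Proof.
move=> /andP[l0 l1]; have q0 : 0 < 1 - l by rewrite subr_gt0.
have ld : 0 < l ^+ d by rewrite exprn_gt0.
have qE : (1 - l) `^ (d%:R / 2) = (Num.sqrt (1 - l) ^+ d.+2) `^ be.
  rewrite -(powR12_sqrt (ltW q0)) -powR_mulrn ?powR_ge0// -!powRrM; congr (_ `^ _).
  have : d.+2%:R != 0 :> R by rewrite pnatr_eq0.
  by rewrite -[d.+2]addn2 natrD => dn; field.
have E x : boundary C x ->
    l ^+ d * (1 - l) `^ (d%:R / 2) *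
      (gauss_kronecker ((fun x => l *: x) @` C) (l *: x) `^ al *
       busemann_density C (l *: x) `^ be) =
    gauss_kronecker C x `^ al * floating_factor l x.
  move=> bx; rewrite gauss_kronecker_scale// qE /floating_factor.
  have G0 := gauss_kronecker_ge0 bx.
  have S0 : 0 <= busemann_density C (l *: x).
    apply/ltW/busemann_density_gt0/interior_scale; last by rewrite l0.
    exact: (boundary_sub clC bx).
  have ld' : 0 <= (l ^+ d)^-1 by rewrite invr_ge0 ltW.
  have q0' : 0 <= Num.sqrt (1 - l) ^+ d.+2 by rewrite exprn_ge0 ?sqrtr_ge0.
  rewrite (powRM _ ld' G0) (powRM _ S0 q0').
  have -> : (l ^+ d)^-1 `^ al = ((l ^+ d) `^ al)^-1.
    by rewrite -(powR_inv1 (ltW ld)) -powRrM mulN1r powRN.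
  ring.
rewrite /busemann_floating_area (boundary_scale _ l0).
rewrite (lower_integral_scale l0 mD); last first.
  by move=> x _; rewrite lee_fin mulr_ge0 ?powR_ge0.
have c0 : 0 < l ^+ d * (1 - l) `^ (d%:R / 2) by rewrite mulr_gt0// powR_gt0.
rewrite muleAC -EFinM -(lower_integralZl surface_measure mD c0); last first.
  by move=> x _; rewrite lee_fin mulr_ge0 ?powR_ge0.
by apply: eq_integral => x; rewrite inE => /E e; exact: (congr1 EFin e).
Qed.

Let al01 : 0 <= al <= 1.
Proof. by rewrite invr_ge0 ler0n/= invf_le1// ler1n. Qed.
Let be0 : 0 <= be. Proof. by rewrite divr_ge0. Qed.

Lemma measurable_floating_factor l : 0 < l < 1 ->
  @measurable_fun _ _ (caratheodory_type (@hausdorff R d d.+1)) R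
    (boundary C) (floating_factor l).
Proof.
move=> l01; have /andP[l0 l1] := l01.
apply: hausdorff_measurable_fun; first exact: closed_boundary.
move=> t y /closure_enormP cy.
have by_ : boundary C y.
  apply: closed_boundary; apply/closure_enormP => e /cy[z [bz _] zy]; by exists z.
split=> //=; rewrite leNgt; apply/negP => yt.
have iy : interior C (l *: y) by apply: interior_scale => //; exact: boundary_sub.
have V0 := hilbert_volume_gt0 clC bdC cC iy.
have [vn0 _] := @closed_eball_volume R d.+1.
pose psi (v : R) : R := l ^+ d / (l ^+ d) `^ al *
  (unit_ball_volume d.+1 / v * Num.sqrt (1 - l) ^+ d.+2) `^ be.
set V := hilbert_volume C (l *: y) in V0.
have cpsi : psi v @[v --> V] --> psi V.
  apply: cvgM; first exact: cvg_cst.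
  pose phi (v : R) : R := unit_ball_volume d.+1 / v * Num.sqrt (1 - l) ^+ d.+2.
  have cphi : phi v @[v --> V] --> phi V.
    apply: cvgM; last exact: cvg_cst.
    by apply: cvgM; [exact: cvg_cst|apply: cvgV; [rewrite gt_eqF|exact: cvg_id]].
  have phi0 : 0 < phi V.
    by rewrite mulr_gt0 ?divr_gt0// exprn_gt0// sqrtr_gt0 subr_gt0.
  exact: (cvg_comp _ _ cphi (@powR_cvg R _ be phi0)).
have psiE z : floating_factor l z = psi (hilbert_volume C (l *: z)) by [].
rewrite psiE -/V in yt; clearbody psi.
have tp : 0 < t - psi V by rewrite subr_gt0.
have [/= e e0 He] := iffLR (cvgrPdist_lt _ _) cpsi _ tp.
have [r r0 Hr] := iffLR (nbhs_enormP _ _) (hilbert_volume_near clC bdC cC iy e0).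
have [z [bz tz] zy] := cy _ r0; rewrite /= psiE in tz.
have : psi (hilbert_volume C (l *: z)) < t.
  apply: lt_of_dist; apply: He; apply: Hr; rewrite -scalerBr enormZ gtr0_norm//.
  by apply: le_lt_trans zy; rewrite ler_piMl ?enorm_ge0// ltW.
by rewrite ltNge tz.
Qed.

Lemma floating_factor_ge0 l x : 0 < l -> 0 <= floating_factor l x.
Proof. by move=> l0; rewrite mulr_ge0 ?powR_ge0// divr_ge0 ?powR_ge0// exprn_ge0// ltW. Qed.

Lemma floating_factor_le x l (M : R) : boundary C x -> 0 < l < 1 ->
  busemann_density C (l *: x) * Num.sqrt (1 - l) ^+ d.+2 <= M ->
  floating_factor l x <= M `^ be.
Proof.
move=> bx l01 h; have /andP[l0 l1] := l01.
have S0 : 0 < busemann_density C (l *: x).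
  by apply/busemann_density_gt0/interior_scale => //; exact: boundary_sub.
have g0 : 0 <= busemann_density C (l *: x) * Num.sqrt (1 - l) ^+ d.+2.
  by rewrite mulr_ge0 ?(ltW S0)// exprn_ge0 ?sqrtr_ge0.
have ld : 0 < l ^+ d by rewrite exprn_gt0.
rewrite /floating_factor -[leRHS]mul1r ler_pM ?powR_ge0//.
- by rewrite divr_ge0 ?powR_ge0// ltW.
- rewrite ler_pdivrMr ?powR_gt0// mul1r ger1_powR//; last by case/andP: al01.
  by rewrite ld exprn_ile1// ltW.
- by rewrite ge0_ler_powR// nnegrE//; exact: le_trans h.
Qed.

Lemma density_limitP x : boundary C x -> gauss_kronecker C x != 0 ->
  [/\ 0 < gauss_kronecker C x, outer_unit_normal C x (normal C x) &
  forall e : R, 0 < e -> exists2 q0 : R, 0 < q0 & forall q, 0 < q < q0 ->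
      `|busemann_density C ((1 - q ^+ 2) *: x) * q ^+ d.+2
        - Num.sqrt (gauss_kronecker C x) / Num.sqrt (2 * dot x (normal C x)) ^+ d.+2| < e].
Proof.
move=> bx h0; have [hp [u [nu uniq_u lim]]] :=
  busemann_density_asymptotic clC bdC cC iC bx (gauss_kroneckerP h0) h0.
have nE : normal C x = u.
  by apply: uniq_u; apply: (@xgetPex _ 0 [set u | outer_unit_normal C x u]); exists u.
by rewrite nE.
Qed.

Lemma floating_factor_cvg (l : R^nat) x : boundary C x -> gauss_kronecker C x != 0 ->
  (forall k, 0 < l k < 1) -> l k @[k --> \oo] --> (1 : R) ->
  floating_factor (l k) x @[k --> \oo] -->
  (Num.sqrt (gauss_kronecker C x) / Num.sqrt (2 * dot x (normal C x)) ^+ d.+2) `^ be.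
Proof.
move=> bx h0 l01 l1; have [hp nu lim] := density_limitP bx h0.
have de0 := normal_dot_gt0 iC nu.
rewrite -[X in _ --> X]mul1r; apply: cvgM.
  have ld1 : l k ^+ d @[k --> \oo] --> (1 : R).
    by rewrite -(expr1n R d); exact: (cvg_comp _ _ l1 (@exprn_continuous R d 1)).
  rewrite -[X in _ --> X](divff (oner_neq0 R)); apply: cvgM => //.
  apply: cvgV; first exact: oner_neq0.
  have := @powR_cvg R 1 al ltr01; rewrite powR1 => p1.
  exact: (cvg_comp _ _ ld1 p1).
set G := Num.sqrt _ / _; have G0 : 0 < G.
  by rewrite divr_gt0 ?exprn_gt0 ?sqrtr_gt0// mulr_gt0.
apply: (fun H => cvg_comp _ _ H (@powR_cvg R _ be G0)).
apply/cvgrPdist_lt => e e0; have [q0 q00 Hq] := lim e e0.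
have q02 : 0 < q0 ^+ 2 by rewrite exprn_gt0.
have [N _ HN] := iffLR (cvgrPdist_lt _ _) l1 _ q02; exists N => // k /HN /=.
have /andP[lk0 lk1] := l01 k; have lk : 0 < 1 - l k by rewrite subr_gt0.
rewrite gtr0_norm// => lq.
have := Hq (Num.sqrt (1 - l k)); rewrite sqrtr_gt0 lk /= -ltr_sqr ?nnegrE ?sqrtr_ge0 ?(ltW q00)//.
by rewrite sqr_sqrtr ?(ltW lk)// subKr distrC; apply.
Qed.

Lemma curvature_bound (M q1 : R) : 0 < q1 ->
  (forall y q, boundary C y -> 0 < q < q1 ->
    busemann_density C ((1 - q ^+ 2) *: y) * q ^+ d.+2 <= M) ->
  exists N : R, forall x, boundary C x -> gauss_kronecker C x != 0 ->
    Num.sqrt (gauss_kronecker C x) / Num.sqrt (2 * dot x (normal C x)) ^+ d.+2 <= M /\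
    gauss_kronecker C x <= N.
Proof.
move=> q10 HM; have [Mc CM] := bdC.
exists ((M * Num.sqrt (2 * Mc) ^+ d.+2) ^+ 2) => x bx h0.
have [hp nu lim] := density_limitP bx h0.
have de0 := normal_dot_gt0 iC nu.
set G := Num.sqrt _ / _.
have s0 : 0 < Num.sqrt (2 * dot x (normal C x)) ^+ d.+2.
  by rewrite exprn_gt0// sqrtr_gt0 mulr_gt0.
have G0 : 0 < G by rewrite divr_gt0// sqrtr_gt0.
have GM : G <= M.
  rewrite leNgt; apply/negP => MG; have e0 : 0 < G - M by rewrite subr_gt0.
  have [q0 q00 Hq] := lim _ e0.
  have m0 : 0 < Num.min q0 q1 by rewrite lt_min q00.
  have mq (a : R) : 0 < a -> Num.min q0 q1 <= a -> 0 < Num.min q0 q1 / 2 < a.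
    by move=> a0 h; apply/andP; split; lra.
  have := Hq (Num.min q0 q1 / 2); rewrite mq ?ge_min ?lexx// => /(_ isT).
  have := HM x (Num.min q0 q1 / 2) bx; rewrite mq ?ge_min ?lexx ?orbT// => /(_ isT).
  rewrite -/G; move: (busemann_density C _ * _) => s sM; rewrite ltr_norml => /andP[h _].
  lra.
split=> //; have M0 : 0 < M by exact: lt_le_trans GM.
rewrite -[leLHS](sqr_sqrtr (ltW hp)).
have Mc0 : dot x (normal C x) <= Mc.
  have := dot_le_enorm x (normal C x); rewrite nu.1 mulr1 => /ler_normlW/le_trans; apply.
  by apply: CM; exact: boundary_sub.
have step : Num.sqrt (gauss_kronecker C x) <= M * Num.sqrt (2 * Mc) ^+ d.+2.
  have -> : Num.sqrt (gauss_kronecker C x) = G * Num.sqrt (2 * dot x (normal C x)) ^+ d.+2.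
    by rewrite /G divfK// gt_eqF.
  apply: ler_pM; rewrite ?(ltW G0) ?(ltW s0)//.
  rewrite lerXn2r ?nnegrE ?sqrtr_ge0//; apply: ler_wsqrtr.
  by rewrite ler_pM2l.
rewrite ler_sqr ?nnegrE ?sqrtr_ge0//.
by apply: le_trans step; exact: sqrtr_ge0.
Qed.

End FloatingLimit.

Theorem theorem4p5 (R : realType) (n : nat) (C : set 'rV[R]_n) :
  (2 <= n)%N ->
  convex_bodies_around0 C ->
  C11_boundary C ->
  let F (lambda : R) : \bar R :=
    (busemann_floating_area C [set lambda *: x | x in C]
     * ((1 - lambda) `^ (n.-1%:R / 2))%:E)%E in
  cvg (F @ 1^'-) /\
  centro_affine_area C = ((2 `^ (n.-1%:R / 2))%:E * lim (F @ 1^'-))%E.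
Proof.
case: n C => [//|d] C _ [coC cC iC] C11 F.
have clC : closed C by apply: compact_closed => //; exact: norm_hausdorff.
have mD : (@hausdorff R d d.+1).-cara.-measurable (boundary C).
  exact/hausdorff_closed_measurable/closed_boundary.
have [muD [M [q1 [/andP[q10 q11] HM]]]] := boundary_uniform_bounds coC cC iC C11.
have {}muD : (@surface_measure R d.+1 (boundary C) < +oo)%E by [].
have [N HN] := curvature_bound coC cC iC q10 HM.
pose al : R := d.+2%:R^-1; pose be : R := d%:R / d.+2%:R.
have al0 : 0 < al by rewrite invr_gt0.
have be0 : 0 <= be by rewrite divr_ge0.
pose a (x : 'rV[R]_d.+1) : R := gauss_kronecker C x `^ al.
pose b_ (x : 'rV[R]_d.+1) : R := (Num.sqrt (gauss_kronecker C x) /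
  Num.sqrt (2 * dot x (normal C x)) ^+ d.+2) `^ be.
pose f (x : 'rV[R]_d.+1) : R := a x * b_ x.
have a_eq0 x : gauss_kronecker C x = 0 -> a x = 0.
  by rewrite /a => ->; rewrite powR0// gt_eqF.
have aN x : boundary C x -> 0 <= a x <= Num.max 0 N `^ al.
  move=> bx; rewrite powR_ge0 /=; have [h0|h0] := eqVneq (gauss_kronecker C x) 0.
    by rewrite a_eq0// powR_ge0.
  have [_ hN] := HN x bx h0; have h00 := gauss_kronecker_ge0 coC cC iC bx.
  by rewrite ge0_ler_powR ?(ltW al0)// ?nnegrE// ?le_max ?lexx ?hN ?orbT.
have fN x : boundary C x -> 0 <= f x <= Num.max 0 N `^ al * M `^ be.
  move=> bx; rewrite /f mulr_ge0 ?powR_ge0//=.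
  have [h0|h0] := eqVneq (gauss_kronecker C x) 0.
    by rewrite a_eq0// mul0r mulr_ge0 ?powR_ge0.
  have [hM _] := HN x bx h0; have g0 : 0 <= Num.sqrt (gauss_kronecker C x) /
      Num.sqrt (2 * dot x (normal C x)) ^+ d.+2.
    by rewrite divr_ge0 ?exprn_ge0 ?sqrtr_ge0.
  apply: ler_pM; rewrite ?powR_ge0//; first by case/andP: (aN _ bx).
  by rewrite ge0_ler_powR// nnegrE//; exact: le_trans hM.
pose L := (\int[surface_measure]_(x in boundary C) (f x)%:E)%E.
have Lfin : L \is a fin_num by exact: (lower_integral_fin mD muD fN).
have Fu (u : R^nat) : (forall k, u k < 1) /\ u k @[k --> \oo] --> (1 : R) ->
    F (u k) @[k --> \oo] --> (fine L)%:E.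
  rewrite (fineK Lfin) => -[u1 ucvg].
  have m0 : 0 < Num.min 1 (q1 ^+ 2) by rewrite lt_min ltr01 exprn_gt0.
  have [n0 _ Hn0] := iffLR (cvgrPdist_lt _ _) ucvg _ m0.
  pose l k := u (k + n0)%N.
  have lP k : 0 < l k < 1 /\ 0 < Num.sqrt (1 - l k) < q1.
    have lk1 : l k < 1 by exact: u1.
    have lk : 0 < 1 - l k by rewrite subr_gt0.
    have := Hn0 (k + n0)%N (leq_addl _ _); rewrite /= -/(l k) gtr0_norm// lt_min => /andP[h1 h2].
    split; first by rewrite lk1 andbT; lra.
    by rewrite sqrtr_gt0 lk /= -ltr_sqr ?nnegrE ?sqrtr_ge0 ?(ltW q10)// sqr_sqrtr ?(ltW lk).
  have lcvg : l k @[k --> \oo] --> (1 : R) by rewrite /l; move: ucvg; rewrite -(cvg_shiftn n0).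
  rewrite -(cvg_shiftn n0).
  have -> : [sequence F (u (k + n0)%N)]_k =
      (fun k => \int[surface_measure]_(x in boundary C) (a x * floating_factor C (l k) x)%:E)%E.
    by apply/funext => k; have [l01 _] := lP k; exact: (floating_area_scale coC cC iC).
  apply: (lower_dominated_convergence mD muD (b := fun k => floating_factor C (l k)) aN).
  - by move=> k; have [l01 _] := lP k; exact: measurable_floating_factor.
  - move=> k x bx; have [/andP[lk0 lk1] lq] := lP k.
    rewrite floating_factor_ge0//=; apply: (floating_factor_le coC cC iC bx); first by rewrite lk0.
    have := HM x _ bx lq; rewrite sqr_sqrtr ?subKr; first exact.
    by rewrite subr_ge0 ltW.
  - move=> x bx ax; apply: floating_factor_cvg => //.
      by apply: contraTneq ax => /a_eq0 ->; rewrite ltxx.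
    by move=> k; have [] := lP k.
  - by [].
have FL : F @ 1^'- --> L.
  by rewrite -(fineK Lfin); exact: (iffRL (cvge_at_leftP F 1 (fine L)) Fu).
have p0 : 0 < 2 `^ (d%:R / 2) :> R by exact: powR_gt0.
have LE : L = (((2 `^ (d%:R / 2))^-1)%:E * centro_affine_area C)%E.
  rewrite /centro_affine_area -lower_integralZl ?invr_gt0//; last first.
    by move=> x _; rewrite lee_fin divr_ge0 ?powR_ge0.
  have E x : boundary C x -> f x = (2 `^ (d%:R / 2))^-1 *
      (gauss_kronecker C x `^ (2^-1) / dot x (normal C x) `^ (d%:R / 2)).
    move=> bx; have [h0|h0] := eqVneq (gauss_kronecker C x) 0.
      by rewrite /f a_eq0// h0 powR0 ?invr_eq0// !mul0r mulr0.
    have [hp nu _] := density_limitP coC cC iC bx h0.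
    exact: (floating_exponents d hp (normal_dot_gt0 iC nu)).
  by apply: eq_integral => x; rewrite inE => /E e; exact: (congr1 EFin e).
split; first by apply/cvg_ex; exists L.
have -> : lim (F @ 1^'-) = L by exact: cvg_lim.
by rewrite LE muleA -EFinM divff ?gt_eqF// mul1e.
Qed.
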